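(* (i) There exist a holomorphic endomorphism $f$ of $\mathbb{P}^2$ of degree at least $2$ and a proper attracting set of $f$ containing infinitely many repelling periodic cycles. (ii) There exist a holomorphic endomorphism $f$ of $\mathbb{P}^2$ of degree at least $2$ and a quasi-attractor of $f$ which is not an attracting set.
   Context: An attracting set of $f$ is a compact set $A=\bigcap_{n\ge0}f^n(U)$ where $U\subset\mathbb{P}^2$ is open with $\overline{f(U)}\subset U$; it is proper if $A\neq\mathbb{P}^2$. A quasi-attractor of $f$ is an intersection $\bigcap_{n\ge1}A_n$ of an infinite decreasing sequence $A_1\supset A_2\supset\cdots$ of attracting sets of $f$. *)

(* Defs.v *)
From HB Require Import structures.
From mathcomp Require Import all_boot all_order all_algebra.
From mathcomp Require Import complex.
From mathcomp Require Import all_classical all_reals all_analysis.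
Export Order.TTheory GRing.Theory Num.Theory.
Export numFieldNormedType.Exports.

Set Implicit Arguments.
Unset Strict Implicit.
Unset Printing Implicit Defensive.

Local Open Scope ring_scope.
Local Open Scope classical_set_scope.

(* The complex numbers, viewed as a normed space over themselves (the ^o
   alias provides the mathcomp-analysis topology/normed structure). *)
Definition Cx (R : realType) := ((R[i])^o : numFieldType).

Section P2.
Variable R : realType.
Local Notation C := (Cx R).

Definition hpoly (d : nat) (c : 'I_d.+1 -> 'I_d.+1 -> C) (z : 'rV[C]_3) : C :=
  \sum_(a < d.+1) \sum_(b < d.+1 | (a + b <= d)%N)
     c a b * z 0 0 ^+ a * z 0 1 ^+ b * z 0 2%:R ^+ (d - a - b).

Definition hlift (d : nat) (c : 'I_3 -> 'I_d.+1 -> 'I_d.+1 -> C)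
  (z : 'rV[C]_3) : 'rV[C]_3 := \row_(k < 3) hpoly (c k) z.

(* F defines a holomorphic endomorphism of P^2: F^{-1}(0) = {0} *)
Definition P2nondeg (d : nat) (c : 'I_3 -> 'I_d.+1 -> 'I_d.+1 -> C) :=
  forall z : 'rV[C]_3, z != 0 -> hlift c z != 0.

(** * The projective plane, as normalized representatives:
      first nonzero homogeneous coordinate equal to 1 *)

Definition normalized (z : 'rV[C]_3) : bool :=
  [exists k : 'I_3, (z 0 k == 1) && [forall j : 'I_3, (j < k)%N ==> (z 0 j == 0)]].

Definition P2 := {z : 'rV[C]_3 | normalized z}.

Definition e0 : 'rV[C]_3 := \row_(j < 3) (j == 0 :> 'I_3)%:R.

Lemma e0_normalized : normalized e0.
Proof.
apply/existsP; exists 0; rewrite /e0 mxE eqxx /= eqxx /=.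
by apply/forallP => j; rewrite /= ?ltn0.
Qed.

Definition P2e0 : P2 := exist _ e0 e0_normalized.

Definition firstnz (z : 'rV[C]_3) : option 'I_3 :=
  [pick k : 'I_3 | (z 0 k != 0) && [forall j : 'I_3, (j < k)%N ==> (z 0 j == 0)]].

Definition P2of (z : 'rV[C]_3) : P2 :=
  match firstnz z with
  | Some k => insubd P2e0 ((z 0 k)^-1 *: z)
  | None => P2e0
  end.

Definition endo (d : nat) (c : 'I_3 -> 'I_d.+1 -> 'I_d.+1 -> C) (p : P2) : P2 :=
  P2of (hlift c (val p)).

(** * Topology of P^2 (quotient topology of C^3 \ {0}) *)

Definition P2open (U : set P2) : Prop :=
  open [set z : 'rV[C]_3 | z != 0 /\ U (P2of z)].

Definition P2closure (S : set P2) : set P2 :=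
  [set p | forall U, P2open U -> U p -> exists q, U q /\ S q].

Definition P2compact (A : set P2) : Prop :=
  forall (I : Type) (U : I -> set P2), (forall i, P2open (U i)) ->
    A `<=` \bigcup_i U i ->
    exists J : set I, finite_set J /\ A `<=` \bigcup_(i in J) U i.

Definition attracting_set (f : P2 -> P2) (A : set P2) : Prop :=
  P2compact A /\
  exists U : set P2, P2open U /\ P2closure (f @` U) `<=` U /\
    A = \bigcap_(n in [set: nat]) (iter n f @` U).

Definition proper_attracting_set (f : P2 -> P2) (A : set P2) : Prop :=
  attracting_set f A /\ A <> [set: P2].

Definition quasi_attractor (f : P2 -> P2) (Q : set P2) : Prop :=
  exists An : nat -> set P2,
    (forall n, attracting_set f (An n)) /\
    (forall n, An n.+1 `<=` An n) /\
    Q = \bigcap_(n in [set: nat]) An n.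

Definition chart (k : 'I_3) (z : 'rV[C]_3) : 'rV[C]_2 :=
  \row_(j < 2) (z 0 (lift k j) / z 0 k).

Definition unchart (k : 'I_3) (u : 'rV[C]_2) : 'rV[C]_3 :=
  \row_(j < 3) match unlift k j with Some j' => u 0 j' | None => 1 end.

Definition in_chart (k : 'I_3) (g : P2 -> P2) (u : 'rV[C]_2) : 'rV[C]_2 :=
  chart k (val (g (P2of (unchart k u)))).

Definition repelling_fixed (g : P2 -> P2) (p : P2) : Prop :=
  g p = p /\
  exists k : 'I_3, val p 0 k != 0 /\
    differentiable (in_chart k g) (chart k (val p)) /\
    forall a : C, eigenvalue ('J (in_chart k g) (chart k (val p))) a -> 1 < `|a|.

Definition repelling_periodic (f : P2 -> P2) (p : P2) : Prop :=
  exists n : nat, (0 < n)%N /\ repelling_fixed (iter n f) p.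

Definition cycle_of (f : P2 -> P2) (p : P2) : set P2 :=
  [set iter k f p | k in [set: nat]].

Definition repelling_cycles_in (f : P2 -> P2) (A : set P2) : set (set P2) :=
  [set Cy | exists p, repelling_periodic f p /\ Cy = cycle_of f p /\ Cy `<=` A].

End P2.

(* Main.v *)
Require Import Defs.
From HB Require Import structures.
From mathcomp Require Import all_boot all_order all_algebra.
From mathcomp Require Import complex finmap.
From mathcomp Require Import all_classical all_reals all_analysis.
From mathcomp Require Import ring lra zify.
Import Order.TTheory GRing.Theory Num.Theory numFieldNormedType.Exports.
Local Open Scope ring_scope.
Local Open Scope classical_set_scope.
Set Implicit Arguments.
Unset Strict Implicit.
Unset Printing Implicit Defensive.

(** The affine map [(z, w) |-> (zpoly t z / kappa b + b w + tiny w^4, z + tiny z^4)] extends to an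
    endomorphism of degree 4 of the projective plane, for which [{|w| < max (4 |u|, |z|)}] is a trap
    in the coordinates [[z : w : u]].  An orbit is the same thing as a solution of the three-term
    recurrence [zpoly t (z i) = kappa b (z (i + 1) - psi (z (i - 1)))]; as [kappa b] is tiny, the
    solutions with a prescribed itinerary are fixed points of a contraction.  The origin is a saddle
    with multipliers [1 / zeta] and [- b zeta], and [t = tau b] is chosen so that the fold of [zpoly]
    at [z = 2] creates a homoclinic tangency.  A cycle that leaves the fold, spends [m] and [n] steps
    near the saddle and returns with eigenvalue 2 closes up where [b (b zeta)^n - zeta^m], up to small
    errors, changes sign, hence for a dense set of [b].  Since the Jacobian determinant is about [- b]
    there, with [b >= 2], that cycle is repelling, and it persists for nearby [b]; nested intervals
    give a parameter with infinitely many repelling cycles, all in the trap.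

    The map is injective on the part of the trap near these cycles, so that a small ball around a
    repelling cycle can only be reached from a smaller one: deleting these balls from a trap leaves
    a trap.  Deleting the cycles one after the other gives a decreasing sequence of attracting sets.
    If its intersection had a trap, compactness would put one of the deleted cycles inside it. *)

(** * Contractions of boxes *)

Lemma nested_intervals (R : realType) (a b : R^nat) :
  nondecreasing_seq a -> nonincreasing_seq b -> (forall n, a n <= b n) ->
  exists l, forall n, a n <= l <= b n.
Proof.
move=> a_nd b_ni ab.
have cross m n : a m <= b n.
  apply: le_trans (a_nd _ _ (leq_maxl m n)) _.
  exact: le_trans (ab _) (b_ni _ _ (leq_maxr m n)).
exists (sup (range a)) => n; apply/andP; split.
  by apply: ub_le_sup; [exists (b 0%N) => _ [m _ <-] | exists n].
by apply: ge_sup => [|_ [m _ <-]] //; exists (a 0%N), 0%N.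
Qed.

Lemma ler_add_half_pow (R : realType) (x y c : R) :
  (forall n, x <= y + c * 2^-1 ^+ n) -> x <= y.
Proof.
move=> x_le; have lim : y + c * 2^-1 ^+ n @[n --> \oo] --> y + c * 0.
  apply: cvgD; first exact: cvg_cst.
  by apply: cvgMr; apply: cvg_expr; rewrite ger0_norm ?invf_lt1 //; lra.
rewrite mulr0 addr0 in lim; apply: (cvgr_to_ge lim).
by apply: nearW => n; apply: x_le.
Qed.

Lemma geometric_steps_limit (R : realType) (u : R^nat) (c : R) :
  (forall n, `|u n.+1 - u n| <= c * 2^-1 ^+ n) ->
  exists l, forall n, `|l - u n| <= 2 * c * 2^-1 ^+ n.
Proof.
move=> step; pose err n := 2 * c * 2^-1 ^+ n.
have errS n : err n = err n.+1 + c * 2^-1 ^+ n by rewrite /err exprS; field.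
have err_ge0 n : 0 <= err n.
  by rewrite /err -mulrA pmulr_rge0 //; apply: le_trans (step n).
have [|||l l_in] := @nested_intervals _ (fun n => u n - err n) (fun n => u n + err n).
- apply/nondecreasing_seqP => n; have := step n; rewrite (errS n) ler_norml; lra.
- apply/nonincreasing_seqP => n; have := step n; rewrite (errS n) ler_norml; lra.
- by move=> n; have := err_ge0 n; lra.
by exists l => n; have := l_in n; rewrite -/(err n) ler_norml; lra.
Qed.

Section BoxContraction.
Variables (R : realType) (J : Type) (c r : J -> R) (T : (J -> R) -> J -> R).

Definition box (u : J -> R) := forall j, `|u j - c j| <= r j.

(* The weights [rho] need not be the radii of the box: this is how decay estimates are obtained. *)
Definition halves (rho : J -> R) := forall (D : R) (u u' : J -> R), 0 <= D ->
  box u -> box u' -> (forall j, `|u j - u' j| <= D * rho j) ->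
  forall j, `|T u j - T u' j| <= D / 2 * rho j.

Lemma box_dist u u' : box u -> box u' -> forall j, `|u j - u' j| <= 2 * r j.
Proof.
move=> bu bu' j; have -> : u j - u' j = (u j - c j) - (u' j - c j) by ring.
by apply: le_trans (ler_normB _ _) _; have := bu j; have := bu' j; lra.
Qed.

Lemma box_fixed_point : (forall j, 0 <= r j) -> (forall u, box u -> box (T u)) ->
  halves r -> exists2 u, box u & forall j, T u j = u j.
Proof.
move=> r_ge0 Tbox Thalves; pose u n := iter n T c; pose h n : R := 2^-1 ^+ n.
have h_ge0 n : 0 <= h n by rewrite exprn_ge0 // invr_ge0.
have bc : box c by move=> j; rewrite subrr normr0.
have bu n : box (u n) by elim: n => //= n; apply: Tbox.
have step n j : `|u n.+1 j - u n j| <= r j * h n.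
  rewrite mulrC; elim: n j => [|n IH] j; first by rewrite /h mul1r; apply: Tbox.
  by have := Thalves _ _ _ (h_ge0 n) (bu n.+1) (bu n) IH j; rewrite /h exprSr.
have [l ul] := choice (fun j => geometric_steps_limit (step^~ j)).
have bl : box l.
  move=> j; apply: (@ler_add_half_pow _ _ _ (2 * r j)) => n; rewrite -/(h n).
  rewrite -(subrKA (u n j)) addrC; apply: le_trans (ler_normD _ _) _.
  by apply: lerD; [apply: bu | apply: ul].
exists l => // j; apply/eqP; rewrite -subr_eq0 -normr_le0.
apply: (@ler_add_half_pow _ _ _ (2 * r j)) => n; rewrite add0r -/(h n).
have h2_ge0 : 0 <= 2 * h n by have := h_ge0 n; lra.
have Tl := Thalves (2 * h n) l (u n) h2_ge0 bl (bu n) (fun j => ltac:(rewrite mulrAC; exact: ul)) j.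
have := ul j n.+1; rewrite exprSr -/(h n) distrC => ulS.
rewrite -(subrKA (T (u n) j)); apply: le_trans (ler_normD _ _) _.
by move: Tl ulS; rewrite -[T (u n) j]/(u n.+1 j); lra.
Qed.

Lemma box_fixed_point_stable (rho : J -> R) (e D : R) (u u' : J -> R) :
  halves rho -> 0 <= e -> 0 <= D -> box u -> box u' -> (forall j, 0 <= rho j) ->
  (forall j, T u j = u j) -> (forall j, `|u j - u' j| <= D * rho j) ->
  (forall j, `|T u' j - u' j| <= e * rho j) ->
  forall j, `|u j - u' j| <= 2 * e * rho j.
Proof.
move=> Thalves e_ge0 D_ge0 bu bu' rho_ge0 fixed_u near_u u'_defect j.
have closer n : forall j, `|u j - u' j| <= (2 * e + D * 2^-1 ^+ n) * rho j.
  elim: n => [|n IH] i.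
    by apply: le_trans (near_u i) _; rewrite expr0 mulr1 ler_wpM2r //; lra.
  have coef_ge0 : 0 <= 2 * e + D * 2^-1 ^+ n.
    by rewrite addr_ge0 ?mulr_ge0 // exprn_ge0 // invr_ge0.
  have := Thalves _ _ _ coef_ge0 bu bu' IH i; rewrite fixed_u => Tuu'.
  have := ler_normD (u i - T u' i) (T u' i - u' i); rewrite subrKA exprSr.
  by have := u'_defect i; move: Tuu'; lra.
apply: (@ler_add_half_pow _ _ _ (D * rho j)) => n.
by have := closer n j; rewrite mulrDl -!mulrA [rho j * _]mulrC.
Qed.

End BoxContraction.

(** * The polynomials of the family and their divided differences *)

Section FamilyPolynomials.
Variable K : fieldType.
Implicit Types t x y b e w : K.

Definition zpoly t z := z * (1 - z) * ((z - 2) ^+ 2 + t * z) / 4.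
Definition wpoly b e w := b * w + e * w ^+ 4.
Definition qpoly e z := z + e * z ^+ 4.
Definition psi b e z := wpoly b e (qpoly e z).

Definition ddzpoly t x y := (4 - 8 * (x + y) + 5 * (x * x + x * y + y * y)
  - (x * x * x + x * x * y + x * y * y + y * y * y)
  + t * (x + y) - t * (x * x + x * y + y * y)) / 4.
Definition ddquartic x y := x * x * x + x * x * y + x * y * y + y * y * y.
Definition ddwpoly b e x y := b + e * ddquartic x y.
Definition ddqpoly e x y := 1 + e * ddquartic x y.
Definition ddpsi b e x y := ddwpoly b e (qpoly e x) (qpoly e y) * ddqpoly e x y.

Definition dzpoly t z := ddzpoly t z z.
Definition dwpoly b e w := ddwpoly b e w w.
Definition dqpoly e z := ddqpoly e z z.
Definition dpsi b e z := ddpsi b e z z.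

Lemma zpolyB t x y : zpoly t x - zpoly t y = ddzpoly t x y * (x - y).
Proof. by rewrite /zpoly /ddzpoly; ring. Qed.

Lemma ddzpolyC t x y : ddzpoly t x y = ddzpoly t y x.
Proof. by rewrite /ddzpoly; ring. Qed.

Lemma ddquarticC x y : ddquartic x y = ddquartic y x.
Proof. by rewrite /ddquartic; ring. Qed.

Lemma wpolyB b e x y : wpoly b e x - wpoly b e y = ddwpoly b e x y * (x - y).
Proof. by rewrite /wpoly /ddwpoly /ddquartic; ring. Qed.

Lemma qpolyB e x y : qpoly e x - qpoly e y = ddqpoly e x y * (x - y).
Proof. by rewrite /qpoly /ddqpoly /ddquartic; ring. Qed.

Lemma psiB b e x y : psi b e x - psi b e y = ddpsi b e x y * (x - y).
Proof. by rewrite /psi wpolyB qpolyB mulrA. Qed.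

Lemma psi0 b e : psi b e 0 = 0.
Proof. by rewrite /psi /wpoly /qpoly; ring. Qed.

End FamilyPolynomials.

Section FamilyMorphisms.
Variables (K K' : fieldType) (f : {rmorphism K -> K'}).

Lemma rmorph_ddquartic x y : f (ddquartic x y) = ddquartic (f x) (f y).
Proof. by rewrite /ddquartic !rmorphD !rmorphM. Qed.

Lemma rmorph_zpoly t z : f (zpoly t z) = zpoly (f t) (f z).
Proof.
rewrite /zpoly rmorphM fmorphV rmorph_nat (rmorphM f (z * _)) (rmorphM f z) (rmorphB f 1).
by rewrite rmorph1 rmorphD (rmorphM f t) rmorphXn rmorphB rmorph_nat.
Qed.

Lemma rmorph_dzpoly t z : f (dzpoly t z) = dzpoly (f t) (f z).
Proof.
rewrite /dzpoly /ddzpoly rmorphM fmorphV rmorph_nat; congr (_ * _).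
rewrite rmorphB rmorphD rmorphB rmorphD rmorphB (rmorphM f 8) (rmorphM f 5) !(rmorphM f t).
by rewrite !rmorph_nat !rmorphD !rmorphM.
Qed.

Lemma rmorph_wpoly b e w : f (wpoly b e w) = wpoly (f b) (f e) (f w).
Proof. by rewrite /wpoly rmorphD (rmorphM f b) (rmorphM f e) rmorphXn. Qed.

Lemma rmorph_dwpoly b e w : f (dwpoly b e w) = dwpoly (f b) (f e) (f w).
Proof. by rewrite /dwpoly /ddwpoly rmorphD (rmorphM f e) rmorph_ddquartic. Qed.

Lemma rmorph_qpoly e z : f (qpoly e z) = qpoly (f e) (f z).
Proof. by rewrite /qpoly rmorphD (rmorphM f e) rmorphXn. Qed.

Lemma rmorph_dqpoly e z : f (dqpoly e z) = dqpoly (f e) (f z).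
Proof. by rewrite /dqpoly /ddqpoly rmorphD (rmorphM f e) rmorph_ddquartic rmorph1. Qed.

End FamilyMorphisms.

Section FamilyEstimates.
Variable R : realType.
Implicit Types t x y z b e v : R.

Lemma normrM_le x y c d : `|x| <= c -> `|y| <= d -> `|x * y| <= c * d.
Proof. by move=> xc yd; rewrite normrM ler_pM. Qed.

Lemma sqr_le_norm x c : `|x| <= c -> x ^+ 2 <= c ^+ 2.
Proof. by move=> xc; rewrite -real_normK ?num_real // lerXn2r // nnegrE // (le_trans _ xc). Qed.

Lemma normr_le_near x y c d : `|x - y| <= c -> `|y| <= d -> `|x| <= c + d.
Proof. by move=> xy yd; rewrite -(subrK y x) (le_trans (ler_normD _ _)) // lerD. Qed.

Lemma ddzpoly_lipschitzl t x x' y : `|t| <= 1 -> `|x| <= 3 -> `|x'| <= 3 -> `|y| <= 3 ->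
  `|ddzpoly t x y - ddzpoly t x' y| <= 30 * `|x - x'|.
Proof.
move=> ht hx hx' hy.
have -> : ddzpoly t x y - ddzpoly t x' y = ((- 8 + 5 * (x + x' + y)
   - (x * x + x * x' + x' * x' + x * y + x' * y + y * y)
   + t - (t * x + t * x' + t * y)) / 4) * (x - x').
  by rewrite /ddzpoly; field.
rewrite normrM ler_wpM2r //.
have := normrM_le hx hx; have := normrM_le hx hx'; have := normrM_le hx' hx'.
have := normrM_le hx hy; have := normrM_le hx' hy; have := normrM_le hy hy.
have := normrM_le ht hx; have := normrM_le ht hx'; have := normrM_le ht hy.
by move: ht hx hx' hy; rewrite !ler_norml; lra.
Qed.

Lemma ddzpoly_lipschitz t t' x x' y y' : `|t| <= 1 -> `|x| <= 3 -> `|x'| <= 3 ->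
  `|y| <= 3 -> `|y'| <= 3 ->
  `|ddzpoly t x y - ddzpoly t' x' y'| <= 30 * (`|x - x'| + `|y - y'|) + 9 * `|t - t'|.
Proof.
move=> ht hx hx' hy hy'.
have in_x := ddzpoly_lipschitzl ht hx hx' hy.
have in_y := ddzpoly_lipschitzl ht hy hy' hx'; rewrite !(ddzpolyC t _ x') in in_y.
have in_t : `|ddzpoly t x' y' - ddzpoly t' x' y'| <= 9 * `|t - t'|.
  have -> : ddzpoly t x' y' - ddzpoly t' x' y' =
    ((x' + y' - (x' * x' + x' * y' + y' * y')) / 4) * (t - t') by rewrite /ddzpoly; field.
  rewrite normrM ler_wpM2r //.
  have := normrM_le hx' hx'; have := normrM_le hx' hy'; have := normrM_le hy' hy'.
  by move: hx' hy'; rewrite !ler_norml; lra.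
rewrite -(subrKA (ddzpoly t x' y)) -(subrKA (ddzpoly t x' y') (ddzpoly t x' y)).
by rewrite (le_trans (ler_normD _ _)) // (le_trans (lerD (lexx _) (ler_normD _ _))) //; lra.
Qed.

Lemma dzpoly_lipschitz t t' x y : `|t| <= 1 -> `|x| <= 3 -> `|y| <= 3 ->
  `|dzpoly t x - dzpoly t' y| <= 60 * `|x - y| + 9 * `|t - t'|.
Proof. by move=> ht hx hy; have := ddzpoly_lipschitz t' ht hx hy hx hy; rewrite /dzpoly; lra. Qed.

Lemma zpoly_taylor t x y : `|t| <= 1 -> `|x| <= 3 -> `|y| <= 3 ->
  `|zpoly t x - zpoly t y - dzpoly t y * (x - y)| <= 30 * (x - y) ^+ 2.
Proof.
move=> ht hx hy; rewrite zpolyB -mulrBl -(real_normK (num_real (x - y))) expr2 mulrA normrM.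
by rewrite ler_wpM2r // ddzpoly_lipschitzl.
Qed.

Lemma ddzpoly_near1 t x y : `|t| <= 1 -> `|x| <= 3 -> `|y| <= 3 ->
  `|ddzpoly t x y - 1| <= 30 * (`|x| + `|y|).
Proof.
move=> ht hx hy; have h0 : `|0 : R| <= 3 by rewrite normr0.
have := ddzpoly_lipschitz t ht hx h0 hy h0.
by rewrite (_ : ddzpoly t 0 0 = 1) ?subrr ?subr0 ?normr0 ?mulr0 ?addr0 // /ddzpoly; field.
Qed.

(* The two zeros of [zpoly] visited by the orbits, 0 and 1; [inv_slope] is the inverse of the slope
   of [zpoly 0] there. *)
Definition site_val (s : bool) : R := s%:R.
Definition inv_slope (s : bool) : R := if s then - 4 else 1.

Lemma inv_slope_norm s : `|inv_slope s| <= 4.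
Proof. by case: s; rewrite /= ler_norml; lra. Qed.

Lemma zpoly_site t s : zpoly t (site_val s) = 0.
Proof. by rewrite /zpoly /site_val; case: s => /=; ring. Qed.

Lemma norm_near_site s y : `|y - site_val s| <= 100^-1 ^+ 2 -> `|y| <= 3.
Proof. by rewrite !ler_norml /site_val; case: s => /=; lra. Qed.

Lemma inv_slope_ddzpoly s t x y : `|t| <= 10^-1 ^+ 3 -> `|x - site_val s| <= 100^-1 ^+ 2 ->
  `|y - site_val s| <= 100^-1 ^+ 2 -> `|1 - inv_slope s * ddzpoly t x y| <= 30^-1.
Proof.
move=> ht hx hy; have t1 : `|t| <= 1 by lra.
have s3 : `|site_val s| <= 3 by rewrite /site_val ler_norml; case: s {hx hy} => /=; lra.
have := ddzpoly_lipschitz t t1 (norm_near_site hx) s3 (norm_near_site hy) s3.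
have -> : ddzpoly t (site_val s) (site_val s) = if s then - (1 + t) / 4 else 1.
  by rewrite /ddzpoly /site_val; case: (s) => /=; field.
rewrite subrr normr0 mulr0 addr0 => /le_trans/(_ (ler_wpM2l _ (lerD hx hy))) bound.
have {bound} := bound ltac:(lra); move: ht; rewrite !ler_norml /inv_slope.
by case: (s) => /=; move: (ddzpoly t x y) => slope; lra.
Qed.

Lemma newton_step_lipschitz s t t' y y' : `|t| <= 10^-1 ^+ 3 ->
  `|y - site_val s| <= 100^-1 ^+ 2 -> `|y' - site_val s| <= 100^-1 ^+ 2 ->
  `|(y - inv_slope s * zpoly t y) - (y' - inv_slope s * zpoly t' y')| <=
  10^-1 * `|y - y'| + 2 * `|y' - site_val s| * `|t - t'|.
Proof.
move=> ht hy hy'.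
have -> : (y - inv_slope s * zpoly t y) - (y' - inv_slope s * zpoly t' y') =
   (1 - inv_slope s * ddzpoly t y y') * (y - y')
   - (inv_slope s * (y' ^+ 2 * (1 - y') / 4)) * (t - t').
  by rewrite /zpoly /ddzpoly; field.
apply: le_trans (ler_normB _ _) _; apply: lerD.
  have := normrM_le (inv_slope_ddzpoly ht hy hy') (lexx `|y - y'|).
  by have := normr_ge0 (y - y'); lra.
rewrite normrM ler_wpM2r //; case: s hy' {hy} => hy'; rewrite /inv_slope /site_val /= in hy' *.
  have -> : - 4 * (y' ^+ 2 * (1 - y') / 4) = (y' - 1) * y' ^+ 2 by field.
  rewrite normrM mulrC ler_wpM2r // ger0_norm ?sqr_ge0 //.
  have y'_le : `|y'| <= 4 / 3 by move: hy'; rewrite !ler_norml; lra.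
  by have := sqr_le_norm y'_le; lra.
have -> : 1 * (y' ^+ 2 * (1 - y') / 4) = y' * (y' * (1 - y') / 4) by field.
rewrite subr0 in hy' *; rewrite normrM mulrC ler_wpM2r //.
have y'_le : `|1 - y'| <= 2 by move: hy'; rewrite !ler_norml; lra.
by have := normrM_le hy' y'_le; rewrite !ler_norml; lra.
Qed.

Lemma fold_slope_lipschitz t t' v v' : `|t| <= 10^-1 ^+ 3 -> `|t'| <= 10^-1 ^+ 3 ->
  `|v| <= 10^-1 ^+ 3 -> `|v'| <= 10^-1 ^+ 3 ->
  `|(v + dzpoly t (2 + v)) - (v' + dzpoly t' (2 + v'))| <= 10^-1 * `|v - v'| + 3 * `|t - t'|.
Proof.
move=> ht ht' hv hv'.
have -> : (v + dzpoly t (2 + v)) - (v' + dzpoly t' (2 + v')) =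
  (- (9 * (v + v') + 4 * (v * v + v * v' + v' * v') + 10 * t + 3 * (t * v) + 3 * (t * v')) / 4)
     * (v - v')
  + (- (8 + 10 * v' + 3 * (v' * v')) / 4) * (t - t').
  by rewrite /dzpoly /ddzpoly; field.
apply: le_trans (ler_normD _ _) _.
have := normrM_le hv hv; have := normrM_le hv' hv'; have := normrM_le hv hv'.
have := normrM_le ht hv; have := normrM_le ht hv'.
move: ht hv hv'; rewrite !ler_norml => ? ? ? ? ? ? ? ?.
by apply: lerD; rewrite normrM; (apply: ler_wpM2r; [exact: normr_ge0 | rewrite ler_norml; lra]).
Qed.

Lemma ddzpoly_fold t v v' : `|t| <= 10^-1 ^+ 3 -> `|v| <= 10^-1 ^+ 3 -> `|v'| <= 10^-1 ^+ 3 ->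
  `|ddzpoly t (2 + v) (2 + v')| <= 100^-1.
Proof.
move=> ht hv hv'.
have -> : ddzpoly t (2 + v) (2 + v') = - (2 * (v + v') + 3 * (v * v + v * v' + v' * v')
  + (v * (v * v) + v * (v * v') + v' * (v * v') + v' * (v' * v')) + 8 * t
  + 5 * (t * v) + 5 * (t * v') + t * (v * v) + t * (v * v') + t * (v' * v')) / 4.
  by rewrite /ddzpoly; field.
have vv := normrM_le hv hv; have vv' := normrM_le hv hv'; have v'v' := normrM_le hv' hv'.
have := normrM_le hv vv; have := normrM_le hv vv'; have := normrM_le hv' vv'.
have := normrM_le hv' v'v'; have := normrM_le ht vv; have := normrM_le ht vv'.
have := normrM_le ht v'v'; have := normrM_le ht hv; have := normrM_le ht hv'.
by move: ht hv hv' vv vv' v'v'; rewrite !ler_norml; lra.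
Qed.

Lemma fold_value_lipschitz t t' v v' : `|t| <= 10^-1 ^+ 3 -> `|v| <= 10^-1 ^+ 3 ->
  `|v'| <= 10^-1 ^+ 3 ->
  `|(t + zpoly t (2 + v)) - (t' + zpoly t' (2 + v'))| <= 10^-1 * `|t - t'| + 100^-1 * `|v - v'|.
Proof.
move=> ht hv hv'.
have -> : (t + zpoly t (2 + v)) - (t' + zpoly t' (2 + v')) =
   (- (8 * v' + 5 * (v' * v') + v' * (v' * v')) / 4) * (t - t')
   + ddzpoly t (2 + v) (2 + v') * (v - v').
  by rewrite /zpoly /ddzpoly; field.
apply: le_trans (ler_normD _ _) _; apply: lerD; rewrite normrM ler_wpM2r //.
  have v'v' := normrM_le hv' hv'; have := normrM_le hv' v'v'.
  by move: hv' v'v'; rewrite !ler_norml; lra.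
exact: ddzpoly_fold.
Qed.

Section SmallQuartic.
Variable e : R.
Hypothesis e_range : 0 <= e <= 10^-1 ^+ 6.

Lemma ddquartic_lipschitzl x x' y : `|x| <= 4 -> `|x'| <= 4 -> `|y| <= 4 ->
  `|e * ddquartic x y - e * ddquartic x' y| <= 10^-1 ^+ 4 * `|x - x'|.
Proof.
move=> hx hx' hy; have he : `|e| <= 10^-1 ^+ 6 by have := e_range; rewrite ler_norml; lra.
have -> : e * ddquartic x y - e * ddquartic x' y =
  (e * (x * x) + e * (x * x') + e * (x' * x') + e * (x * y) + e * (x' * y) + e * (y * y)) * (x - x').
  by rewrite /ddquartic; ring.
rewrite normrM ler_wpM2r //.
have := normrM_le he (normrM_le hx hx); have := normrM_le he (normrM_le hx hx').
have := normrM_le he (normrM_le hx' hx'); have := normrM_le he (normrM_le hx hy).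
have := normrM_le he (normrM_le hx' hy); have := normrM_le he (normrM_le hy hy).
by rewrite !ler_norml; lra.
Qed.

Lemma ddquartic_lipschitz x x' y y' : `|x| <= 4 -> `|x'| <= 4 -> `|y| <= 4 -> `|y'| <= 4 ->
  `|e * ddquartic x y - e * ddquartic x' y'| <= 10^-1 ^+ 4 * (`|x - x'| + `|y - y'|).
Proof.
move=> hx hx' hy hy'; rewrite -(subrKA (e * ddquartic x' y)) [leRHS]mulrDr.
apply: le_trans (ler_normD _ _) _; apply: lerD; first exact: ddquartic_lipschitzl.
by rewrite !(ddquarticC x'); exact: ddquartic_lipschitzl.
Qed.

Lemma ddquartic_small x y : `|x| <= 4 -> `|y| <= 4 ->
  `|e * ddquartic x y| <= 10^-1 ^+ 4 * (`|x| + `|y|).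
Proof.
move=> hx hy; have h0 : `|0 : R| <= 4 by rewrite normr0.
have := ddquartic_lipschitz hx h0 hy h0.
by rewrite (_ : ddquartic 0 0 = 0) ?mulr0 ?subr0 // /ddquartic; ring.
Qed.

Lemma ddqpoly_norm x y : `|x| <= 4 -> `|y| <= 4 -> `|ddqpoly e x y| <= 101 / 100.
Proof.
move=> hx hy; rewrite /ddqpoly (le_trans (ler_normD _ _)) // normr1.
by have := ddquartic_small hx hy; lra.
Qed.

Lemma qpoly_lipschitz x y : `|x| <= 4 -> `|y| <= 4 ->
  `|qpoly e x - qpoly e y| <= 101 / 100 * `|x - y|.
Proof. by move=> hx hy; rewrite qpolyB normrM ler_wpM2r // ddqpoly_norm. Qed.

Lemma qpoly_norm y : `|y| <= 4 -> `|qpoly e y| <= 101 / 100 * `|y|.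
Proof.
have qpoly0 : qpoly e 0 = 0 by rewrite /qpoly; ring.
by move=> hy; have := @qpoly_lipschitz y 0 hy; rewrite qpoly0 normr0 !subr0; apply.
Qed.

Lemma qpoly_norm4 y : `|y| <= 3 -> `|qpoly e y| <= 4.
Proof.
move=> hy; have y4 : `|y| <= 4 by lra.
by have := qpoly_norm y4; lra.
Qed.

Variable b : R.
Hypothesis b_range : 2 <= b <= 3.

Let b_norm : `|b| <= 3.
Proof. by rewrite ger0_norm; have := b_range; lra. Qed.

Lemma ddwpoly_near x y : `|x| <= 4 -> `|y| <= 4 ->
  `|ddwpoly b e x y - b| <= 10^-1 ^+ 4 * (`|x| + `|y|).
Proof. by move=> hx hy; rewrite /ddwpoly addrC addKr; exact: ddquartic_small. Qed.

Lemma ddpsi_lipschitz x x' y y' : `|x| <= 3 -> `|x'| <= 3 -> `|y| <= 3 -> `|y'| <= 3 ->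
  `|ddpsi b e x y - ddpsi b e x' y'| <= 10^-1 ^+ 3 * (`|x - x'| + `|y - y'|).
Proof.
move=> hx hx' hy hy'; have le4 (u : R) : `|u| <= 3 -> `|u| <= 4 by lra.
have -> : ddpsi b e x y - ddpsi b e x' y' =
  ddwpoly b e (qpoly e x) (qpoly e y) * (e * ddquartic x y - e * ddquartic x' y')
  + (e * ddquartic (qpoly e x) (qpoly e y) - e * ddquartic (qpoly e x') (qpoly e y'))
    * ddqpoly e x' y'.
  by rewrite /ddpsi /ddwpoly /ddqpoly; ring.
have w_norm : `|ddwpoly b e (qpoly e x) (qpoly e y)| <= 31 / 10.
  have := normr_le_near (ddwpoly_near (qpoly_norm4 hx) (qpoly_norm4 hy)) b_norm.
  by have := qpoly_norm4 hx; have := qpoly_norm4 hy; lra.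
have inner := ddquartic_lipschitz (le4 _ hx) (le4 _ hx') (le4 _ hy) (le4 _ hy').
have := ddquartic_lipschitz (qpoly_norm4 hx) (qpoly_norm4 hx') (qpoly_norm4 hy) (qpoly_norm4 hy').
move=> /normrM_le/(_ (ddqpoly_norm (le4 _ hx') (le4 _ hy'))) outer.
apply: le_trans (ler_normD _ _) _; have := normrM_le w_norm inner.
have := qpoly_lipschitz (le4 _ hx) (le4 _ hx'); have := qpoly_lipschitz (le4 _ hy) (le4 _ hy').
by have := normr_ge0 (x - x'); have := normr_ge0 (y - y'); lra.
Qed.

Lemma ddpsi_near x y : `|x| <= 3 -> `|y| <= 3 ->
  `|ddpsi b e x y - b| <= 10^-1 ^+ 3 * (`|x| + `|y|).
Proof.
move=> hx hy; have h0 : `|0 : R| <= 3 by rewrite normr0.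
have := ddpsi_lipschitz hx h0 hy h0; rewrite (_ : ddpsi b e 0 0 = b) ?subr0 //.
by rewrite /ddpsi /ddwpoly /ddqpoly /ddquartic /qpoly; ring.
Qed.

Lemma ddpsi_norm x y : `|x| <= 3 -> `|y| <= 3 -> `|ddpsi b e x y| <= 31 / 10.
Proof. by move=> hx hy; have := normr_le_near (ddpsi_near hx hy) b_norm; lra. Qed.

Lemma dpsi_lipschitz x y : `|x| <= 3 -> `|y| <= 3 ->
  `|dpsi b e x - dpsi b e y| <= 10^-1 ^+ 2 * `|x - y|.
Proof.
move=> hx hy; have := ddpsi_lipschitz hx hy hx hy; have := normr_ge0 (x - y).
by rewrite -/(dpsi b e x) -/(dpsi b e y); lra.
Qed.

Lemma psi_taylor x y : `|x| <= 3 -> `|y| <= 3 ->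
  `|psi b e x - psi b e y - dpsi b e y * (x - y)| <= 10^-1 ^+ 3 * (x - y) ^+ 2.
Proof.
move=> hx hy; rewrite psiB -mulrBl -(real_normK (num_real (x - y))) expr2 mulrA normrM.
rewrite ler_wpM2r //; have := ddpsi_lipschitz hx hy hy hy.
by rewrite subrr normr0 addr0.
Qed.

Lemma psi_lipschitz x y : `|x| <= 3 -> `|y| <= 3 ->
  `|psi b e x - psi b e y| <= 31 / 10 * `|x - y|.
Proof. by move=> hx hy; rewrite psiB normrM ler_wpM2r // ddpsi_norm. Qed.

Lemma psi_norm y : `|y| <= 3 -> `|psi b e y| <= 31 / 10 * `|y|.
Proof. by move=> hy; have := @psi_lipschitz y 0 hy; rewrite normr0 psi0 !subr0; apply. Qed.

End SmallQuartic.

End FamilyEstimates.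

(** * Orbits with a prescribed itinerary *)

(* [Upos i] and [Utan i] are the [z]-coordinates of the point and of the tangent vector at [i],
   [Ufold] is the offset from 2 of the point in the fold, and [Utune] is the parameter [t]. *)
Inductive unknown (I : Type) := Upos of I | Utan of I | Ufold | Utune.
Arguments Upos {I}. Arguments Utan {I}. Arguments Ufold {I}. Arguments Utune {I}.

(* The position [None] is the fold. The weights rescale the tangent vectors of the neighbours. *)
Record itinerary (R : Type) (I : Type) := Itinerary {
  fwd : option I -> option I;
  bwd : option I -> option I;
  wfwd : option I -> R;
  wbwd : option I -> R;
  site : I -> bool
}.

Section OrbitEquations.
Variables (R : realType) (I : Type) (s : itinerary R I) (kap b e : R).
Implicit Types (u : unknown I -> R) (o : option I).

Definition zval u o := if o is Some i then u (Upos i) else 2 + u Ufold.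
Definition ztan u o := if o is Some i then u (Utan i) else 1.

Definition zforce u o := zval u (fwd s o) - psi b e (zval u (bwd s o)).
Definition tforce u o := wfwd s o * ztan u (fwd s o)
  - dpsi b e (zval u (bwd s o)) * (wbwd s o * ztan u (bwd s o)).

Definition zres u o := zpoly (u Utune) (zval u o) - kap * zforce u o.
Definition tres u o := dzpoly (u Utune) (zval u o) * ztan u o - kap * tforce u o.

(* The unknowns [Ufold] and [Utune] can be frozen, at the values [vf] and [tf]. *)
Definition newton (vf tf : option R) u (j : unknown I) : R :=
  match j with
  | Upos i => u (Upos i) - inv_slope R (site s i) * zres u (Some i)
  | Utan i => u (Utan i) - inv_slope R (site s i) * tres u (Some i)
  | Ufold => if vf is Some v then v else u Ufold + tres u None
  | Utune => if tf is Some t then t else u Utune + zres u None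
  end.

Lemma newton_fixed vf tf u : (forall j, newton vf tf u j = u j) ->
  [/\ forall i, zres u (Some i) = 0, forall i, tres u (Some i) = 0,
      (if vf is Some v then u Ufold = v else tres u None = 0) &
      (if tf is Some t then u Utune = t else zres u None = 0)].
Proof.
have cancel (x y : R) p : x - inv_slope R p * y = x -> y = 0.
  have p_neq0 : inv_slope R p != 0 by case: p; rewrite /inv_slope ?oner_neq0 // oppr_eq0 pnatr_eq0.
  by move/eqP; rewrite -subr_eq0 addrC addKr oppr_eq0 mulf_eq0 (negbTE p_neq0) => /eqP.
move=> fixed_u; split.
- by move=> i; apply: cancel (fixed_u (Upos i)).
- by move=> i; apply: cancel (fixed_u (Utan i)).
- by move: (fixed_u Ufold); case: vf {fixed_u} => //= fixed_v; lra.
- by move: (fixed_u Utune); case: tf {fixed_u} => //= fixed_t; lra.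
Qed.

End OrbitEquations.

Record small_params (R : realType) (k kap b e : R) : Prop := SmallParams {
  sp_k : 0 < k <= 10^-1 ^+ 6;
  sp_kap : 0 < kap <= k;
  sp_e : 0 <= e <= 10^-1 ^+ 6;
  sp_b : 2 <= b <= 3
}.

Section Admissible.
Variables (R : realType) (I : Type) (s : itinerary R I).

Definition nbr (o o' : option I) := fwd s o = o' \/ bwd s o = o'.
Definition isolated o := forall o', nbr o o' -> exists2 i, o' = Some i & ~~ site s i.

Record admissible (depth : I -> nat) : Prop := Admissible {
  adm_depth : forall i j, nbr (Some i) (Some j) -> (depth i <= (depth j).+1)%N;
  adm_deep : forall i, (0 < depth i)%N -> isolated (Some i);
  adm_site : forall i, site s i -> depth i = 0%N;
  adm_fold : isolated None;
  adm_wfwd : forall o, `|wfwd s o| <= 2;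
  adm_wbwd : forall o, `|wbwd s o| <= 2
}.

Lemma nbr_fwd o : nbr o (fwd s o). Proof. by left. Qed.
Lemma nbr_bwd o : nbr o (bwd s o). Proof. by right. Qed.

End Admissible.

Section OrbitBox.
Variables (R : realType) (I : Type) (s : itinerary R I) (k : R) (depth : I -> nat).
Local Notation theta := (50 * k).
Implicit Types (u : unknown I -> R) (o : option I).

Definition center (j : unknown I) : R := if j is Upos i then site_val R (site s i) else 0.
Definition radius (j : unknown I) : R :=
  match j with
  | Upos i | Utan i => 100 * k * theta ^+ depth i
  | Ufold => 20 * 10 ^+ 3 * k ^+ 2
  | Utune => 2 * 10 ^+ 3 * k ^+ 2
  end.
Definition orbit_box := box center radius.

Hypothesis k_range : 0 < k <= 10^-1 ^+ 6.
Hypothesis adm : admissible s depth.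

Lemma sqr_k_le : k ^+ 2 <= 10^-1 ^+ 6 * k.
Proof. by rewrite expr2 ler_wpM2r //; have := k_range; lra. Qed.

Lemma theta_exp_le1 n : theta ^+ n <= 1.
Proof. by apply: exprn_ile1; have := k_range; lra. Qed.

Lemma radius_ge0 j : 0 <= radius j.
Proof. by have := k_range; case: j => [i|i||] kr /=; rewrite ?mulr_ge0 ?exprn_ge0 //; lra. Qed.

Lemma radius_le i : radius (Upos i) <= 100 * k.
Proof. by rewrite /= ler_piMr ?theta_exp_le1 //; have := k_range; lra. Qed.

Lemma radius_shallow i : depth i = 0%N -> radius (Upos i) = 100 * k.
Proof. by move=> /= ->; rewrite expr0 mulr1. Qed.

Lemma radius_nbr i j : nbr s (Some i) (Some j) -> radius (Upos j) * theta <= radius (Upos i).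
Proof.
move=> /(adm_depth adm) depth_le /=; rewrite -mulrA -exprSr.
apply: ler_wpM2l; first by have := k_range; lra.
by apply: ler_wiXn2l => //; have := k_range; lra.
Qed.

(* A quantity attached to the position [o] which is of the size of the radius at [o], up to the
   factor [c / theta], as soon as the neighbours of [o] are away from the fold and from site 1. *)
Definition decays (c N : R) o :=
  (isolated s o -> `|N| <= 100 * c * k) /\
  (forall i, o = Some i -> (0 < depth i)%N -> `|N| * theta <= c * radius (Upos i)).

Lemma decays_comb (a c p q N x y : R) o : 0 <= a -> 0 <= c -> `|N| <= a * `|x| + c * `|y| ->
  decays p x o -> decays q y o -> decays (a * p + c * q) N o.
Proof.
move=> a0 c0 N_le [x_iso x_deep] [y_iso y_deep]; split=> [iso|i oi depth_i].
  have := ler_wpM2l a0 (x_iso iso); have := ler_wpM2l c0 (y_iso iso).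
  by move: N_le; lra.
have := ler_wpM2l a0 (x_deep i oi depth_i); have := ler_wpM2l c0 (y_deep i oi depth_i).
have theta_ge0 : 0 <= theta by have := k_range; lra.
by have := ler_wpM2r theta_ge0 N_le; lra.
Qed.

Lemma newton_force_le (a c M N : R) i : 0 <= a -> c <= 50 * a -> `|M| <= k * `|N| ->
  `|N| <= 25 * a -> decays c N (Some i) -> `|inv_slope R (site s i) * M| <= a * radius (Upos i).
Proof.
move=> a0 c_le M_le N_le [_ N_deep]; have /andP[k_gt0 _] := k_range.
have [di|di] := posnP (depth i).
  rewrite radius_shallow //; have := normrM_le (inv_slope_norm R (site s i)) M_le.
  by have := ler_wpM2l (ltW k_gt0) N_le; lra.
have -> : site s i = false by apply/negP => /(adm_site adm) di0; rewrite di0 in di.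
have := N_deep i erefl di; have := ler_wpM2r (radius_ge0 (Upos i)) c_le.
by rewrite mul1r; move: M_le; lra.
Qed.

Section InBox.
Variable u : unknown I -> R.
Hypothesis bu : orbit_box u.

Lemma box_pos i : `|u (Upos i) - site_val R (site s i)| <= 100 * k.
Proof. exact: le_trans (bu (Upos i)) (radius_le i). Qed.

Lemma box_pos_near i : `|u (Upos i) - site_val R (site s i)| <= 100^-1 ^+ 2.
Proof. by apply: le_trans (box_pos i) _; have := k_range; lra. Qed.

Lemma box_tan i : `|u (Utan i)| <= radius (Upos i).
Proof. by have := bu (Utan i); rewrite /= subr0. Qed.

Lemma box_tan_le i : `|u (Utan i)| <= 100 * k.
Proof. exact: le_trans (box_tan i) (radius_le i). Qed.

Lemma box_fold : `|u Ufold| <= 10^-1 ^+ 3.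
Proof. by have := bu Ufold; rewrite /= subr0; have := sqr_k_le; have := k_range; lra. Qed.

Lemma box_tune : `|u Utune| <= 10^-1 ^+ 3.
Proof. by have := bu Utune; rewrite /= subr0; have := sqr_k_le; have := k_range; lra. Qed.

Lemma box_pos_norm i : `|u (Upos i)| <= 11 / 10.
Proof. by have := box_pos_near i; rewrite !ler_norml /site_val; case: (site s i) => /=; lra. Qed.

Lemma zval_norm o : `|zval u o| <= 21 / 10.
Proof.
case: o => [i|] /=; first by have := box_pos_norm i; lra.
by have := box_fold; rewrite !ler_norml; lra.
Qed.

Lemma zval_norm3 o : `|zval u o| <= 3.
Proof. by have := zval_norm o; lra. Qed.

Lemma ztan_norm o : `|ztan u o| <= 1.
Proof. by case: o => [i|] /=; rewrite ?normr1 //; have := box_tan_le i; have := k_range; lra. Qed.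

Lemma zval_decays o o' : nbr s o o' -> decays 1 (zval u o') o.
Proof.
move=> oo'; split=> [iso|i oi di].
  have [j -> /negbTE s_j] := iso _ oo'.
  by have := box_pos j; rewrite /= s_j /site_val subr0 mulr1.
rewrite {}oi in oo'; have [j jE /negbTE s_j] := adm_deep adm di oo'; rewrite {}jE in oo' *.
rewrite mul1r (le_trans _ (radius_nbr oo')) // ler_wpM2r //; first by have := k_range; lra.
by have := bu (Upos j); rewrite /= s_j /site_val subr0.
Qed.

Lemma ztan_decays o o' : nbr s o o' -> decays 1 (ztan u o') o.
Proof.
move=> oo'; split=> [iso|i oi di].
  by have [j -> _] := iso _ oo'; rewrite mulr1; exact: box_tan_le.
rewrite {}oi in oo'; have [j jE _] := adm_deep adm di oo'; rewrite {}jE in oo' *.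
rewrite mul1r (le_trans _ (radius_nbr oo')) // ler_wpM2r ?box_tan //.
by have := k_range; lra.
Qed.

End InBox.
End OrbitBox.

Section NewtonEstimates.
Variables (R : realType) (I : Type) (s : itinerary R I) (depth : I -> nat) (k kap b e : R).
Hypothesis adm : admissible s depth.
Hypothesis sp : small_params k kap b e.
Local Notation theta := (50 * k).
Local Notation radius := (radius k depth).
Local Notation center := (center s).
Local Notation obox := (orbit_box s k depth).
Local Notation newton := (newton s kap b e).
Local Notation zforce := (zforce s b e).
Local Notation tforce := (tforce s b e).
Local Notation slope i := (inv_slope R (site s i)).
Implicit Types (u : unknown I -> R) (o : option I).

Let k_range := sp_k sp.
Let e_range := sp_e sp.
Let b_range := sp_b sp.

Lemma kap_norm_le x c : `|x| <= c -> `|kap * x| <= k * c.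
Proof. by have := sp_kap sp => kr; apply: normrM_le; rewrite gtr0_norm; lra. Qed.

Section Forces.
Variable u : unknown I -> R.
Hypothesis bu : obox u.

Lemma zforce_le o : `|zforce u o| <= 1 * `|zval u (fwd s o)| + 31 / 10 * `|zval u (bwd s o)|.
Proof.
apply: le_trans (ler_normB _ _) _; rewrite mul1r lerD2l.
exact: (psi_norm e_range b_range (zval_norm3 k_range bu (bwd s o))).
Qed.

Lemma tforce_le o : `|tforce u o| <= 2 * `|ztan u (fwd s o)| + 62 / 10 * `|ztan u (bwd s o)|.
Proof.
have z3 := zval_norm3 k_range bu (bwd s o).
have fwd_le := normrM_le (adm_wfwd adm o) (lexx `|ztan u (fwd s o)|).
have bwd_le := normrM_le (ddpsi_norm e_range b_range z3 z3)
  (normrM_le (adm_wbwd adm o) (lexx `|ztan u (bwd s o)|)).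
by apply: le_trans (ler_normB _ _) _; move: fwd_le bwd_le; rewrite /dpsi; lra.
Qed.

Lemma zforce_norm o : `|zforce u o| <= 9.
Proof.
have := zforce_le o; have := zval_norm k_range bu (fwd s o).
by have := zval_norm k_range bu (bwd s o); lra.
Qed.

Lemma tforce_norm o : `|tforce u o| <= 9.
Proof.
have := tforce_le o; have := ztan_norm k_range bu (fwd s o).
by have := ztan_norm k_range bu (bwd s o); lra.
Qed.

Lemma zforce_decays o : decays s k depth (1 * 1 + 31 / 10 * 1) (zforce u o) o.
Proof.
apply: (decays_comb k_range _ _ (zforce_le o) (zval_decays k_range adm bu (nbr_fwd s o))
  (zval_decays k_range adm bu (nbr_bwd s o))) => //; by rewrite divr_ge0.
Qed.

Lemma tforce_decays o : decays s k depth (2 * 1 + 62 / 10 * 1) (tforce u o) o.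
Proof.
apply: (decays_comb k_range _ _ (tforce_le o) (ztan_decays k_range adm bu (nbr_fwd s o))
  (ztan_decays k_range adm bu (nbr_bwd s o))) => //; by rewrite divr_ge0.
Qed.

End Forces.

Lemma newton_posE vf tf u i : newton vf tf u (Upos i) =
  (u (Upos i) - slope i * zpoly (u Utune) (u (Upos i))) + slope i * (kap * zforce u (Some i)).
Proof. by rewrite /= /zres /=; ring. Qed.

Lemma newton_tanE vf tf u i : newton vf tf u (Utan i) =
  (1 - slope i * dzpoly (u Utune) (u (Upos i))) * u (Utan i) + slope i * (kap * tforce u (Some i)).
Proof. by rewrite /= /tres /=; ring. Qed.

Section NewtonHalf.
Variable u : unknown I -> R.
Hypothesis bu : obox u.

Let k_sqr := sqr_k_le k_range.
Let tune_le := box_tune k_range bu.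
Let fold_le := box_fold k_range bu.

Lemma newton_pos_half vf tf i :
  `|newton vf tf u (Upos i) - center (Upos i)| <= radius (Upos i) / 2.
Proof.
have self_near : `|site_val R (site s i) - site_val R (site s i)| <= 100^-1 ^+ 2.
  by rewrite subrr normr0 exprn_ge0 // invr_ge0.
have := newton_step_lipschitz (u Utune) tune_le (box_pos_near k_range bu i) self_near.
rewrite zpoly_site mulr0 subr0 !subrr normr0 !(mulr0, addr0) => own_part.
have force : `|slope i * (kap * zforce u (Some i))| <= 4 / 10 * radius (Upos i).
  apply: (newton_force_le k_range adm _ _ (kap_norm_le (lexx _)) _ (zforce_decays bu _)); try lra.
  by have := zforce_norm bu (Some i); lra.
rewrite newton_posE addrAC; apply: le_trans (ler_normD _ _) _.
by move: own_part force (bu (Upos i)); rewrite /=; lra.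
Qed.

Lemma newton_tan_half vf tf i :
  `|newton vf tf u (Utan i) - center (Utan i)| <= radius (Utan i) / 2.
Proof.
have near := box_pos_near k_range bu i.
have own_part := normrM_le (inv_slope_ddzpoly tune_le near near) (box_tan bu i).
have force : `|slope i * (kap * tforce u (Some i))| <= 4 / 10 * radius (Upos i).
  apply: (newton_force_le k_range adm _ _ (kap_norm_le (lexx _)) _ (tforce_decays bu _)); try lra.
  by have := tforce_norm bu (Some i); lra.
rewrite newton_tanE subr0; apply: le_trans (ler_normD _ _) _.
by have := radius_ge0 depth k_range (Upos i); move: own_part force; rewrite /= /dzpoly; lra.
Qed.

Lemma newton_fold_half vf tf : `|odflt 0 vf| <= radius Ufold / 2 ->
  `|newton vf tf u Ufold - center Ufold| <= radius Ufold / 2.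
Proof.
rewrite subr0; case: vf => [v|_] //=.
have zero_le : `|0 : R| <= 10^-1 ^+ 3 by rewrite normr0 exprn_ge0 // invr_ge0.
have := fold_slope_lipschitz tune_le zero_le fold_le zero_le.
rewrite (_ : dzpoly 0 (2 + 0) = 0 :> R); last by rewrite /dzpoly /ddzpoly; field.
rewrite !addr0 !subr0 => own_part.
have force := kap_norm_le ((tforce_decays bu None).1 (adm_fold adm)).
rewrite /tres /= mulr1 addrA; apply: le_trans (ler_normB _ _) _.
have := bu Ufold; have := bu Utune; rewrite /= !subr0.
by move: own_part force (sqr_ge0 k); rewrite !expr2; lra.
Qed.

Lemma newton_tune_half vf tf : `|odflt 0 tf| <= radius Utune / 2 ->
  `|newton vf tf u Utune - center Utune| <= radius Utune / 2.
Proof.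
rewrite subr0; case: tf => [t|_] //=.
have zero_le : `|0 : R| <= 10^-1 ^+ 3 by rewrite normr0 exprn_ge0 // invr_ge0.
have := fold_value_lipschitz 0 tune_le fold_le zero_le.
rewrite (_ : zpoly 0 (2 + 0) = 0 :> R); last by rewrite /zpoly; ring.
rewrite !addr0 !subr0 => own_part.
have force := kap_norm_le ((zforce_decays bu None).1 (adm_fold adm)).
rewrite /zres /= addrA; apply: le_trans (ler_normB _ _) _.
have := bu Ufold; have := bu Utune; rewrite /= !subr0.
by move: own_part force (sqr_ge0 k); rewrite !expr2; lra.
Qed.

Lemma newton_half vf tf : `|odflt 0 vf| <= radius Ufold / 2 -> `|odflt 0 tf| <= radius Utune / 2 ->
  forall j, `|newton vf tf u j - center j| <= radius j / 2.
Proof.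
move=> vf_le tf_le; case=> [i|i||]; first exact: newton_pos_half; first exact: newton_tan_half.
  exact: newton_fold_half.
exact: newton_tune_half.
Qed.

End NewtonHalf.

Section Weights.
Variables (w : I -> R) (rv rt : R) (vf tf : option R).

Definition weight (j : unknown I) : R :=
  match j with Upos i | Utan i => w i | Ufold => rv | Utune => rt end.
Definition oweight o := if o is Some i then w i else rv.

Hypothesis weight_ge0 : forall j, 0 <= weight j.
Hypothesis w_nbr : forall i j, nbr s (Some i) (Some j) -> w j * theta <= w i.
Hypothesis w_site : forall i j, site s i -> nbr s (Some i) (Some j) -> w j <= w i.
Hypothesis w_fold_nbr : forall i, nbr s (Some i) None -> 400 * k * rv <= w i.
Hypothesis w_tune : forall i, 10 ^+ 3 * radius (Upos i) * rt <= w i.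
Hypothesis fold_weights : vf = None ->
  3 * rt + k * (2 * oweight (fwd s None) + 8 * oweight (bwd s None)) <= 4 / 10 * rv.
Hypothesis tune_weights : tf = None ->
  rv / 100 + k * (oweight (fwd s None) + 4 * oweight (bwd s None)) <= 4 / 10 * rt.

Let k_ge0 : 0 <= k. Proof. by have := k_range; lra. Qed.

Lemma oweight_ge0 o : 0 <= oweight o.
Proof. by case: o => [i|]; [exact: (weight_ge0 (Upos i)) | exact: (weight_ge0 Ufold)]. Qed.

Lemma slope_oweight_le i o : nbr s (Some i) o -> `|slope i| * (k * oweight o) <= w i / 50.
Proof.
have w_ge0 j : 0 <= w j := weight_ge0 (Upos j); have rv_ge0 : 0 <= rv := weight_ge0 Ufold.
have := w_ge0 i; case: o => [j|] /= wi io.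
  case si: (site s i).
    have := w_site si io; rewrite /inv_slope normrN ger0_norm //; have := w_ge0 j.
    by have := k_range; nra.
  by have := w_nbr io; rewrite /inv_slope normr1; lra.
have := w_fold_nbr io; have krv_ge0 : 0 <= k * rv by rewrite mulr_ge0.
by have := ler_wpM2r krv_ge0 (inv_slope_norm R (site s i)); lra.
Qed.

Section Differences.
Variables (D : R) (u u' : unknown I -> R).
Hypothesis D_ge0 : 0 <= D.
Hypothesis bu : obox u.
Hypothesis bu' : obox u'.
Hypothesis uu' : forall j, `|u j - u' j| <= D * weight j.

Let tune_le := box_tune k_range bu.
Let near := box_pos_near k_range bu.
Let near' := box_pos_near k_range bu'.

Lemma zval_diff o : `|zval u o - zval u' o| <= D * oweight o.
Proof.
case: o => [i|] /=; first exact: (uu' (Upos i)).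
by have -> : 2 + u Ufold - (2 + u' Ufold) = u Ufold - u' Ufold by ring.
Qed.

Lemma ztan_diff o : `|ztan u o - ztan u' o| <= D * oweight o.
Proof.
case: o => [i|] /=; first exact: (uu' (Utan i)).
by rewrite subrr normr0 mulr_ge0 //; exact: (weight_ge0 Ufold).
Qed.

Lemma zforce_diff o :
  `|zforce u o - zforce u' o| <= D * (oweight (fwd s o) + 4 * oweight (bwd s o)).
Proof.
have -> : zforce u o - zforce u' o = (zval u (fwd s o) - zval u' (fwd s o))
    - (psi b e (zval u (bwd s o)) - psi b e (zval u' (bwd s o))) by rewrite /zforce; ring.
have := psi_lipschitz e_range b_range (zval_norm3 k_range bu (bwd s o))
  (zval_norm3 k_range bu' (bwd s o)).
have := zval_diff (fwd s o); have := zval_diff (bwd s o) => zb zf psi_le.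
by apply: le_trans (ler_normB _ _) _; have := normr_ge0 (zval u (bwd s o) - zval u' (bwd s o)); lra.
Qed.

Lemma tforce_diff o :
  `|tforce u o - tforce u' o| <= D * (2 * oweight (fwd s o) + 8 * oweight (bwd s o)).
Proof.
have z3 := zval_norm3 k_range bu (bwd s o); have z3' := zval_norm3 k_range bu' (bwd s o).
have -> : tforce u o - tforce u' o = wfwd s o * (ztan u (fwd s o) - ztan u' (fwd s o))
  - wbwd s o * (dpsi b e (zval u (bwd s o)) * (ztan u (bwd s o) - ztan u' (bwd s o))
     + ztan u' (bwd s o) * (dpsi b e (zval u (bwd s o)) - dpsi b e (zval u' (bwd s o)))).
  by rewrite /tforce; ring.
have fwd_le := normrM_le (adm_wfwd adm o) (ztan_diff (fwd s o)).
have own := normrM_le (ddpsi_norm e_range b_range z3 z3) (ztan_diff (bwd s o)).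
have turn := normrM_le (ztan_norm k_range bu' (bwd s o)) (dpsi_lipschitz e_range b_range z3 z3').
have := zval_diff (bwd s o); have := mulr_ge0 D_ge0 (oweight_ge0 (bwd s o)) => Dw zb.
have := normrM_le (adm_wbwd adm o) (le_trans (ler_normD _ _) (lerD own turn)).
by move=> bwd_le; apply: le_trans (ler_normB _ _) _; lra.
Qed.

Lemma force_diff_le i N :
  `|N| <= D * (2 * oweight (fwd s (Some i)) + 8 * oweight (bwd s (Some i))) ->
  `|slope i * (kap * N)| <= D * w i / 5.
Proof.
move=> /kap_norm_le/(normrM_le (lexx `|slope i|)) /le_trans; apply.
have := ler_wpM2l D_ge0 (slope_oweight_le (nbr_fwd s (Some i))).
by have := ler_wpM2l D_ge0 (slope_oweight_le (nbr_bwd s (Some i))); lra.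
Qed.

Lemma newton_pos_diff i :
  `|newton vf tf u (Upos i) - newton vf tf u' (Upos i)| <= D / 2 * w i.
Proof.
have own := newton_step_lipschitz (u' Utune) tune_le (near i) (near' i).
have drift : 2 * `|u' (Upos i) - site_val R (site s i)| * `|u Utune - u' Utune| <= D * w i / 500.
  have := ler_pM (normr_ge0 _) (normr_ge0 _) (bu' (Upos i)) (uu' Utune).
  by have := ler_wpM2l D_ge0 (w_tune i); rewrite /=; lra.
have force : `|slope i * (kap * (zforce u (Some i) - zforce u' (Some i)))| <= D * w i / 5.
  apply: force_diff_le; apply: le_trans (zforce_diff _) _; apply: ler_wpM2l => //.
  by have := oweight_ge0 (fwd s (Some i)); have := oweight_ge0 (bwd s (Some i)); lra.
rewrite !newton_posE opprD addrACA -mulrBr -mulrBr; apply: le_trans (ler_normD _ _) _.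
have Dw : 0 <= D * w i by rewrite mulr_ge0 //; exact: (weight_ge0 (Upos i)).
by have := uu' (Upos i); rewrite /=; lra.
Qed.

Lemma newton_tan_diff i :
  `|newton vf tf u (Utan i) - newton vf tf u' (Utan i)| <= D / 2 * w i.
Proof.
have Dw : 0 <= D * w i by rewrite mulr_ge0 //; exact: (weight_ge0 (Upos i)).
have Drt : 0 <= D * rt by rewrite mulr_ge0 //; exact: (weight_ge0 Utune).
have own := normrM_le (inv_slope_ddzpoly tune_le (near i) (near i)) (uu' (Utan i)).
have drift : `|slope i * (u' (Utan i) * (dzpoly (u Utune) (u (Upos i))
    - dzpoly (u' Utune) (u' (Upos i))))| <= D * w i / 10.
  have t1 : `|u Utune| <= 1 by have := tune_le; lra.
  have := dzpoly_lipschitz (u' Utune) t1 (norm_near_site (near i)) (norm_near_site (near' i)).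
  move=> dz; have {}dz : `|dzpoly (u Utune) (u (Upos i)) - dzpoly (u' Utune) (u' (Upos i))|
      <= 60 * (D * w i) + 9 * (D * rt).
    by have := uu' (Upos i); have := uu' Utune; rewrite /=; lra.
  have := normrM_le (inv_slope_norm R (site s i)) (normrM_le (lexx `|u' (Utan i)|) dz).
  have := ler_wpM2r Dw (box_tan_le k_range bu' i); have := ler_wpM2r Drt (box_tan bu' i).
  have := ler_wpM2l D_ge0 (w_tune i).
  have : 100 * k * (D * w i) <= 10^-1 ^+ 4 * (D * w i).
    by apply: ler_wpM2r => //; have := k_range; lra.
  lra.
have force := force_diff_le (tforce_diff (Some i)).
rewrite !newton_tanE; set a := dzpoly _ (u _) in drift *; set a' := dzpoly _ (u' _) in drift *.
have -> : (1 - slope i * a) * u (Utan i) + slope i * (kap * tforce u (Some i))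
  - ((1 - slope i * a') * u' (Utan i) + slope i * (kap * tforce u' (Some i)))
  = (1 - slope i * a) * (u (Utan i) - u' (Utan i)) - slope i * (u' (Utan i) * (a - a'))
    + slope i * (kap * (tforce u (Some i) - tforce u' (Some i))) by ring.
apply: le_trans (ler_normD _ _) (le_trans (lerD (ler_normB _ _) (lexx _)) _).
by move: own; rewrite /= -/(dzpoly _ _) -/a; lra.
Qed.

Lemma newton_fold_diff : `|newton vf tf u Ufold - newton vf tf u' Ufold| <= D / 2 * rv.
Proof.
case: vf fold_weights => [v _|balance] /=.
  by rewrite subrr normr0 !mulr_ge0 ?invr_ge0 //; exact: (weight_ge0 Ufold).
have own := fold_slope_lipschitz tune_le (box_tune k_range bu') (box_fold k_range bu)
  (box_fold k_range bu').
have force := kap_norm_le (tforce_diff None).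
have -> : u Ufold + tres s kap b e u None - (u' Ufold + tres s kap b e u' None) =
  (u Ufold + dzpoly (u Utune) (2 + u Ufold)) - (u' Ufold + dzpoly (u' Utune) (2 + u' Ufold))
  - kap * (tforce u None - tforce u' None) by rewrite /tres /=; ring.
apply: le_trans (ler_normB _ _) _.
have := uu' Ufold; have := uu' Utune; have := ler_wpM2l D_ge0 (balance erefl).
by move: own force; rewrite /=; lra.
Qed.

Lemma newton_tune_diff : `|newton vf tf u Utune - newton vf tf u' Utune| <= D / 2 * rt.
Proof.
case: tf tune_weights => [t _|balance] /=.
  by rewrite subrr normr0 !mulr_ge0 ?invr_ge0 //; exact: (weight_ge0 Utune).
have own := fold_value_lipschitz (u' Utune) tune_le (box_fold k_range bu) (box_fold k_range bu').
have force := kap_norm_le (zforce_diff None).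
have -> : u Utune + zres s kap b e u None - (u' Utune + zres s kap b e u' None) =
  (u Utune + zpoly (u Utune) (2 + u Ufold)) - (u' Utune + zpoly (u' Utune) (2 + u' Ufold))
  - kap * (zforce u None - zforce u' None) by rewrite /zres /=; ring.
apply: le_trans (ler_normB _ _) _.
have := uu' Ufold; have := uu' Utune; have := ler_wpM2l D_ge0 (balance erefl).
by move: own force; rewrite /=; lra.
Qed.

End Differences.

Lemma newton_halves : halves center radius (newton vf tf) weight.
Proof.
move=> D u u' D_ge0 bu bu' uu'.
case=> [i|i||]; first exact: newton_pos_diff; first exact: newton_tan_diff.
  exact: newton_fold_diff.
exact: newton_tune_diff.
Qed.

End Weights.

Lemma radius_halves vf tf : halves center radius (newton vf tf) radius.
Proof.
have [k_gt0 k_le] := andP k_range; have k_sqr := sqr_k_le k_range; have k2_ge0 := sqr_ge0 k.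
pose w i := radius (Upos i); have w_le i : w i <= 100 * k := radius_le depth k_range i.
have ow_le o : isolated s None -> nbr s None o -> oweight w (radius Ufold) o <= 100 * k.
  by move=> iso no; have [i -> _] := iso _ no; exact: w_le.
have fold_fwd := ow_le _ (adm_fold adm) (nbr_fwd s None).
have fold_bwd := ow_le _ (adm_fold adm) (nbr_bwd s None).
have -> : radius = weight w (radius Ufold) (radius Utune) by apply/funext => -[].
apply: newton_halves.
- by case=> [i|i||]; exact: (radius_ge0 depth k_range).
- by move=> i j; exact: radius_nbr.
- by move=> i j /(adm_site adm) di _; rewrite {2}/w radius_shallow.
- move=> i near_fold; have di : depth i = 0%N.
    have [//|di] := posnP (depth i).
    by have [] := adm_deep adm di near_fold.
  by rewrite /w radius_shallow //=; nra.
- move=> i; have w_ge0 : 0 <= w i := radius_ge0 depth k_range (Upos i).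
  have rt_le : 10 ^+ 3 * radius Utune <= 1 by rewrite /=; lra.
  by have := ler_wpM2l w_ge0 rt_le; rewrite /w; lra.
- by move=> _; have := ler_wpM2l (ltW k_gt0) fold_fwd; have := ler_wpM2l (ltW k_gt0) fold_bwd;
    rewrite /=; lra.
- by move=> _; have := ler_wpM2l (ltW k_gt0) fold_fwd; have := ler_wpM2l (ltW k_gt0) fold_bwd;
    rewrite /=; lra.
Qed.

Definition newton_orbit vf tf u :=
  (forall j, `|u j - center j| <= radius j / 2) /\ forall j, newton vf tf u j = u j.

Lemma newton_orbit_box vf tf u : newton_orbit vf tf u -> obox u.
Proof.
by move=> [half _] j; have := radius_ge0 depth k_range j; have := half j; lra.
Qed.

Lemma newton_orbit_exists vf tf : `|odflt 0 vf| <= radius Ufold / 2 ->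
  `|odflt 0 tf| <= radius Utune / 2 -> exists u, newton_orbit vf tf u.
Proof.
move=> vf_le tf_le; have radius_ge0 := radius_ge0 depth k_range.
have stable u : obox u -> obox (newton vf tf u).
  move=> bu j; apply: le_trans (newton_half bu vf_le tf_le j) _.
  by have := radius_ge0 j; lra.
have [u bu fixed_u] := box_fixed_point radius_ge0 stable (radius_halves vf tf).
by exists u; split=> // j; rewrite -fixed_u; exact: newton_half.
Qed.

Lemma newton_orbit_stable vf tf (D : R) u u' : 0 <= D -> newton_orbit vf tf u -> obox u' ->
  (forall j, `|newton vf tf u' j - u' j| <= D * radius j) ->
  forall j, `|u j - u' j| <= 2 * D * radius j.
Proof.
move=> D_ge0 orb bu' near_fixed; have bu := newton_orbit_box orb.
exact: (box_fixed_point_stable (radius_halves vf tf) D_ge0 _ bu bu' (radius_ge0 depth k_range)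
  orb.2 (box_dist bu bu')).
Qed.

End NewtonEstimates.

Section NewtonParameters.
Variables (R : realType) (I : Type) (s : itinerary R I) (depth : I -> nat).
Variables (k kap b kap' b' e d : R) (u : unknown I -> R).
Hypothesis adm : admissible s depth.
Hypothesis sp : small_params k kap b e.
Hypothesis sp' : small_params k kap' b' e.
Hypothesis d_ge0 : 0 <= d.
Hypothesis kap_close : `|kap - kap'| <= k * d.
Hypothesis b_close : `|b - b'| <= d.
Hypothesis bu : orbit_box s k depth u.
Local Notation radius := (radius k depth).

Let k_range := sp_k sp.

Let kap'_norm : `|kap'| <= k.
Proof. by have := sp_kap sp'; rewrite ler_norml; have := k_range; lra. Qed.

Definition zforce_drift o : R := d * `|zforce s b e u o| + d * (101 / 100) * `|zval u (bwd s o)|.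
Definition tforce_drift o : R := d * `|tforce s b e u o| + d * (202 / 100) * `|ztan u (bwd s o)|.

Lemma zforce_drift_ge0 o : 0 <= zforce_drift o.
Proof. by rewrite /zforce_drift addr_ge0 ?mulr_ge0 // divr_ge0. Qed.

Lemma tforce_drift_ge0 o : 0 <= tforce_drift o.
Proof. by rewrite /tforce_drift addr_ge0 ?mulr_ge0 // divr_ge0. Qed.

Lemma zforce_param o :
  `|kap * zforce s b e u o - kap' * zforce s b' e u o| <= k * `|zforce_drift o|.
Proof.
have -> : kap * zforce s b e u o - kap' * zforce s b' e u o =
  (kap - kap') * zforce s b e u o - kap' * ((b - b') * qpoly e (zval u (bwd s o))).
  by rewrite /zforce /psi /wpoly; ring.
have z4 : `|zval u (bwd s o)| <= 4 by have := zval_norm3 k_range bu (bwd s o); lra.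
have := normrM_le kap_close (lexx `|zforce s b e u o|).
have := normrM_le kap'_norm (normrM_le b_close (qpoly_norm (sp_e sp) z4)) => drift_b drift_kap.
apply: le_trans (ler_normB _ _) _; rewrite (ger0_norm (zforce_drift_ge0 o)) /zforce_drift.
by move: drift_b drift_kap; lra.
Qed.

Lemma tforce_param o :
  `|kap * tforce s b e u o - kap' * tforce s b' e u o| <= k * `|tforce_drift o|.
Proof.
set z := zval u (bwd s o).
have -> : kap * tforce s b e u o - kap' * tforce s b' e u o = (kap - kap') * tforce s b e u o
    - kap' * ((b - b') * ddqpoly e z z * (wbwd s o * ztan u (bwd s o))).
  by rewrite /tforce /dpsi /ddpsi /ddwpoly -/z; ring.
have z4 : `|z| <= 4 by have := zval_norm3 k_range bu (bwd s o); rewrite -/z; lra.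
have := normrM_le kap_close (lexx `|tforce s b e u o|).
have := normrM_le kap'_norm (normrM_le (normrM_le b_close (ddqpoly_norm (sp_e sp) z4 z4))
  (normrM_le (adm_wbwd adm o) (lexx `|ztan u (bwd s o)|))) => drift_b drift_kap.
apply: le_trans (ler_normB _ _) _; rewrite (ger0_norm (tforce_drift_ge0 o)) /tforce_drift.
by move: drift_b drift_kap; lra.
Qed.

Lemma zforce_drift_le o : `|zforce_drift o| <= 25 * d.
Proof.
rewrite (ger0_norm (zforce_drift_ge0 o)) /zforce_drift.
have := ler_wpM2l d_ge0 (zforce_norm sp bu o).
by have := ler_wpM2l d_ge0 (zval_norm k_range bu (bwd s o)); have := d_ge0; lra.
Qed.

Lemma tforce_drift_le o : `|tforce_drift o| <= 25 * d.
Proof.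
rewrite (ger0_norm (tforce_drift_ge0 o)) /tforce_drift.
have := ler_wpM2l d_ge0 (tforce_norm adm sp bu o).
by have := ler_wpM2l d_ge0 (ztan_norm k_range bu (bwd s o)); have := d_ge0; lra.
Qed.

Lemma zforce_drift_decays o : decays s k depth
  (d * (1 * 1 + 31 / 10 * 1) + d * (101 / 100) * 1) (zforce_drift o) o.
Proof.
apply: (decays_comb k_range d_ge0 _ _ (zforce_decays adm sp bu o)
  (zval_decays k_range adm bu (nbr_bwd s o))); first by rewrite mulr_ge0 ?divr_ge0.
by rewrite (ger0_norm (zforce_drift_ge0 o)).
Qed.

Lemma tforce_drift_decays o : decays s k depth
  (d * (2 * 1 + 62 / 10 * 1) + d * (202 / 100) * 1) (tforce_drift o) o.
Proof.
apply: (decays_comb k_range d_ge0 _ _ (tforce_decays adm sp bu o)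
  (ztan_decays k_range adm bu (nbr_bwd s o))); first by rewrite mulr_ge0 ?divr_ge0.
by rewrite (ger0_norm (tforce_drift_ge0 o)).
Qed.

Lemma newton_param vf tf j :
  `|newton s kap b e vf tf u j - newton s kap' b' e vf tf u j| <= d * radius j.
Proof.
have [[k_gt0 _] d2_ge0] := (andP k_range, mulr_ge0 d_ge0 (sqr_ge0 k)).
case: j => [i|i||].
- rewrite !newton_posE opprD addrACA subrr add0r -mulrBr.
  apply: (newton_force_le k_range adm d_ge0 _ (zforce_param _) (zforce_drift_le _)
    (zforce_drift_decays _)). have := d_ge0; lra.
- rewrite !newton_tanE opprD addrACA subrr add0r -mulrBr.
  apply: (newton_force_le k_range adm d_ge0 _ (tforce_param _) (tforce_drift_le _)
    (tforce_drift_decays _)); have := d_ge0; lra.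
- case: vf => [v|] /=; first by rewrite subrr normr0; exact: (mulr_ge0 d_ge0 (radius_ge0 depth k_range Ufold)).
  rewrite (_ : _ - _ = - (kap * tforce s b e u None - kap' * tforce s b' e u None)); last first.
    by rewrite /tres /=; ring.
  rewrite normrN; apply: le_trans (tforce_param None) _.
  have := ler_wpM2l (ltW k_gt0) ((tforce_drift_decays None).1 (adm_fold adm)).
  by move: d2_ge0; rewrite /= !expr2; lra.
- case: tf => [t|] /=; first by rewrite subrr normr0; exact: (mulr_ge0 d_ge0 (radius_ge0 depth k_range Utune)).
  rewrite (_ : _ - _ = - (kap * zforce s b e u None - kap' * zforce s b' e u None)); last first.
    by rewrite /zres /=; ring.
  rewrite normrN; apply: le_trans (zforce_param None) _.
  have := ler_wpM2l (ltW k_gt0) ((zforce_drift_decays None).1 (adm_fold adm)).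
  by move: d2_ge0; rewrite /= !expr2; lra.
Qed.

End NewtonParameters.

(** * Response of a nearly constant three-term recurrence to its far end *)

Lemma prod_near1 (R : realType) (x tol : nat -> R) n :
  (forall j, (j < n)%N -> `|x j - 1| <= tol j) -> \sum_(j < n) tol j <= 4^-1 ->
  1 / 2 <= \prod_(j < n) x j <= 2.
Proof.
move=> x_near sum_le.
have tol_ge0 j : (j < n)%N -> 0 <= tol j by move=> /x_near; apply: le_trans.
have partial_sum m : (m <= n)%N -> 0 <= \sum_(j < m) tol j <= 4^-1.
  move=> mn; apply/andP; split.
    by apply: sumr_ge0 => i _; apply: tol_ge0; apply: leq_trans mn.
  apply: le_trans sum_le; rewrite -(subnKC mn) big_split_ord /= lerDl.
  by apply: sumr_ge0 => i _; apply: tol_ge0; rewrite -{2}(subnKC mn) ltn_add2l.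
suff bounds m : (m <= n)%N ->
    1 - \sum_(j < m) tol j <= \prod_(j < m) x j <= 1 + 2 * \sum_(j < m) tol j.
  by have := bounds n (leqnn n); lra.
elim: m => [|m IH] mn; first by rewrite !big_ord0; lra.
have := IH (ltnW mn); have := partial_sum _ (ltnW mn); have := partial_sum _ mn.
rewrite !big_ord_recr /=; have := tol_ge0 _ mn; have := x_near _ mn; rewrite ler_norml.
by move: (\sum_(j < m) _) (\prod_(j < m) _) (tol m) (x m) => S P t y; nra.
Qed.

Section ThreeTermRecurrence.
Variables (R : realType) (a al be D tol : nat -> R) (al0 be0 root : R) (n : nat).
Hypothesis root_eq : root * (1 - al0 * root) = be0.
Hypothesis root_neq0 : root != 0.
Hypothesis tol_range : forall j, 0 <= tol j <= 16^-1.
Hypothesis a_near : forall j, (j < n)%N -> `|a j - 1| <= tol j.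
Hypothesis al_near : forall j, (j.+1 < n)%N -> `|al j.+1 - al0| <= `|al0| * tol j.+1.
Hypothesis be_near : forall j, (j < n)%N -> `|be j - be0| <= `|be0| * tol j.
Hypothesis coupling_small : `|al0 * root| <= 10^-1 ^+ 3.
Hypothesis coupling_tol0 : `|al0 * root| <= tol 0%N / 100.
Hypothesis coupling_tolS : forall j, (j.+1 < n)%N -> `|al0 * root| * tol j <= tol j.+1 / 100.
Hypothesis recurrence : forall j, (j < n)%N ->
  a j * D j = al j * (if j is i.+1 then D i else 0) + be j * D j.+1.

Lemma ratio_near_root j (r : R) : (j < n)%N -> `|r| <= 5 / 4 * tol j ->
  (1 - al0 * root + r) * D j = be j * D j.+1 ->
  exists2 x, `|x - 1| <= 4 * tol j & D j = root * x * D j.+1.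
Proof.
move=> jn r_le DE; have be_j := be_near jn; have /andP[tol_ge0 tol_le] := tol_range j.
set q := 1 - al0 * root in DE.
have q_range : 999 / 1000 <= q <= 1001 / 1000.
  by move: coupling_small; rewrite /q ler_norml; lra.
have root_gt0 : 0 < `|root| by rewrite normr_gt0.
have den_ge : 9 / 10 <= q + r by move: r_le; rewrite ler_norml; lra.
have den_neq0 : q + r != 0 by apply: lt0r_neq0; lra.
have err_ge0 : 0 <= tol j * `|root| by rewrite mulr_ge0.
exists (be j / (root * (q + r))); last first.
  by apply: (mulfI den_neq0); rewrite DE; field; rewrite den_neq0 root_neq0.
have -> : be j / (root * (q + r)) - 1 = (be j - be0 - r * root) / (root * (q + r)).
  by rewrite -root_eq -/q; field; rewrite den_neq0 root_neq0.
have be0_le : `|be0| <= `|root| * (1001 / 1000).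
  by rewrite -root_eq -/q; apply: normrM_le => //; rewrite ger0_norm; lra.
have num_le : `|be j - be0 - r * root| <= 27 / 10 * tol j * `|root|.
  apply: le_trans (ler_normB _ _) _; rewrite normrM.
  by have := ler_wpM2r (ltW root_gt0) r_le; have := ler_wpM2r tol_ge0 be0_le; lra.
have den_gt0 : 0 < q + r by lra.
rewrite normrM normfV normrM (gtr0_norm den_gt0) ler_pdivrMr ?mulr_gt0 //.
by apply: le_trans num_le _; nra.
Qed.

Lemma ratio_exists j : (j < n)%N ->
  exists2 x, `|x - 1| <= 4 * tol j & D j = root * x * D j.+1.
Proof.
elim: j => [|j IH] jn.
  apply: (@ratio_near_root 0%N (a 0%N - 1 + al0 * root)) => //.
    apply: le_trans (ler_normD _ _) _; have := coupling_tol0; have := a_near jn.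
    by have /andP[] := tol_range 0%N; lra.
  by have := recurrence jn; rewrite mulr0 add0r => <-; ring.
have [x x_near DjE] := IH (ltnW jn).
pose r := (a j.+1 - 1) - (al j.+1 - al0) * (root * x) - al0 * root * (x - 1).
apply: (@ratio_near_root j.+1 r) => //.
  have /andP[tol_ge0 tol_le] := tol_range j; have /andP[tolS_ge0 tolS_le] := tol_range j.+1.
  have x_norm : `|x| <= 2 by move: x_near; rewrite !ler_norml; lra.
  have al_part : `|(al j.+1 - al0) * (root * x)| <= `|al0 * root| * tol j.+1 * 2.
    by have := normrM_le (al_near jn) (normrM_le (lexx `|root|) x_norm); rewrite !normrM; lra.
  have x_part : `|al0 * root * (x - 1)| <= `|al0 * root| * (4 * tol j) by apply: normrM_le.
  have := ler_wpM2r tolS_ge0 coupling_small; have := a_near jn; have := coupling_tolS jn.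
  have := ler_normB ((a j.+1 - 1) - (al j.+1 - al0) * (root * x)) (al0 * root * (x - 1)).
  by have := ler_normB (a j.+1 - 1) ((al j.+1 - al0) * (root * x)); rewrite -/r; lra.
have -> : be j.+1 * D j.+2 = a j.+1 * D j.+1 - al j.+1 * D j by rewrite recurrence //; ring.
by rewrite DjE /r; ring.
Qed.

Lemma far_end_response : \sum_(j < n) 4 * tol j <= 4^-1 ->
  exists2 P, 1 / 2 <= P <= 2 & D 0%N = P * root ^+ n * D n.
Proof.
move=> sum_le.
have ratio j : exists x, (j < n)%N -> `|x - 1| <= 4 * tol j /\ D j = root * x * D j.+1.
  by case: (ltnP j n) => [/ratio_exists [x x_near DE] | _]; [exists x | exists 0].
have [x xP] := choice ratio.
exists (\prod_(j < n) x j).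
  by apply: (@prod_near1 _ x (fun j => 4 * tol j)) => // j /xP[].
suff chain m : (m <= n)%N -> D 0%N = (\prod_(j < m) x j) * root ^+ m * D m by exact: chain.
elim: m => [|m IH] mn; first by rewrite big_ord0 expr0 !mul1r.
rewrite IH ?(ltnW mn) // big_ord_recr /= exprSr.
by have [_ ->] := xP _ mn; ring.
Qed.

End ThreeTermRecurrence.

(** * The homoclinic tangency and the cycles shadowing it *)

(* Off the fold, [Some (true, j)] lies [j.+1] steps in the past of the fold point and
   [Some (false, j)] lies [j.+1] steps in its future. *)
Definition branch_index := (bool * nat)%type.

Definition hom_fwd (o : option branch_index) : option branch_index :=
  match o with
  | None => Some (false, 0%N)
  | Some (true, j) => if j is i.+1 then Some (true, i) else None
  | Some (false, j) => Some (false, j.+1)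
  end.
Definition hom_bwd (o : option branch_index) : option branch_index :=
  match o with
  | None => Some (true, 0%N)
  | Some (true, j) => Some (true, j.+1)
  | Some (false, j) => if j is i.+1 then Some (false, i) else None
  end.
Definition hom_depth (i : branch_index) : nat := i.2.

(* The cycle visits the fold, [m] times the saddle, once the site 1 at [(true, n)], and [n] times
   the saddle; the indices beyond it are irrelevant. *)
Definition cyc_fwd n m o := if o == Some (false, m.-1) then Some (true, n) else hom_fwd o.
Definition cyc_bwd n m o := if o == Some (true, n) then Some (false, m.-1) else hom_bwd o.
Definition cyc_depth n m (i : branch_index) : nat := minn i.2 ((if i.1 then n else m).-1 - i.2).

Section Itineraries.
Variable R : realType.

Definition homoclinic (g : bool) : itinerary R branch_index :=
  Itinerary hom_fwd hom_bwd (fun=> g%:R) (fun=> g%:R) (fun=> false).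

(* The tangent vectors on the branch [(false, _)] are divided by the eigenvalue 2 of the cycle. *)
Definition cyclic n m : itinerary R branch_index :=
  Itinerary (cyc_fwd n m) (cyc_bwd n m)
    (fun o => if o == Some (false, m.-1) then 2 else 1)
    (fun o => if o == Some (true, n) then 1 / 2 else 1)
    (fun i => i == (true, n)).

Lemma admissible_homoclinic g : admissible (homoclinic g) hom_depth.
Proof.
split=> //.
- by move=> [[] [|i]] [[] j] [] //= [] <-; rewrite /hom_depth /=; lia.
- by move=> [[] [|i]] // _ o [] <-; eexists.
- by move=> o [] <-; eexists.
- by move=> o; case: g; rewrite ger0_norm //=; lra.
- by move=> o; case: g; rewrite ger0_norm //=; lra.
Qed.

Lemma admissible_homoclinic_flat g : admissible (homoclinic g) (fun=> 0%N).
Proof. by have [_ _ _ fold wf wb] := admissible_homoclinic g; split. Qed.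

Lemma admissible_cyclic n m : (0 < n)%N -> (0 < m)%N -> admissible (cyclic n m) (cyc_depth n m).
Proof.
move=> n0 m0; split.
- move=> [s i] [s' j]; rewrite /nbr /= /cyc_fwd /cyc_bwd /cyc_depth /=.
  case; case: eqP => [[-> ->]|ne].
  + by case=> <- <- /=; lia.
  + by case: s ne => [|ne] /=; [case: i => //= i _|] => -[<- <-] /=; lia.
  + by case=> <- <- /=; lia.
  + by case: s ne => [ne|] /=; [|case: i => //= i _] => -[<- <-] /=; lia.
- move=> [s i]; rewrite /cyc_depth /= => i_deep o; have i0 : (0 < i)%N by lia.
  rewrite /nbr /= /cyc_fwd /cyc_bwd; case; case: eqP => [[sE iE]|ne] <-.
  + by rewrite sE iE in i_deep; move: i_deep; rewrite /=; lia.
  + case: s i_deep ne => /= i_deep ne; last by eexists.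
    by case: i i0 i_deep ne => // i _ i_deep _; eexists=> //; apply/eqP => -[]; lia.
  + by rewrite sE iE in i_deep; move: i_deep; rewrite /=; lia.
  + case: s i_deep ne => /= i_deep ne; last by case: i i0 {i_deep ne} => // i _; eexists.
    by eexists=> //; apply/eqP => -[]; lia.
- by move=> i /eqP ->; rewrite /cyc_depth /=; lia.
- move=> o [] <-; rewrite /= /cyc_fwd /cyc_bwd /=; eexists=> //.
  by apply/eqP => -[nE]; rewrite -nE in n0.
- by move=> o /=; case: eqP => _; rewrite ger0_norm; lra.
- by move=> o /=; case: eqP => _; rewrite ger0_norm; lra.
Qed.

End Itineraries.

Section FamilyParameters.
Variable R : realType.
Implicit Types b : R.

(* Both the bound on [kappa] and the coefficient of the quartic terms. *)
Definition tiny : R := 10^-1 ^+ 6.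
Definition zeta : R := tiny / 2.
(* With this choice the saddle has the exact multipliers [zeta^-1] and [- b * zeta]. *)
Definition kappa b : R := zeta / (1 - b * zeta ^+ 2).

Lemma tiny_gt0 : 0 < tiny.
Proof. by rewrite exprn_gt0 // invr_gt0. Qed.

Lemma zeta_range : 0 < zeta <= 10^-1 ^+ 6.
Proof. by have := tiny_gt0; rewrite /zeta /tiny; lra. Qed.

Lemma kappa_den b : 2 <= b <= 3 -> 99 / 100 <= 1 - b * zeta ^+ 2 < 1.
Proof.
move=> b_range; have := zeta_range; rewrite expr2 => z_range.
have : 0 < zeta * zeta <= zeta / 100 by nra.
by nra.
Qed.

Lemma kappaE b : 2 <= b <= 3 -> kappa b * (1 - b * zeta ^+ 2) = zeta.
Proof. by move=> /kappa_den den; rewrite /kappa divfK //; apply: lt0r_neq0; lra. Qed.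

Lemma kappa_bounds b : 2 <= b <= 3 -> zeta <= kappa b <= 102 / 100 * zeta.
Proof.
move=> /kappa_den den; have z_range := zeta_range; have den_gt0 : 0 < 1 - b * zeta ^+ 2 by lra.
by rewrite /kappa ler_pdivlMr // ler_pdivrMr //; apply/andP; split; nra.
Qed.

Lemma kappa_range b : 2 <= b <= 3 -> 0 < kappa b <= tiny.
Proof. by move=> /kappa_bounds; have := zeta_range; have := tiny_gt0; rewrite /zeta; lra. Qed.

Lemma kappa_lipschitz b b' : 2 <= b <= 3 -> 2 <= b' <= 3 ->
  `|kappa b - kappa b'| <= tiny * `|b - b'|.
Proof.
move=> b_range b'_range; have [z_gt0 z_le] := andP zeta_range.
have [k_range k'_range] := (kappa_range b_range, kappa_range b'_range).
have -> : kappa b - kappa b' = (kappa b * kappa b' * zeta) * (b - b').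
  apply: (mulfI (lt0r_neq0 z_gt0)).
  have -> : zeta * (kappa b - kappa b') = kappa b * (kappa b' * (1 - b' * zeta ^+ 2))
     - kappa b' * (kappa b * (1 - b * zeta ^+ 2)) by rewrite !kappaE //; ring.
  by ring.
have kk'_ge0 : 0 <= kappa b * kappa b' by apply: mulr_ge0; lra.
rewrite normrM ler_wpM2r // ger0_norm; last by rewrite mulr_ge0 // ltW.
have tiny_le1 : tiny <= 1 by rewrite /tiny; lra.
have kk'_le : kappa b * kappa b' <= tiny * 1 by apply: ler_pM; lra.
by nra.
Qed.

Lemma small_params_family b : 2 <= b <= 3 -> small_params tiny (kappa b) b tiny.
Proof.
move=> b_range; have tiny_gt0 := tiny_gt0; split=> //; first by rewrite tiny_gt0 lexx.
  exact: kappa_range.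
by rewrite ltW ?lexx.
Qed.

Definition hom_orbit b : unknown branch_index -> R := xget (fun=> 0)
  [set u | newton_orbit (homoclinic R true) hom_depth tiny (kappa b) b tiny None None u].
Definition tau b := hom_orbit b Utune.

Definition cyc_orbit n m b : unknown branch_index -> R := xget (fun=> 0)
  [set u | newton_orbit (cyclic R n m) (cyc_depth n m) tiny (kappa b) b tiny None (Some (tau b)) u].

(* Vanishes exactly when the shadowing orbit closes up at the parameters [(b, tau b)]. *)
Definition defect n m b := zres (cyclic R n m) (kappa b) b tiny (cyc_orbit n m b) None.

End FamilyParameters.

Section FamilyOrbits.
Variable R : realType.
Local Notation tiny := (tiny R).
Local Notation cyc_newton := (fun n m b => newton (cyclic R n m) (kappa b) b tiny).
Local Notation hom_radius := (radius tiny hom_depth).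
Local Notation cyc_radius n m := (radius tiny (cyc_depth n m)).

Lemma tiny_range : 0 < tiny <= 10^-1 ^+ 6.
Proof. by rewrite tiny_gt0 lexx. Qed.

Lemma hom_orbitP b : 2 <= b <= 3 ->
  newton_orbit (homoclinic R true) hom_depth tiny (kappa b) b tiny None None (hom_orbit b).
Proof.
move=> b_range; have adm := admissible_homoclinic R true.
have zero_le j : `|odflt 0 None : R| <= hom_radius j / 2.
  by rewrite normr0 divr_ge0 // (radius_ge0 _ tiny_range).
have [u u_orbit] := newton_orbit_exists adm (small_params_family b_range) (zero_le Ufold) (zero_le Utune).
by apply: (@xgetPex _ _ [set u | newton_orbit _ _ _ _ _ _ _ _ u]); exists u.
Qed.

Lemma hom_orbit_box b : 2 <= b <= 3 ->
  orbit_box (homoclinic R true) tiny hom_depth (hom_orbit b).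
Proof.
by move=> b_range; exact: (newton_orbit_box (small_params_family b_range) (hom_orbitP b_range)).
Qed.

Lemma cyc_orbitP n m b : (0 < n)%N -> (0 < m)%N -> 2 <= b <= 3 -> newton_orbit (cyclic R n m)
  (cyc_depth n m) tiny (kappa b) b tiny None (Some (tau b)) (cyc_orbit n m b).
Proof.
move=> n0 m0 b_range; have zero_le : `|odflt 0 None : R| <= cyc_radius n m Ufold / 2.
  by rewrite normr0 divr_ge0 // (radius_ge0 _ tiny_range Ufold).
have tau_le : `|odflt 0 (Some (tau b))| <= cyc_radius n m Utune / 2.
  by have := (hom_orbitP b_range).1 Utune; rewrite /= subr0.
have [u u_orbit] := newton_orbit_exists (admissible_cyclic R n0 m0) (small_params_family b_range)
  zero_le tau_le.
by apply: (@xgetPex _ _ [set u | newton_orbit _ _ _ _ _ _ _ _ u]); exists u.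
Qed.

Lemma cyc_orbit_box n m b : (0 < n)%N -> (0 < m)%N -> 2 <= b <= 3 ->
  orbit_box (cyclic R n m) tiny (cyc_depth n m) (cyc_orbit n m b).
Proof.
move=> n0 m0 b_range.
exact: (newton_orbit_box (small_params_family b_range) (cyc_orbitP n0 m0 b_range)).
Qed.

Section Lipschitz.
Variables b b' : R.
Hypothesis b_range : 2 <= b <= 3.
Hypothesis b'_range : 2 <= b' <= 3.

Let sp := small_params_family b_range.
Let sp' := small_params_family b'_range.
Let kappa_close := kappa_lipschitz b_range b'_range.

Lemma hom_orbit_lipschitz j :
  `|hom_orbit b j - hom_orbit b' j| <= 2 * `|b - b'| * hom_radius j.
Proof.
have adm := admissible_homoclinic R true; have bu' := hom_orbit_box b'_range.
apply: (newton_orbit_stable adm sp (normr_ge0 _) (hom_orbitP b_range) bu') => {}j.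
rewrite -[X in _ - X](hom_orbitP b'_range).2.
exact: (newton_param adm sp sp' (normr_ge0 _) kappa_close (lexx _) bu').
Qed.

Lemma tau_lipschitz : `|tau b - tau b'| <= `|b - b'|.
Proof.
apply: le_trans (hom_orbit_lipschitz Utune) _; rewrite mulrAC ler_piMl //=.
by have := sqr_k_le tiny_range; have := tiny_range; lra.
Qed.

Variables n m : nat.
Hypothesis n_gt0 : (0 < n)%N.
Hypothesis m_gt0 : (0 < m)%N.

Let adm := admissible_cyclic R n_gt0 m_gt0.
Let bu := cyc_orbit_box n_gt0 m_gt0 b_range.
Let bu' := cyc_orbit_box n_gt0 m_gt0 b'_range.

Let param_drift vf tf j : `|cyc_newton n m b vf tf (cyc_orbit n m b') j
    - cyc_newton n m b' vf tf (cyc_orbit n m b') j| <= `|b - b'| * cyc_radius n m j.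
Proof. exact: (newton_param adm sp sp' (normr_ge0 _) kappa_close (lexx _) bu'). Qed.

Lemma cyc_orbit_lipschitz j :
  `|cyc_orbit n m b j - cyc_orbit n m b' j| <= 4 * `|b - b'| * cyc_radius n m j.
Proof.
have -> : 4 * `|b - b'| = 2 * (2 * `|b - b'|) by ring.
have dist_ge0 : 0 <= 2 * `|b - b'| by rewrite mulr_ge0.
apply: (newton_orbit_stable adm sp dist_ge0 (cyc_orbitP n_gt0 m_gt0 b_range) bu') => {}j.
rewrite -[X in _ - X](cyc_orbitP n_gt0 m_gt0 b'_range).2.
have drift : `|b - b'| * cyc_radius n m j <= 2 * `|b - b'| * cyc_radius n m j.
  by rewrite ler_wpM2r ?(radius_ge0 _ tiny_range) // ler_peMl //; lra.
case: j drift => [i|i||] drift; try exact: le_trans (param_drift None (Some (tau b)) _) drift.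
exact: (hom_orbit_lipschitz Utune).
Qed.

Lemma defect_lipschitz : `|defect n m b - defect n m b'| <= 7 * `|b - b'| * cyc_radius n m Utune.
Proof.
pose step c v := cyc_newton n m c None None (cyc_orbit n m v) Utune.
have defectE c : defect n m c = step c c - cyc_orbit n m c Utune by rewrite /step /= /defect; ring.
have dist_ge0 : 0 <= 4 * `|b - b'| by rewrite mulr_ge0.
have inner : `|step b b - step b b'| <= 4 * `|b - b'| / 2 * cyc_radius n m Utune.
  exact: (radius_halves adm sp None None dist_ge0 bu bu' cyc_orbit_lipschitz).
have outer : `|step b b' - step b' b'| <= `|b - b'| * cyc_radius n m Utune.
  exact: param_drift.
have orbits := cyc_orbit_lipschitz Utune; rewrite !defectE.
move: (step b b) (step b b') (step b' b') inner outer => x y z inner outer.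
move: (cyc_orbit n m b Utune) (cyc_orbit n m b' Utune) orbits => p q orbits.
have -> : x - p - (z - q) = (x - y) + (y - z) - (p - q) by ring.
apply: le_trans (ler_normB _ _) (le_trans (lerD (ler_normD _ _) (lexx _)) _); lra.
Qed.

End Lipschitz.

End FamilyOrbits.

(** ** The shadowing orbit against the homoclinic orbit *)

Section Splice.
Variables (R : realType) (n m : nat).
Hypothesis n_gt0 : (0 < n)%N.
Hypothesis m_gt0 : (0 < m)%N.
Local Notation N := (minn n m).
Implicit Types (u : unknown branch_index -> R) (o : option branch_index).

Definition near_fold (l : nat) o := if o is Some i then (i.2 < l)%N else true.

Definition splice u u' (j : unknown branch_index) : R :=
  match j with
  | Upos i | Utan i => if near_fold N (Some i) then u' j else u j
  | Ufold | Utune => u' j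
  end.

Lemma zval_splice u u' o : near_fold N o -> zval (splice u u') o = zval u' o.
Proof. by case: o => //= i ->. Qed.

Lemma ztan_splice u u' o : near_fold N o -> ztan (splice u u') o = ztan u' o.
Proof. by case: o => //= i ->. Qed.

Lemma near_fold_pred l o : near_fold l.-1 o -> near_fold l o.
Proof. by case: o => //= i; lia. Qed.

Lemma near_fold_nbr o o' : near_fold N.-1 o -> nbr (homoclinic R true) o o' -> near_fold N o'.
Proof.
by move=> o_in [] <- {o'}; case: o o_in => [[[] [|j]]|] //=; lia.
Qed.

Lemma cyc_fwd_near_fold o : near_fold N.-1 o -> cyc_fwd n m o = hom_fwd o.
Proof. by rewrite /cyc_fwd; case: eqP => //= ->; rewrite /=; lia. Qed.

Lemma cyc_bwd_near_fold o : near_fold N.-1 o -> cyc_bwd n m o = hom_bwd o.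
Proof. by rewrite /cyc_bwd; case: eqP => //= ->; rewrite /=; lia. Qed.

Section Residuals.
Variables (kap b e : R) (u u' : unknown branch_index -> R) (o : option branch_index).
Hypothesis o_in : near_fold N.-1 o.

Let o_core : near_fold N o := near_fold_pred o_in.
Let fwd_core : near_fold N (hom_fwd o) := near_fold_nbr o_in (nbr_fwd (homoclinic R true) o).
Let bwd_core : near_fold N (hom_bwd o) := near_fold_nbr o_in (nbr_bwd (homoclinic R true) o).

Lemma zres_splice :
  zres (homoclinic R true) kap b e (splice u u') o = zres (cyclic R n m) kap b e u' o.
Proof.
rewrite /zres /zforce /= cyc_fwd_near_fold // cyc_bwd_near_fold //.
by rewrite (zval_splice _ _ o_core) (zval_splice _ _ fwd_core) (zval_splice _ _ bwd_core).
Qed.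

Lemma tres_splice :
  tres (homoclinic R true) kap b e (splice u u') o = tres (cyclic R n m) kap b e u' o.
Proof.
rewrite /tres /tforce /= cyc_fwd_near_fold // cyc_bwd_near_fold //.
rewrite (zval_splice _ _ o_core) (zval_splice _ _ bwd_core).
rewrite (ztan_splice _ _ o_core) (ztan_splice _ _ fwd_core) (ztan_splice _ _ bwd_core).
by rewrite !ifN //; apply: contraL o_in => /eqP ->; rewrite /=; lia.
Qed.

End Residuals.

End Splice.

Section FoldShift.
Variables (R : realType) (n m : nat) (b : R).
Hypothesis n_gt0 : (0 < n)%N.
Hypothesis m_gt0 : (0 < m)%N.
Hypothesis b_range : 2 <= b <= 3.
Local Notation tiny := (tiny R).
Local Notation theta := (50 * tiny).
Local Notation N := (minn n m).
Local Notation u := (hom_orbit b).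
Local Notation u' := (cyc_orbit n m b).
Local Notation flat_radius := (radius tiny (fun _ : branch_index => 0%N)).
Local Notation frozen_newton :=
  (newton (homoclinic R true) (kappa b) b tiny None (Some (tau b))).
Local Notation spliced := (splice n m u u').

Definition shift_weight : unknown branch_index -> R :=
  weight (fun i => theta ^+ (N.-1 - i.2)) (theta ^+ N.-1) 0.

Let theta_range : 0 < theta <= 10^-1 ^+ 4.
Proof. by have := tiny_range R; lra. Qed.

Let theta_exp_gt0 l : 0 < theta ^+ l.
Proof. by rewrite exprn_gt0 //; have := theta_range; lra. Qed.

Lemma shift_weight_ge0 j : 0 <= shift_weight j.
Proof. by case: j => [i|i||] //=; exact: ltW. Qed.

Lemma radius_le_flat depth j : radius tiny depth j <= flat_radius j.
Proof.
have t_ge0 : 0 <= 100 * tiny by have := tiny_range R; lra.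
by case: j => [i|i||] //=; rewrite expr0 mulr1 ler_piMr ?(theta_exp_le1 (tiny_range R)).
Qed.

Lemma flat_radius_le j : flat_radius j <= 100 * tiny.
Proof.
have := sqr_k_le (tiny_range R); have := tiny_range R.
by case: j => [i|i||] /=; rewrite ?expr0 ?mulr1; lra.
Qed.

Lemma hom_nbr_le i j : nbr (homoclinic R true) (Some i) (Some j) -> (j.2 <= i.2.+1)%N.
Proof. by case: i => [[] [|i]] [] //= -[<-] /=; lia. Qed.

Lemma shift_halves :
  halves (center (homoclinic R true)) flat_radius frozen_newton shift_weight.
Proof.
have adm := admissible_homoclinic_flat R true; have [t_gt0 t_le] := andP theta_range.
apply: (newton_halves adm (small_params_family b_range)) => //.
- exact: shift_weight_ge0.
- move=> [s i] [s' j] /hom_nbr_le /= ji; rewrite -exprSr.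
  by apply: ler_wiXn2l; [lra | lra | lia].
- move=> [s i] [|] /=; case: s; case: i => // _; rewrite subn0 ler_piMl ?ltW //; lra.
- by move=> i; rewrite mulr0 ltW.
- by move=> _ /=; rewrite subn0 mulr0; have := theta_exp_gt0 N.-1; nra.
Qed.

Lemma splice_box : orbit_box (homoclinic R true) tiny (fun=> 0%N) spliced.
Proof.
have bu := hom_orbit_box b_range; have bu' := cyc_orbit_box n_gt0 m_gt0 b_range.
case=> [[s j]|[s j]||]; rewrite /splice /=.
- case: ifP => j_in; last exact: (le_trans (bu (Upos (s, j))) (radius_le_flat _ (Upos _))).
  apply: le_trans (radius_le_flat (cyc_depth n m) (Upos (s, j))).
  have off_site : site (cyclic R n m) (s, j) = false.
    by apply/eqP => -[_ jE]; move: j_in; rewrite jE; lia.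
  by have := bu' (Upos (s, j)); rewrite /center off_site.
- case: ifP => _; first exact: (le_trans (bu' (Utan (s, j))) (radius_le_flat _ (Utan _))).
  exact: (le_trans (bu (Utan (s, j))) (radius_le_flat _ (Utan _))).
- exact: (bu' Ufold).
- exact: (bu' Utune).
Qed.

Lemma splice_defect j :
  `|frozen_newton spliced j - spliced j| <= 200 * tiny * shift_weight j.
Proof.
have [_ fixed_u'] := cyc_orbitP n_gt0 m_gt0 b_range.
have tuned : u' Utune = tau b by rewrite -fixed_u'.
have tau_le : `|odflt 0 (Some (tau b))| <= flat_radius Utune / 2.
  by have := (hom_orbitP b_range).1 Utune; rewrite /= subr0.
have fold_le : `|odflt 0 None : R| <= flat_radius Ufold / 2.
  by rewrite normr0 divr_ge0 // (radius_ge0 _ (tiny_range R) Ufold).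
have far : `|frozen_newton spliced j - spliced j| <= 200 * tiny.
  have half := newton_half (admissible_homoclinic_flat R true) (small_params_family b_range)
    splice_box fold_le tau_le j.
  rewrite -(subrKA (center (homoclinic R true) j)); apply: le_trans (ler_normD _ _) _.
  have := splice_box j; rewrite (distrC (center _ _)); have := flat_radius_le j.
  by have := tiny_range R; move: half; rewrite /=; lra.
have exact_fit : frozen_newton spliced j = spliced j ->
    `|frozen_newton spliced j - spliced j| <= 200 * tiny * shift_weight j.
  move=> ->; rewrite subrr normr0 mulr_ge0 ?shift_weight_ge0 //.
  by have := tiny_range R; lra.
have in_core s l : (l < N.-1)%N -> (s, l) == (true, n) = false /\ (l < N)%N.
  by move=> l_in; split; [apply/eqP => -[_ lE]; move: l_in; rewrite lE; lia | lia].
have edge l : (N.-1 <= l)%N -> theta ^+ (N.-1 - l) = 1.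
  by rewrite -subn_eq0 => /eqP ->; rewrite expr0.
case: j far exact_fit => [[s l]|[s l]||] far exact_fit.
- have [l_in|l_out] := ltnP l N.-1; last by rewrite /= edge // mulr1.
  have [off_site l_lt] := in_core s l l_in; apply: exact_fit.
  by rewrite /= zres_splice //= l_lt -[RHS]fixed_u' /= off_site.
- have [l_in|l_out] := ltnP l N.-1; last by rewrite /= edge // mulr1.
  have [off_site l_lt] := in_core s l l_in; apply: exact_fit.
  by rewrite /= tres_splice //= l_lt -[RHS]fixed_u' /= off_site.
- by apply: exact_fit; rewrite /= tres_splice // -[RHS]fixed_u'.
- by apply: exact_fit; rewrite /= tuned.
Qed.

Lemma fold_shift : `|u Ufold - u' Ufold| <= 2 * (200 * tiny) * theta ^+ N.-1.
Proof.
have bu := hom_orbit_box b_range; have [_ fixed_u] := hom_orbitP b_range.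
have flat_u : orbit_box (homoclinic R true) tiny (fun=> 0%N) u.
  by move=> j; exact: le_trans (bu j) (radius_le_flat _ _).
have w_gt0 := theta_exp_gt0 N.-1; have [t_gt0 t_le] := andP theta_range.
have crude j : `|u j - spliced j| <= (theta ^+ N.-1)^-1 * shift_weight j.
  have le1 : `|u j - spliced j| <= 1.
    have := box_dist flat_u splice_box j; have := flat_radius_le j.
    by have := tiny_range R; lra.
  have edge i : 1 <= (theta ^+ N.-1)^-1 * theta ^+ (N.-1 - i).
    rewrite mulrC ler_pdivlMr // mul1r; apply: ler_wiXn2l; [lra | lra | exact: leq_subr].
  case: j le1 => [i|i||] le1 /=; try exact: le_trans le1 (edge _).
    by rewrite mulVf ?lt0r_neq0.
  by rewrite -(cyc_orbitP n_gt0 m_gt0 b_range).2 /= subrr normr0 mulr0.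
have t_ge0 : 0 <= 200 * tiny by have := tiny_range R; lra.
have c_ge0 : 0 <= (theta ^+ N.-1)^-1 by rewrite invr_ge0 ltW.
have fixed_hom j : frozen_newton u j = u j by case: j => [i|i||] //; rewrite -[RHS]fixed_u.
exact: (box_fixed_point_stable shift_halves t_ge0 c_ge0 flat_u splice_box shift_weight_ge0
  fixed_hom crude splice_defect Ufold).
Qed.

End FoldShift.

(** ** Criticality of the residual at the tangency *)

Section Slide.
Variables (R : realType) (I : Type) (s : itinerary R I) (depth : I -> nat) (k kap b e : R).
Hypothesis sp : small_params k kap b e.
Hypothesis wfwd1 : forall o, wfwd s o = 1.
Hypothesis wbwd1 : forall o, wbwd s o = 1.

Definition slide (u : unknown I -> R) (d : R) (j : unknown I) : R :=
  match j with
  | Upos i => u (Upos i) + d * u (Utan i)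
  | Utan _ => 0
  | Ufold => u Ufold + d
  | Utune => u Utune
  end.

Lemma zval_slide u d o : zval (slide u d) o = zval u o + d * ztan u o.
Proof. by case: o => [i|] //=; ring. Qed.

Lemma zres_slide u d o : orbit_box s k depth u -> orbit_box s k depth (slide u d) ->
  `|zres s kap b e (slide u d) o - (zres s kap b e u o + d * tres s kap b e u o)| <=
  d ^+ 2 * (30 * ztan u o ^+ 2 + kap * (10^-1 ^+ 3 * ztan u (bwd s o) ^+ 2)).
Proof.
move=> bu bus; have k_range := sp_k sp; have kap_gt0 := sp_kap sp.
have t1 : `|u Utune| <= 1 by have := box_tune k_range bu; lra.
have z_part := zpoly_taylor t1 (zval_norm3 k_range bus o) (zval_norm3 k_range bu o).
have psi_part := psi_taylor (sp_e sp) (sp_b sp) (zval_norm3 k_range bus (bwd s o))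
  (zval_norm3 k_range bu (bwd s o)).
have dz o' : zval (slide u d) o' - zval u o' = d * ztan u o' by rewrite zval_slide; ring.
rewrite !dz !exprMn in z_part psi_part.
have -> : zres s kap b e (slide u d) o - (zres s kap b e u o + d * tres s kap b e u o) =
  (zpoly (u Utune) (zval (slide u d) o) - zpoly (u Utune) (zval u o)
    - dzpoly (u Utune) (zval u o) * (d * ztan u o))
  + kap * (psi b e (zval (slide u d) (bwd s o)) - psi b e (zval u (bwd s o))
    - dpsi b e (zval u (bwd s o)) * (d * ztan u (bwd s o))).
  by rewrite /zres /tres /zforce /tforce wfwd1 wbwd1 !zval_slide /=; ring.
have := normrM_le (lexx `|kap|) psi_part; rewrite (gtr0_norm (x := kap)); last by lra.
by move=> scaled; apply: le_trans (ler_normD _ _) _; lra.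
Qed.

End Slide.

Section HomoclinicRemainder.
Variables (R : realType) (b v : R) (u' : unknown branch_index -> R).
Local Notation tiny := (tiny R).
Local Notation radius := (radius tiny hom_depth).
Local Notation u := (hom_orbit b).
Local Notation d := (v - u Ufold).
Local Notation slid := (slide u d).
Hypothesis b_range : 2 <= b <= 3.
Hypothesis v_le : `|v| <= radius Ufold / 2.
Hypothesis u'_orbit : newton_orbit (homoclinic R false) hom_depth tiny (kappa b) b tiny
  (Some v) (Some (tau b)) u'.

Let sp := small_params_family b_range.
Let bu := hom_orbit_box b_range.
Let bu' := newton_orbit_box sp u'_orbit.

Let d_le : `|d| <= 4^-1.
Proof.
have := (hom_orbitP b_range).1 Ufold; rewrite /= subr0 => u_le.
apply: le_trans (ler_normB _ _) _; have := sqr_k_le (tiny_range R); have := tiny_range R.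
by move: v_le u_le; rewrite /=; lra.
Qed.

Lemma slide_box : orbit_box (homoclinic R true) tiny hom_depth slid.
Proof.
have r_ge0 := radius_ge0 hom_depth (tiny_range R).
case=> [i|i||]; rewrite /slide /=.
- rewrite subr0; have tan_part := normrM_le d_le (box_tan bu i).
  have pos_part := (hom_orbitP b_range).1 (Upos i); rewrite /= subr0 in pos_part.
  apply: le_trans (ler_normD _ _) _.
  by move: tan_part pos_part (r_ge0 (Upos i)); rewrite /=; lra.
- by rewrite subrr normr0; exact: (r_ge0 (Utan i)).
- by rewrite subr0 subrKC; have := v_le; have := r_ge0 Ufold; rewrite /=; lra.
- exact: (bu Utune).
Qed.

Lemma slide_residual o : `|zres (homoclinic R true) (kappa b) b tiny slid o| <=
  d ^+ 2 * (30 * ztan u o ^+ 2 + kappa b * (10^-1 ^+ 3 * ztan u (hom_bwd o) ^+ 2)).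
Proof.
have [zres0 tres0 fold0 tune0] := newton_fixed (hom_orbitP b_range).2.
have := @zres_slide _ _ (homoclinic R true) _ _ _ _ _ sp (fun=> erefl) (fun=> erefl) u d o bu slide_box.
by case: o => [i|]; rewrite ?zres0 ?tres0 ?fold0 ?tune0 mulr0 addr0 subr0.
Qed.

Lemma slide_defect j : `|newton (homoclinic R false) (kappa b) b tiny (Some v) (Some (tau b)) slid j
  - slid j| <= d ^+ 2 * radius j.
Proof.
have d2_ge0 := sqr_ge0 d; have r_ge0 := radius_ge0 hom_depth (tiny_range R).
have exact_fit (x : R) j' : x = 0 -> `|x| <= d ^+ 2 * radius j'.
  by move=> ->; rewrite normr0; apply: mulr_ge0.
case: j => [i|i||]; try by apply: exact_fit; rewrite /= ?subrKC ?subrr.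
  rewrite [newton _ _ _ _ _ _ _ _]/= mul1r addrAC subrr add0r normrN.
  apply: le_trans (slide_residual (Some i)) _.
  apply: ler_wpM2l => //; have [t_gt0 t_le] := andP (tiny_range R).
  have own : ztan u (Some i) ^+ 2 <= 100 * tiny * radius (Upos i).
    rewrite -(real_normK (num_real _)) expr2.
    by apply: ler_pM => //; [exact: (box_tan_le (tiny_range R) bu) | exact: (box_tan bu)].
  have back_le := ztan_norm (tiny_range R) bu (hom_bwd (Some i)).
  have back : `|kappa b * ztan u (hom_bwd (Some i))| <= 1 * radius (Upos i).
    rewrite -[X in `|X|]mul1r.
    apply: (@newton_force_le _ _ _ _ _ (tiny_range R) (admissible_homoclinic R true) 1 1 _
      (ztan u (hom_bwd (Some i))) i); [lra | lra | exact: (kap_norm_le sp) | lra |].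
    exact: (ztan_decays (tiny_range R) (admissible_homoclinic R true) bu (nbr_bwd _ _)).
  have {}back : kappa b * ztan u (hom_bwd (Some i)) ^+ 2 <= radius (Upos i).
    rewrite expr2 mulrA; apply: le_trans (ler_norm _) _.
    by have := normrM_le back back_le; rewrite mul1r mulr1.
  by have := ler_wpM2r (r_ge0 (Upos i)) t_le; have := r_ge0 (Upos i); lra.
by apply: exact_fit; rewrite /= /tres /tforce /= !(mulr0n, mul0r, mulr0, subrr).
Qed.

Lemma homoclinic_remainder :
  `|zres (homoclinic R false) (kappa b) b tiny u' None| <= 31 * (v - u Ufold) ^+ 2.
Proof.
have adm := admissible_homoclinic R false; have d2_ge0 := sqr_ge0 d.
have close := newton_orbit_stable adm sp d2_ge0 u'_orbit slide_box slide_defect.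
have [_ _ u'_fold u'_tune] := newton_fixed u'_orbit.2.
pose s := homoclinic R false; have [t_gt0 t_le] := andP (tiny_range R).
have diff : `|zforce s b tiny u' None - zforce s b tiny slid None| <=
    2 * d ^+ 2 * (radius (Upos (false, 0%N)) + 4 * radius (Upos (true, 0%N))).
  pose w i := radius (Upos i).
  apply: (@zforce_diff _ _ s hom_depth _ _ _ _ sp w (radius Ufold) (radius Utune) _ u' slid) => //.
  exact: slide_box.
have -> : zres s (kappa b) b tiny u' None = zres (homoclinic R true) (kappa b) b tiny slid None
    - kappa b * (zforce s b tiny u' None - zforce s b tiny slid None).
  by rewrite /zres /zforce /= u'_fold u'_tune /= subrKC; ring.
apply: le_trans (ler_normB _ _) _; have := slide_residual None; rewrite expr1n mulr1.
have := normrM_le (lexx `|kappa b|) diff; rewrite !radius_shallow //.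
have back := sqr_le_norm (ztan_norm (tiny_range R) bu (hom_bwd None)); rewrite expr1n in back.
have [kap_gt0 kap_le] := andP (kappa_range b_range); rewrite (gtr0_norm kap_gt0).
have kd_le : kappa b * d ^+ 2 <= 10^-1 ^+ 6 * d ^+ 2 by apply: ler_wpM2r => //; lra.
have kdt : kappa b * d ^+ 2 * tiny <= kappa b * d ^+ 2 by apply: ler_piMr; [apply: mulr_ge0 => //; lra | lra].
have := ler_wpM2l (mulr_ge0 (ltW kap_gt0) d2_ge0) back.
by move: kd_le kdt; lra.
Qed.

End HomoclinicRemainder.

(** ** The sign of the defect *)

Section BranchTolerance.
Variable R : realType.
Local Notation tiny := (tiny R).
Local Notation theta := (50 * tiny).

Definition branch_tol l j : R := (theta ^+ j + theta ^+ (l.-1 - j)) / 33.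

Lemma theta_exp_gt0 j : 0 < theta ^+ j.
Proof. by rewrite exprn_gt0 //; have := tiny_gt0 R; lra. Qed.

Lemma theta_expS_le j : theta ^+ j.+1 <= theta ^+ j / 10 ^+ 4.
Proof. by rewrite exprS; have := theta_exp_gt0 j; have := tiny_range R; nra. Qed.

Lemma branch_tol_range l j : 0 <= branch_tol l j <= 16^-1.
Proof.
have := theta_exp_gt0 j; have := theta_exp_gt0 (l.-1 - j); rewrite /branch_tol.
have := theta_exp_le1 (tiny_range R) j; have := theta_exp_le1 (tiny_range R) (l.-1 - j).
lra.
Qed.

Lemma branch_tolS l j : (j.+1 < l)%N -> theta * branch_tol l j <= branch_tol l j.+1.
Proof.
move=> jl; rewrite /branch_tol -(ltn_predK jl) subnS exprS.
have := theta_expS_le (l.-1 - j).-1; rewrite prednK; last by lia.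
by have := theta_exp_gt0 (l.-1 - j).-1; have := theta_exp_gt0 (l.-1 - j); have := tiny_range R; nra.
Qed.

Lemma branch_tol_sum l : \sum_(j < l) 4 * branch_tol l j <= 4^-1.
Proof.
have geometric p : \sum_(j < p) theta ^+ j <= 501 / 500 - 501 / 500 * theta ^+ p.
  elim: p => [|p IH]; first by rewrite big_ord0 expr0; lra.
  by rewrite big_ord_recr /=; have := theta_expS_le p; have := theta_exp_gt0 p; lra.
have reversed : \sum_(j < l) theta ^+ (l.-1 - j) = \sum_(j < l) theta ^+ j.
  rewrite (reindex_inj rev_ord_inj) /=; apply: eq_bigr => i _; congr (_ ^+ _).
  by have := ltn_ord i; lia.
rewrite -mulr_sumr -mulr_suml big_split /= reversed.
by have := geometric l; have := theta_exp_gt0 l; lra.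
Qed.

End BranchTolerance.

Section BranchResponse.
Variables (R : realType) (n m : nat) (b : R) (u' u : unknown branch_index -> R).
Local Notation tiny := (tiny R).
Local Notation zeta := (zeta R).
Local Notation theta := (50 * tiny).
Hypothesis n_gt0 : (0 < n)%N.
Hypothesis m_gt0 : (0 < m)%N.
Hypothesis b_range : 2 <= b <= 3.
Hypothesis bu' : orbit_box (cyclic R n m) tiny (cyc_depth n m) u'.
Hypothesis bu : orbit_box (homoclinic R false) tiny hom_depth u.
Hypothesis u'_orbit : forall i, zres (cyclic R n m) (kappa b) b tiny u' (Some i) = 0.
Hypothesis u_orbit : forall i, zres (homoclinic R false) (kappa b) b tiny u (Some i) = 0.
Hypothesis same_fold : u' Ufold = u Ufold.
Hypothesis same_tune : u' Utune = u Utune.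

Definition branch_length (s : bool) := if s then n else m.

(* Where the cycle is when the homoclinic orbit is at [(s, j)]: both branches end at the site 1. *)
Definition branch_pos (s : bool) j := if j == branch_length s then (true, n) else (s, j).
Definition branch_diff s j : R := u' (Upos (branch_pos s j)) - u (Upos (s, j)).

Definition inner_pos s j : option branch_index := if j is i.+1 then Some (s, i) else None.
Definition inner_diff s j := if j is i.+1 then branch_diff s i else 0.
Definition branch_slope s j :=
  ddpsi b tiny (zval u' (cyc_bwd n m (Some (s, j)))) (zval u (hom_bwd (Some (s, j)))).
Definition branch_coef (t : bool) p := if t then kappa b else - (kappa b * p).
Definition branch_root (s : bool) := if s then - (b * zeta) else zeta.

Let k_range := tiny_range R.
Let e_range := sp_e (small_params_family b_range).

Lemma branch_pos_lt s j : (j < branch_length s)%N -> branch_pos s j = (s, j).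
Proof. by rewrite /branch_pos => /ltn_eqF ->. Qed.

Lemma hom_pos_le i : `|u (Upos i)| <= 2 * theta ^+ i.2.+1.
Proof. by have := bu (Upos i); rewrite /= subr0 exprS /hom_depth; lra. Qed.

Lemma cyc_pos_le s j : (j < branch_length s)%N ->
  `|u' (Upos (s, j))| <= 2 * (theta ^+ j.+1 + theta ^+ (branch_length s - j)).
Proof.
move=> jl; have off_site : site (cyclic R n m) (s, j) = false.
  by apply/eqP => -[sE jE]; move: jl; rewrite sE jE ltnn.
have := bu' (Upos (s, j)); rewrite /center off_site /= subr0 /cyc_depth /= -/(branch_length s).
have -> : (branch_length s - j = ((branch_length s).-1 - j).+1)%N by lia.
rewrite !exprS; have := theta_exp_gt0 R j; have := theta_exp_gt0 R ((branch_length s).-1 - j).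
by rewrite /minn; case: ifP => _; have := k_range; nra.
Qed.

(* The points one step further from the fold and one step closer to it. *)
Lemma branch_sizes s j : (j < branch_length s)%N ->
  [/\ `|u' (Upos (branch_pos s j))| + `|u (Upos (s, j))| <= 140 * theta * branch_tol R (branch_length s) j,
      `|u' (Upos (branch_pos s j.+1))| + `|u (Upos (s, j.+1))| <= 140 * branch_tol R (branch_length s) j &
      (0 < j)%N -> `|u' (Upos (branch_pos s j.-1))| + `|u (Upos (s, j.-1))| <=
        140 * branch_tol R (branch_length s) j].
Proof.
move=> jl; set l := branch_length s in jl *.
have [t_gt0 t_le] := andP k_range; have th j' := theta_exp_gt0 R j'.
have thS j' := theta_expS_le R j'.
have tolE j' : (j' < l)%N -> 33 * branch_tol R l j' = theta ^+ j' + theta ^+ (l.-1 - j').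
  by rewrite /branch_tol => _; field.
split.
- rewrite branch_pos_lt //; have := cyc_pos_le jl; have := hom_pos_le (s, j); rewrite -/l /=.
  have -> : (l - j = (l.-1 - j).+1)%N by lia.
  by have := tolE j jl; rewrite !exprS; have := th j; have := th (l.-1 - j)%N; nra.
- have := hom_pos_le (s, j.+1); have := tolE j jl => /=.
  have := thS j; have := thS j.+1; have := th (l.-1 - j)%N; have := th j.
  have [jS|jS] := ltnP j.+1 l.
    rewrite branch_pos_lt //; have := cyc_pos_le jS; rewrite -/l.
    have -> : (l - j.+1 = l.-1 - j)%N by lia.
    by lra.
  have -> : (l.-1 - j = 0)%N by lia.
  have := box_pos_norm k_range bu' (branch_pos s j.+1); rewrite expr0; lra.
- case: j jl => // j jl _; rewrite branch_pos_lt ?(ltnW jl) //=.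
  have := cyc_pos_le (ltnW jl); have := hom_pos_le (s, j); have := tolE _ jl; rewrite -/l /=.
  have -> : (l - j = (l.-1 - j.+1).+2)%N by lia.
  have := th j.+1; have := th (l.-1 - j.+1)%N; have := thS (l.-1 - j.+1)%N.
  by have := thS (l.-1 - j.+1).+1; lra.
Qed.

Lemma zval_inner s j : (j < branch_length s)%N ->
  zval u' (inner_pos s j) - zval u (inner_pos s j) = inner_diff s j.
Proof.
case: j => [|j] jl /=; first by rewrite same_fold subrr.
by rewrite /branch_diff branch_pos_lt // ltnW.
Qed.

Lemma cyc_fwd_branch s j : (j < branch_length s)%N ->
  cyc_fwd n m (Some (s, j)) = if s then inner_pos s j else Some (branch_pos s j.+1).
Proof.
rewrite /cyc_fwd /branch_pos; case: s => //= jl; case: (j.+1 =P m) => [<-|jm] /=.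
  by rewrite eqxx.
by case: eqP => // -[jE]; case: jm; rewrite jE prednK.
Qed.

Lemma cyc_bwd_branch s j : (j < branch_length s)%N ->
  cyc_bwd n m (Some (s, j)) = if s then Some (branch_pos s j.+1) else inner_pos s j.
Proof.
rewrite /cyc_bwd /branch_pos; case: s => //= jl.
by case: eqP => [[jE]|_]; [rewrite jE ltnn in jl | case: eqP => [->|]].
Qed.

Lemma branch_recurrence s j : (j < branch_length s)%N ->
  ddzpoly (u Utune) (u' (Upos (s, j))) (u (Upos (s, j))) * branch_diff s j =
  branch_coef s (branch_slope s j) * inner_diff s j
  + branch_coef (~~ s) (branch_slope s j) * branch_diff s j.+1.
Proof.
move=> jl; rewrite [in LHS]/branch_diff branch_pos_lt // -zpolyB.
have inner := zval_inner jl.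
have fwd_part : zval u' (cyc_fwd n m (Some (s, j))) - zval u (hom_fwd (Some (s, j))) =
    if s then inner_diff s j else branch_diff s j.+1.
  by rewrite cyc_fwd_branch //; case: (s) inner.
have bwd_part : zval u' (cyc_bwd n m (Some (s, j))) - zval u (hom_bwd (Some (s, j))) =
    if s then branch_diff s j.+1 else inner_diff s j.
  by rewrite cyc_bwd_branch //; case: (s) inner.
have psi_part : psi b tiny (zval u' (cyc_bwd n m (Some (s, j))))
    - psi b tiny (zval u (hom_bwd (Some (s, j)))) =
    branch_slope s j * (if s then branch_diff s j.+1 else inner_diff s j).
  by rewrite psiB bwd_part.
transitivity (kappa b * ((if s then inner_diff s j else branch_diff s j.+1)
    - branch_slope s j * (if s then branch_diff s j.+1 else inner_diff s j))).
  rewrite -fwd_part -psi_part; have := u'_orbit (s, j); have := u_orbit (s, j).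
  by rewrite /zres /zforce /= same_tune; lra.
by case: (s); rewrite /branch_coef /=; ring.
Qed.

Lemma branch_slope_near s j : (j < branch_length s)%N -> s || (0 < j)%N ->
  `|branch_slope s j - b| <= 2 * branch_tol R (branch_length s) j.
Proof.
move=> jl; have [_ outer inner] := branch_sizes jl.
have le3 i : `|u' (Upos i)| <= 3 /\ `|u (Upos i)| <= 3.
  by have := box_pos_norm k_range bu' i; have := box_pos_norm k_range bu i; split; lra.
have near i' i : `|u' (Upos i')| + `|u (Upos i)| <= 140 * branch_tol R (branch_length s) j ->
    `|ddpsi b tiny (u' (Upos i')) (u (Upos i)) - b| <= 2 * branch_tol R (branch_length s) j.
  have := ddpsi_near e_range b_range (le3 i').1 (le3 i).2.
  by have /andP[] := branch_tol_range R (branch_length s) j; lra.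
rewrite /branch_slope cyc_bwd_branch //; case: s jl outer inner near => /= jl outer inner near.
  by move=> _; exact: near.
case: j jl inner near {outer} => // j jl /(_ isT) inner near _; apply: near.
by rewrite branch_pos_lt ?(ltnW jl) // in inner.
Qed.

Lemma branch_coef_near t p tol : 0 <= tol -> t || (`|p - b| <= 2 * tol) ->
  `|branch_coef t p - branch_coef t b| <= `|branch_coef t b| * tol.
Proof.
move=> tol_ge0; case: t => /= [_|p_near]; first by rewrite subrr normr0 mulr_ge0.
have -> : - (kappa b * p) - - (kappa b * b) = - (kappa b * (p - b)) by ring.
rewrite !normrN !normrM -[leRHS]mulrA ler_wpM2l // (le_trans p_near) // ler_wpM2r //.
by rewrite ger0_norm; have := b_range; lra.
Qed.

Lemma branch_coupling s : `|branch_coef s b * branch_root s| = kappa b * (b * zeta).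
Proof.
have kap_range := kappa_range b_range; have z_range := zeta_range R.
have nonneg : 0 <= kappa b * (b * zeta).
  by have br := b_range; apply: mulr_ge0; [lra | apply: mulr_ge0; lra].
case: s; rewrite /branch_coef /branch_root; first by rewrite mulrN normrN ger0_norm.
by rewrite mulNr normrN -mulrA ger0_norm.
Qed.

Lemma coupling_le : kappa b * (b * zeta) <= theta / 10 ^+ 5.
Proof.
have := kappa_range b_range; have := zeta_range R; have := b_range; have := tiny_range R.
rewrite (_ : zeta = tiny / 2) // => t_range br z_range kap_range.
have bz_le : b * (tiny / 2) <= 2 * 10^-1 ^+ 6 by nra.
by have : kappa b * (b * (tiny / 2)) <= tiny * (2 * 10^-1 ^+ 6); [apply: ler_pM; nra | lra].
Qed.

Lemma branch_response s : exists2 P : R, 1 / 2 <= P <= 2 & branch_diff s 0 =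
  P * branch_root s ^+ branch_length s * branch_diff s (branch_length s).
Proof.
have kap_range := kappa_range b_range; have z_range := zeta_range R.
have tol_ge0 j : 0 <= branch_tol R (branch_length s) j.
  by have /andP[] := branch_tol_range R (branch_length s) j.
apply: (far_end_response (a := fun j => ddzpoly (u Utune) (u' (Upos (s, j))) (u (Upos (s, j))))
  (al := fun j => branch_coef s (branch_slope s j))
  (be := fun j => branch_coef (~~ s) (branch_slope s j))
  (al0 := branch_coef s b) (be0 := branch_coef (~~ s) b)
  (tol := branch_tol R (branch_length s))) => [||j|j jl|j jl|j jl|||j jl|j jl|].
- have fixed : zeta + kappa b * b * zeta ^+ 2 = kappa b.
    by rewrite -[X in X + _](kappaE b_range); ring.
  case: s {tol_ge0}; rewrite /branch_root /branch_coef /=; last by rewrite -[RHS]fixed; ring.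
  by rewrite -[X in _ = - (X * _)]fixed; ring.
- by case: s {tol_ge0}; rewrite /branch_root ?oppr_eq0 ?mulf_neq0 ?lt0r_neq0 //; have := b_range; lra.
- exact: branch_tol_range.
- have t1 : `|u Utune| <= 1 by have := box_tune k_range bu; lra.
  have le3 (v : R) : `|v| <= 11 / 10 -> `|v| <= 3 by lra.
  have := ddzpoly_near1 t1 (le3 _ (box_pos_norm k_range bu' (s, j)))
    (le3 _ (box_pos_norm k_range bu (s, j))).
  have [own _ _] := branch_sizes jl; rewrite branch_pos_lt // in own.
  by have := ler_wpM2r (tol_ge0 j) (andP k_range).2; have := tol_ge0 j; lra.
- by apply: branch_coef_near => //; case: (s) jl => //= jl; apply: branch_slope_near.
- by apply: branch_coef_near => //; case: (s) jl => //= jl; apply: branch_slope_near.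
- by rewrite branch_coupling; have := coupling_le; have := tiny_range R; lra.
- rewrite branch_coupling /branch_tol expr0; have := theta_exp_gt0 R ((branch_length s).-1 - 0).
  by have := coupling_le; have := tiny_range R; lra.
- rewrite branch_coupling; have := branch_tolS R jl; have := ler_wpM2r (tol_ge0 j) coupling_le.
  by have := tol_ge0 j.+1; lra.
- exact: branch_recurrence.
- exact: branch_tol_sum.
Qed.

Lemma branch_end_near s : `|branch_diff s (branch_length s) - 1| <= 10^-1.
Proof.
rewrite /branch_diff /branch_pos eqxx addrAC; apply: le_trans (ler_normB _ _) _.
have := box_pos k_range bu' (true, n); rewrite /= eqxx /site_val /=.
by have := box_pos k_range bu (s, branch_length s); rewrite /= subr0; have := k_range; lra.
Qed.

Lemma zres_fold_diff : exists2 p, 2 <= p + 10^-1 <= 4 &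
  zres (cyclic R n m) (kappa b) b tiny u' None = zres (homoclinic R false) (kappa b) b tiny u None
    - kappa b * (branch_diff false 0 - p * branch_diff true 0).
Proof.
have le3 i : `|u' (Upos i)| <= 3 /\ `|u (Upos i)| <= 3.
  by have := box_pos_norm k_range bu' i; have := box_pos_norm k_range bu i; split; lra.
exists (ddpsi b tiny (u' (Upos (true, 0%N))) (u (Upos (true, 0%N)))).
  have := ddpsi_near e_range b_range (le3 (true, 0%N)).1 (le3 (true, 0%N)).2.
  have := box_pos_norm k_range bu' (true, 0%N); have := box_pos_norm k_range bu (true, 0%N).
  move=> ? ? near; have {near} : `|ddpsi b tiny (u' (Upos (true, 0%N))) (u (Upos (true, 0%N))) - b|
      <= 10^-1 by lra.
  by rewrite ler_norml; have := b_range; lra.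
rewrite /branch_diff !branch_pos_lt // -psiB /zres /zforce /= same_tune same_fold.
by rewrite /cyc_fwd /cyc_bwd /=; ring.
Qed.

End BranchResponse.

Section DefectSign.
Variables (R : realType) (n m : nat) (b : R).
Local Notation tiny := (tiny R).
Local Notation zeta := (zeta R).
Local Notation theta := (50 * tiny).
Local Notation N := (minn n m).
Hypothesis n_ge5 : (5 <= n)%N.
Hypothesis m_ge5 : (5 <= m)%N.
Hypothesis n_even : ~~ odd n.
Hypothesis b_range : 2 <= b <= 3.

Let n_gt0 : (0 < n)%N := leq_trans (isT : (0 < 5)%N) n_ge5.
Let m_gt0 : (0 < m)%N := leq_trans (isT : (0 < 5)%N) m_ge5.

Lemma defect_expansion : exists P Q E : R, [/\ 2 / 5 <= P <= 3, 4 / 5 <= Q <= 10,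
  `|E| <= 31 * (2 * (200 * tiny) * theta ^+ N.-1) ^+ 2 &
  defect n m b = kappa b * (Q * (b * zeta) ^+ n - P * zeta ^+ m) + E].
Proof.
have u'_orbitP := cyc_orbitP n_gt0 m_gt0 b_range; set u' := cyc_orbit n m b in u'_orbitP.
have [u'_orbit _ _ u'_tune] := newton_fixed u'_orbitP.2.
have v_le : `|u' Ufold| <= radius tiny hom_depth Ufold / 2.
  by have := u'_orbitP.1 Ufold; rewrite /= subr0.
have tau_le : `|odflt 0 (Some (tau b))| <= radius tiny hom_depth Utune / 2.
  by have := (hom_orbitP b_range).1 Utune; rewrite /= subr0.
have sp := small_params_family b_range.
have [u uP] := newton_orbit_exists (admissible_homoclinic R false) sp
  (v_le : `|odflt 0 (Some _)| <= _) tau_le.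
have [u_orbit _ u_fold u_tune] := newton_fixed uP.2.
have same_fold : u' Ufold = u Ufold by rewrite u_fold.
have same_tune : u' Utune = u Utune by rewrite u_tune.
have bu' := cyc_orbit_box n_gt0 m_gt0 b_range; have bu := newton_orbit_box sp uP.
have response := branch_response n_gt0 m_gt0 b_range bu' bu u'_orbit u_orbit same_fold same_tune.
have [[P1 P1_range rightE] [P2 P2_range leftE]] := (response true, response false).
have [p p_range foldE] := zres_fold_diff n_gt0 m_gt0 b_range bu' bu same_fold same_tune.
have := branch_end_near bu' bu true; have := branch_end_near bu' bu false.
set endL := branch_diff _ _ _ _ false _; set endR := branch_diff _ _ _ _ true _.
rewrite !ler_norml => endL_near endR_near.
exists (P2 * endL), (p * (P1 * endR)), (zres (homoclinic R false) (kappa b) b tiny u None); split.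
- by nra.
- have : 9 / 20 <= P1 * endR <= 22 / 10 by nra.
  by nra.
- have := homoclinic_remainder b_range v_le uP.
  have := sqr_le_norm (fold_shift n_gt0 m_gt0 b_range); rewrite -/u' -sqrrN opprB.
  by lra.
- have powE : (- (b * zeta)) ^+ n = (b * zeta) ^+ n.
    by rewrite exprNn -signr_odd (negbTE n_even) expr0 mul1r.
  rewrite /defect -/u' foldE rightE leftE /branch_root /branch_length -/endL -/endR powE.
  by ring.
Qed.

Lemma remainder_small l : (5 <= l)%N ->
  31 * (2 * (200 * tiny) * theta ^+ l.-1) ^+ 2 <= zeta / 10 * zeta ^+ l.
Proof.
move=> l_ge5; have [z_gt0 _] := andP (zeta_range R).
have -> : 31 * (2 * (200 * tiny) * theta ^+ l.-1) ^+ 2 = 31 * 64 * (5000 * tiny * zeta) ^+ l.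
  have -> : 2 * (200 * tiny) * theta ^+ l.-1 = 8 * (theta * theta ^+ l.-1) by ring.
  rewrite -exprS prednK; last exact: leq_trans l_ge5.
  have -> : 5000 * tiny * zeta = theta ^+ 2 by rewrite /@zeta; field.
  by rewrite [in RHS]exprAC exprMn; ring.
rewrite exprMn mulrA ler_wpM2r ?exprn_ge0 ?ltW //.
have coefE : 5000 * tiny = 2^-1 * 10^-1 ^+ 2 :> R by rewrite /@tiny; field.
have : (5000 * tiny) ^+ l <= (5000 * tiny) ^+ 5.
  by rewrite coefE; apply: ler_wiXn2l => //; lra.
by rewrite coefE /@zeta /@tiny; lra.
Qed.

Let zeta_exp_le : zeta ^+ n <= (b * zeta) ^+ n.
Proof.
have [z_gt0 _] := andP (zeta_range R).
have z_le : zeta <= b * zeta by rewrite ler_peMl ?(ltW z_gt0) //; have := b_range; lra.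
by apply: lerXn2r => //; rewrite nnegrE; lra.
Qed.

Lemma defect_lt0 : 100 * (b * zeta) ^+ n <= zeta ^+ m -> defect n m b < 0.
Proof.
move=> saddle_wins; have [z_gt0 z_le] := andP (zeta_range R).
have [P [Q [E [P_range Q_range E_le ->]]]] := defect_expansion.
have zm_gt0 : 0 < zeta ^+ m by rewrite exprn_gt0.
have zn_gt0 : 0 < zeta ^+ n by rewrite exprn_gt0.
have zn_le := zeta_exp_le.
have mn : (m <= n)%N.
  rewrite leqNgt; apply/negP => nm.
  have : zeta ^+ m <= zeta ^+ n by apply: ler_wiXn2l; [exact: ltW | lra | exact: ltnW].
  lra.
move: E_le; rewrite (minn_idPr mn) => /le_trans/(_ (remainder_small m_ge5)).
rewrite ler_norml => /andP[_ E_le]; have kap_range := kappa_bounds b_range.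
have balance : Q * (b * zeta) ^+ n - P * zeta ^+ m <= - (3 / 10) * zeta ^+ m.
  by have : 0 < (b * zeta) ^+ n by [lra]; nra.
have : kappa b * (Q * (b * zeta) ^+ n - P * zeta ^+ m) <= zeta * (- (3 / 10) * zeta ^+ m).
  have : 0 <= (kappa b - zeta) * zeta ^+ m by apply: mulr_ge0; [lra | exact: ltW].
  have : 0 < kappa b by lra.
  by nra.
have : 0 < zeta * zeta ^+ m by rewrite mulr_gt0.
by lra.
Qed.

Lemma defect_gt0 : 100 * zeta ^+ m <= (b * zeta) ^+ n -> 0 < defect n m b.
Proof.
move=> saddle_loses; have [z_gt0 z_le] := andP (zeta_range R).
have [P [Q [E [P_range Q_range E_le ->]]]] := defect_expansion.
have zm_gt0 : 0 < zeta ^+ m by rewrite exprn_gt0.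
have zn_gt0 : 0 < zeta ^+ n by rewrite exprn_gt0.
have zn_le := zeta_exp_le.
have min_le : zeta ^+ N <= (b * zeta) ^+ n by rewrite /minn; case: ifP => _ //; lra.
have N_ge5 : (5 <= N)%N by rewrite leq_min n_ge5.
have := le_trans E_le (remainder_small N_ge5); rewrite ler_norml => /andP[{}E_le _].
have kap_range := kappa_bounds b_range.
have balance : 7 / 10 * (b * zeta) ^+ n <= Q * (b * zeta) ^+ n - P * zeta ^+ m.
  by have : 0 < (b * zeta) ^+ n by [lra]; nra.
have : zeta * (7 / 10 * (b * zeta) ^+ n) <= kappa b * (Q * (b * zeta) ^+ n - P * zeta ^+ m).
  by apply: ler_pM => //; [exact: ltW | lra | lra].
have : zeta / 10 * zeta ^+ N <= zeta / 10 * (b * zeta) ^+ n by apply: ler_wpM2l => //; lra.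
have : 0 < zeta * (b * zeta) ^+ n by apply: mulr_gt0 => //; lra.
by lra.
Qed.

End DefectSign.

Lemma expr_unbounded (R : realType) (r c : R) : 1 < r -> \forall n \near \oo, c <= r ^+ n.
Proof.
move=> r_gt1; have r_gt0 : 0 < r by lra.
have lim : (r^-1) ^+ n @[n --> \oo] --> (0 : R).
  by apply: cvg_expr; rewrite gtr0_norm ?invr_gt0 // invf_lt1.
have : \forall n \near \oo, (r^-1) ^+ n < (`|c| + 1)^-1.
  by apply: (cvgr_lt 0) => //; rewrite invr_gt0 ltr_wpDl.
apply: filterS => n; rewrite exprVn ltf_pV2 ?posrE ?exprn_gt0 ?ltr_wpDl //.
by have := ler_norm c; lra.
Qed.

Lemma lipschitz_IVT0 (R : realType) (g : R -> R) (a b c : R) : a < b ->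
  {in `[a, b]%R &, forall x y, `|g x - g y| <= c * `|x - y|} ->
  g a < 0 -> 0 < g b -> exists2 x, a < x < b & g x = 0.
Proof.
move=> ab g_lip ga gb.
have g_cont : {within `[a, b], continuous g}.
  apply/subspace_continuousP => x x_in; apply/cvgrPdist_lt => eps eps_gt0.
  have delta_gt0 : 0 < eps / (`|c| + 1) by rewrite divr_gt0 // ltr_wpDl.
  rewrite near_withinE; apply: filterS (nbhsx_ballx x _ delta_gt0) => y xy y_in.
  apply: (le_lt_trans (g_lip x y x_in y_in)); move: xy; rewrite -ball_normE /= ltr_pdivlMr ?ltr_wpDl //.
  by have := ler_norm c; have := normr_ge0 (x - y); nra.
have /(IVT (ltW ab) g_cont) [x] : Num.min (g a) (g b) <= 0 <= Num.max (g a) (g b).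
  by rewrite ge_min le_max (ltW ga) (ltW gb) orbT.
rewrite in_itv /= => /andP[ax xb] gx; exists x => //.
by rewrite !lt_neqAle ax xb !andbT; apply/andP; split; apply/eqP => xE; move: ga gb gx;
  rewrite ?xE -?xE; lra.
Qed.

Lemma expr_bracket (R : realType) (r x : R) : 0 < r < 1 -> 0 < x < 1 ->
  exists q, r ^+ q.+1 <= x < r ^+ q.
Proof.
move=> /andP[r_gt0 r_lt1] /andP[x_gt0 x_lt1].
have small : exists q, r ^+ q <= x.
  have [|q _ rq_le] := @expr_unbounded _ r^-1 x^-1; first by rewrite invf_gt1.
  by exists q; have := rq_le q (leqnn q); rewrite exprVn lef_pV2 ?posrE ?exprn_gt0.
have [[|q] rq_le least] := ex_minnP small.
  by move: rq_le; rewrite expr0 leNgt x_lt1.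
by exists q; rewrite rq_le ltNge; apply/negP => /least; rewrite ltnn.
Qed.

Section ClosingParameters.
Variable R : realType.
Local Notation zeta := (zeta R).
Implicit Types b : R.

Lemma large_even_exponent b1 b2 (c : R) K : 2 <= b1 < b2 ->
  exists2 n, (K <= n)%N & c * b1 ^+ n.*2 <= b2 ^+ n.*2.
Proof.
move=> b12; have ratio_gt1 : 1 < (b2 / b1) ^+ 2.
  by rewrite expr_gt1 ?ltr_pdivlMr ?divr_ge0 //; lra.
have [n0 _ large] := expr_unbounded c ratio_gt1.
exists (n0 + K)%N; first exact: leq_addl.
rewrite -ler_pdivlMr; last by rewrite exprn_gt0 //; lra.
by have := large (n0 + K)%N (leq_addr _ _); rewrite -exprM mul2n expr_div_n.
Qed.

Lemma balanced_exponents b1 b2 K : 2 <= b1 < b2 -> b2 <= 3 ->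
  exists n m, [/\ (K <= n)%N, (K <= m)%N, ~~ odd n & ~~ odd m] /\
    (100 * (b1 * zeta) ^+ n <= zeta ^+ m /\ 100 * zeta ^+ m <= (b2 * zeta) ^+ n).
Proof.
move=> b12 b2_le; have [z_gt0 z_le] := andP (zeta_range R).
have z2_range : 0 < zeta ^+ 2 < 1 by rewrite exprn_gt0 //= expr2; nra.
have [n nK ratio] := large_even_exponent (10 ^+ 4 / zeta ^+ 2) K b12.
pose A := (b2 * zeta) ^+ n.*2.
have b2z_gt0 : 0 < b2 * zeta by rewrite mulr_gt0 //; lra.
have A_gt0 : 0 < A by rewrite exprn_gt0.
have A_le : A <= zeta ^+ n.
  have square_le : (b2 * zeta) ^+ 2 <= zeta.
    have b2z_le : b2 * zeta <= 3 * zeta by rewrite ler_wpM2r // ltW.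
    by rewrite expr2; nra.
  by rewrite /A -mul2n exprM lerXn2r ?nnegrE ?sqr_ge0 ?(ltW z_gt0).
have A_large : 10 ^+ 4 * (b1 * zeta) ^+ n.*2 <= A * zeta ^+ 2.
  have powM b : (b * zeta) ^+ n.*2 = b ^+ n.*2 * zeta ^+ n.*2 by apply: exprMn.
  rewrite /A !powM -ler_pdivrMr ?exprn_gt0 //.
  have := ler_wpM2r (ltW (exprn_gt0 n.*2 z_gt0)) ratio.
  by move: (b1 ^+ _) (b2 ^+ _) (zeta ^+ n.*2) (zeta ^+ 2) => x y z w; lra.
have A_lt : 0 < A / 100 < 1.
  have zn_le1 : zeta ^+ n <= 1 by apply: exprn_ile1; lra.
  by lra.
have [q /andP[below above]] := expr_bracket z2_range A_lt.
have powE l : zeta ^+ l.*2 = (zeta ^+ 2) ^+ l by rewrite -exprM mul2n.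
exists n.*2, q.+1.*2; split; first split; rewrite ?odd_double //.
- by rewrite -addnn (leq_trans nK) // leq_addr.
- rewrite leqNgt; apply/negP => mK.
  have : zeta ^+ K <= zeta ^+ q.+1.*2 by apply: ler_wiXn2l; [exact: ltW | lra | exact: ltnW].
  have : zeta ^+ n <= zeta ^+ K by apply: ler_wiXn2l; [exact: ltW | lra |].
  have : 0 < zeta ^+ q.+1.*2 by rewrite exprn_gt0.
  by rewrite powE; lra.
- rewrite powE -/A; split; last by lra.
  rewrite [X in _ <= X]exprS; have := ler_wpM2r (ltW (andP z2_range).1) (ltW above).
  by move: A_large; lra.
Qed.

Lemma closing_parameters b1 b2 K : (5 <= K)%N -> 2 <= b1 < b2 -> b2 <= 3 ->
  exists n m b, [/\ (K <= n)%N, (K <= m)%N, ~~ odd n & ~~ odd m] /\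
    b1 < b < b2 /\ defect n m b = 0.
Proof.
move=> K_ge5 b12 b2_le.
have [n [m [[Kn Km n_even m_even] [wins loses]]]] := balanced_exponents K b12 b2_le.
have [n_ge5 m_ge5] := (leq_trans K_ge5 Kn, leq_trans K_ge5 Km).
have [b1_range b2_range] : 2 <= b1 <= 3 /\ 2 <= b2 <= 3 by lra.
have neg := defect_lt0 n_ge5 m_ge5 n_even b1_range wins.
have pos := defect_gt0 n_ge5 m_ge5 n_even b2_range loses.
have lip : {in `[b1, b2]%R &, forall x y : R, `|defect n m x - defect n m y| <=
    7 * radius (tiny R) (cyc_depth n m) Utune * `|x - y|}.
  move=> x y; rewrite !in_itv /= => x_in y_in; rewrite mulrAC.
  by apply: defect_lipschitz; [lra | lra | exact: leq_trans n_ge5 | exact: leq_trans m_ge5].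
have [|b b_in b_closed] := lipschitz_IVT0 _ lip neg pos; first by lra.
by exists n, m, b.
Qed.

End ClosingParameters.

(** * Strict differentiability of the iterates, jointly in the parameter *)

(* The estimates below are needed over the reals, to continue a cycle in the parameter, and over
   the complex numbers, where it is repelling. *)
Record valued_ext (R : realType) := ValuedExt {
  vfield :> fieldType;
  vnorm : vfield -> R;
  vincl : {rmorphism R -> vfield};
  vnormD : forall x y, vnorm (x + y) <= vnorm x + vnorm y;
  vnormM : forall x y, vnorm (x * y) = vnorm x * vnorm y;
  vnorm_incl : forall r, vnorm (vincl r) = `|r|
}.
Arguments vnorm {R K} _ : rename, simpl never.
Arguments vincl {R K} : rename.

Section ValuedExt.
Variables (R : realType) (K : valued_ext R).
Implicit Types x y : K.

Lemma vnorm0 : vnorm (0 : K) = 0.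
Proof. by rewrite -(rmorph0 vincl) vnorm_incl normr0. Qed.

Lemma vnorm1 : vnorm (1 : K) = 1.
Proof. by rewrite -(rmorph1 vincl) vnorm_incl normr1. Qed.

Lemma vnorm_nat n : vnorm (n%:R : K) = n%:R.
Proof. by rewrite -(rmorph_nat vincl) vnorm_incl normr_nat. Qed.

Lemma vnormN x : vnorm (- x) = vnorm x.
Proof. by rewrite -mulN1r vnormM -(rmorphN1 vincl) vnorm_incl normrN1 mul1r. Qed.

Lemma vnorm_ge0 x : 0 <= vnorm x.
Proof. by have := vnormD x (- x); rewrite subrr vnorm0 vnormN; lra. Qed.

Lemma vnormV x : vnorm x^-1 = (vnorm x)^-1.
Proof.
have [->|x_neq0] := eqVneq x 0; first by rewrite invr0 vnorm0 invr0.
have /(canRL (mulfK _)) : vnorm x^-1 * vnorm x = 1 by rewrite -vnormM mulVf ?vnorm1.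
rewrite mul1r; apply; apply/eqP => nx0; have := vnormM x^-1 x.
by rewrite mulVf // nx0 mulr0 vnorm1 => /eqP; rewrite oner_eq0.
Qed.

Lemma vnorm_eq0 x : (vnorm x == 0) = (x == 0).
Proof.
apply/eqP/eqP => [nx0|->]; last exact: vnorm0.
apply/eqP/negPn/negP => x_neq0; have := vnormM x^-1 x.
by rewrite mulVf // nx0 mulr0 vnorm1 => /eqP; rewrite oner_eq0.
Qed.

Lemma vnorm_gt0 x : (0 < vnorm x) = (x != 0).
Proof. by rewrite lt_neqAle vnorm_ge0 andbT eq_sym vnorm_eq0. Qed.

Lemma vnormX x n : vnorm (x ^+ n) = vnorm x ^+ n.
Proof. by elim: n => [|n IH]; rewrite ?expr0 ?vnorm1 // !exprS vnormM IH. Qed.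

Lemma vnormB x y : vnorm (x - y) <= vnorm x + vnorm y.
Proof. by rewrite -(vnormN y) vnormD. Qed.

Lemma vnormD_ge x y : vnorm x - vnorm y <= vnorm (x + y).
Proof. by have := vnormB (x + y) y; rewrite addrK; lra. Qed.

Lemma vnormB_ge x y : vnorm x - vnorm y <= vnorm (x - y).
Proof. by rewrite -(vnormN y) vnormD_ge. Qed.

Lemma vdistC x y : vnorm (x - y) = vnorm (y - x).
Proof. by rewrite -vnormN opprB. Qed.

Lemma vnormM_le x y (a c : R) : vnorm x <= a -> vnorm y <= c -> vnorm (x * y) <= a * c.
Proof. by move=> xa yc; rewrite vnormM ler_pM ?vnorm_ge0. Qed.

Lemma vnormD_le x y (a c : R) : vnorm x <= a -> vnorm y <= c -> vnorm (x + y) <= a + c.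
Proof. by move=> xa yc; apply: le_trans (vnormD _ _) (lerD xa yc). Qed.

Lemma vnormB_le x y (a c : R) : vnorm x <= a -> vnorm y <= c -> vnorm (x - y) <= a + c.
Proof. by move=> xa yc; apply: le_trans (vnormB _ _) (lerD xa yc). Qed.

Lemma natf_neq0_valued n : (n.+1%:R : K) != 0.
Proof. by rewrite -(rmorph_nat vincl) fmorph_eq0 pnatr_eq0. Qed.

End ValuedExt.

Section MaxNorm.
Variables (R : realType) (K : valued_ext R).
Implicit Types x y : K * K.

Definition maxnorm x : R := Num.max (vnorm x.1) (vnorm x.2).

Lemma maxnorm_le x c : (maxnorm x <= c) = (vnorm x.1 <= c) && (vnorm x.2 <= c).
Proof. by rewrite ge_max. Qed.

Lemma vnorm1_le x : vnorm x.1 <= maxnorm x.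
Proof. by rewrite le_max lexx. Qed.

Lemma vnorm2_le x : vnorm x.2 <= maxnorm x.
Proof. by rewrite le_max lexx orbT. Qed.

Lemma maxnorm_ge0 x : 0 <= maxnorm x.
Proof. exact: le_trans (vnorm_ge0 _) (vnorm1_le x). Qed.

Lemma maxnorm0 : maxnorm 0 = 0.
Proof. by rewrite /maxnorm /= vnorm0 maxxx. Qed.

Lemma maxnormN x : maxnorm (- x) = maxnorm x.
Proof. by rewrite /maxnorm /= !vnormN. Qed.

Lemma maxnormD x y : maxnorm (x + y) <= maxnorm x + maxnorm y.
Proof. by rewrite maxnorm_le !(le_trans (vnormD _ _)) // lerD ?vnorm1_le ?vnorm2_le. Qed.

Definition scale2 (c : K) x : K * K := (c * x.1, c * x.2).

Definition bounded_linear (M : K * K -> K * K) :=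
  [/\ forall x y, M (x + y) = M x + M y, forall c x, M (scale2 c x) = scale2 c (M x) &
      exists2 C : R, 0 <= C & forall x, maxnorm (M x) <= C * maxnorm x].

Lemma bounded_linearN M x : bounded_linear M -> M (- x) = - M x.
Proof.
move=> [_ scaleM _]; have negE z : - z = scale2 (-1) z.
  by case: z => p q; rewrite /scale2 /= !mulN1r.
by rewrite negE scaleM -negE.
Qed.

Lemma bounded_linearB M x y : bounded_linear M -> M (x - y) = M x - M y.
Proof. by move=> linM; have [addM _ _] := linM; rewrite addM bounded_linearN. Qed.

Lemma bounded_linear_id : bounded_linear id.
Proof. by split=> //; exists 1 => // x; rewrite mul1r. Qed.

Lemma bounded_linear_comp M M' :
  bounded_linear M -> bounded_linear M' -> bounded_linear (M' \o M).
Proof.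
move=> [addM scaleM [C C_ge0 boundM]] [addM' scaleM' [C' C'_ge0 boundM']]; split=> [x y|c x|] /=.
- by rewrite addM addM'.
- by rewrite scaleM scaleM'.
- exists (C' * C) => [|x]; first exact: mulr_ge0.
  by apply: le_trans (boundM' _) _; rewrite -mulrA ler_wpM2l.
Qed.

Definition matrix2 (row1 row2 : K * K) (v : K * K) : K * K :=
  (row1.1 * v.1 + row1.2 * v.2, row2.1 * v.1 + row2.2 * v.2).

Lemma matrix2_norm row1 row2 v :
  maxnorm (matrix2 row1 row2 v) <= 2 * (maxnorm row1 + maxnorm row2) * maxnorm v.
Proof.
have row_le row : vnorm (row.1 * v.1 + row.2 * v.2) <= 2 * maxnorm row * maxnorm v.
  have := vnormD_le (vnormM_le (vnorm1_le row) (vnorm1_le v)) (vnormM_le (vnorm2_le row) (vnorm2_le v)).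
  lra.
have row1_ge0 := mulr_ge0 (maxnorm_ge0 row1) (maxnorm_ge0 v).
have row2_ge0 := mulr_ge0 (maxnorm_ge0 row2) (maxnorm_ge0 v).
by rewrite maxnorm_le; have := row_le row1; have := row_le row2; lra.
Qed.

Lemma bounded_linear_matrix2 row1 row2 : bounded_linear (matrix2 row1 row2).
Proof.
split=> [x y|c x|].
- by rewrite /matrix2; congr (_, _) => /=; ring.
- by rewrite /matrix2 /scale2; congr (_, _) => /=; ring.
- exists (2 * (maxnorm row1 + maxnorm row2)) => [|v]; last exact: matrix2_norm.
  by rewrite mulr_ge0 // addr_ge0 ?maxnorm_ge0.
Qed.

Lemma matrix2B row1 row2 row1' row2' v :
  matrix2 row1 row2 v - matrix2 row1' row2' v = matrix2 (row1 - row1') (row2 - row2') v.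
Proof. by rewrite /matrix2; congr (_, _) => /=; ring. Qed.

Definition det2 x y : K := x.1 * y.2 - x.2 * y.1.

Lemma det2_matrix2 row1 row2 x y :
  det2 (matrix2 row1 row2 x) (matrix2 row1 row2 y) = det2 row1 row2 * det2 x y.
Proof. by rewrite /det2 /matrix2 /=; ring. Qed.

End MaxNorm.

Section StrictDifferentiability.
Variables (R : realType) (K : valued_ext R).
Implicit Types (F G : R -> K * K -> K * K) (M : K * K -> K * K) (x y : K * K).

Definition strict_diff F (b0 : R) x0 y0 M := forall eps : R, 0 < eps ->
  exists2 r : R, 0 < r & forall b x y, `|b - b0| <= r ->
    maxnorm (x - x0) <= r -> maxnorm (y - x0) <= r ->
    maxnorm (F b x - F b y - M (x - y)) <= eps * maxnorm (x - y) /\ maxnorm (F b x - y0) <= eps.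

Lemma strict_diff_id b0 x0 : strict_diff (fun=> id) b0 x0 x0 id.
Proof.
move=> eps eps_gt0; exists eps => // b x y _ x_near _; split=> //.
by rewrite subrr maxnorm0 mulr_ge0 ?maxnorm_ge0 ?ltW.
Qed.

Lemma strict_diff_comp F G b0 x0 y0 z0 M M' : bounded_linear M -> bounded_linear M' ->
  strict_diff F b0 x0 y0 M -> strict_diff G b0 y0 z0 M' ->
  strict_diff (fun b x => G b (F b x)) b0 x0 z0 (M' \o M).
Proof.
move=> [_ _ [C C_ge0 boundM]] linM' F_diff G_diff eps eps_gt0.
have [_ _ [C' C'_ge0 boundM']] := linM'.
have epsG_gt0 : 0 < Num.min eps (eps / (2 * (C + 1))).
  by rewrite lt_min eps_gt0 divr_gt0 //; lra.
have [rG rG_gt0 G_near] := G_diff _ epsG_gt0; set epsG := Num.min _ _ in epsG_gt0 G_near.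
have epsF_gt0 : 0 < Num.min (Num.min 1 rG) (eps / (2 * (C' + 1))).
  by rewrite !lt_min rG_gt0 ltr01 divr_gt0 //; lra.
have [rF rF_gt0 F_near] := F_diff _ epsF_gt0; set epsF := Num.min _ _ in epsF_gt0 F_near.
have [epsG_le epsG_C] : epsG <= eps /\ epsG * (2 * (C + 1)) <= eps.
  by rewrite -ler_pdivlMr; [rewrite /epsG !ge_min !lexx !orbT | lra].
have [epsF_le1 [epsF_rG epsF_C]] : epsF <= 1 /\ epsF <= rG /\ epsF * (2 * (C' + 1)) <= eps.
  by rewrite -ler_pdivlMr; [rewrite /epsF !ge_min !lexx !orbT | lra].
exists (Num.min rF rG) => [|b x y]; first by rewrite lt_min rF_gt0.
rewrite !le_min => /andP[bF bG] /andP[xF _] /andP[yF _].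
have [F_lin Fx] := F_near b x y bF xF yF; have [_ Fy] := F_near b y x bF yF xF.
have [G_lin Gx] := G_near b _ _ bG (le_trans Fx epsF_rG) (le_trans Fy epsF_rG).
split; last exact: le_trans Gx epsG_le.
set X := F b x in F_lin G_lin *; set Y := F b y in F_lin G_lin *; clearbody X Y epsF epsG.
have d_ge0 := maxnorm_ge0 (x - y).
have XY : maxnorm (X - Y) <= (C + 1) * maxnorm (x - y).
  rewrite -(subrK (M (x - y)) (X - Y)); apply: le_trans (maxnormD _ _) _.
  by have := boundM (x - y); have := ler_wpM2r d_ge0 epsF_le1; lra.
have -> : G b X - G b Y - (M' \o M) (x - y) =
    (G b X - G b Y - M' (X - Y)) + M' (X - Y - M (x - y)).
  by rewrite (bounded_linearB (X - Y)) //= addrA subrK.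
apply: le_trans (maxnormD _ _) _.
have := le_trans (boundM' _) (ler_wpM2l C'_ge0 F_lin); have := ler_wpM2l (ltW epsG_gt0) XY.
have := ler_wpM2r d_ge0 epsG_C; have := ler_wpM2r d_ge0 epsF_C.
have := mulr_ge0 (ltW epsF_gt0) d_ge0.
by move: G_lin; lra.
Qed.

End StrictDifferentiability.

Section LipschitzAt.
Variables (R : realType) (K : valued_ext R) (P : Type) (d : P -> R) (p0 : P) (r : R).
Hypothesis r_le1 : r <= 1.
Implicit Types G H : P -> K.

Definition lipschitz_at G :=
  exists2 C : R, 0 <= C & forall p, d p <= r -> vnorm (G p - G p0) <= C * d p.

Lemma lipschitz_at1 G : (forall p, d p <= r -> vnorm (G p - G p0) <= d p) -> lipschitz_at G.
Proof. by move=> G_lip; exists 1 => // p /G_lip; rewrite mul1r. Qed.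

Lemma lipschitz_at_cst (c : K) : lipschitz_at (fun=> c).
Proof. by exists 0 => // p _; rewrite subrr vnorm0 mul0r. Qed.

Lemma lipschitz_atD G H : lipschitz_at G -> lipschitz_at H -> lipschitz_at (fun p => G p + H p).
Proof.
move=> [C C_ge0 G_lip] [D D_ge0 H_lip]; exists (C + D) => [|p pr]; first exact: addr_ge0.
by rewrite opprD addrACA mulrDl vnormD_le ?G_lip ?H_lip.
Qed.

Lemma lipschitz_atN G : lipschitz_at G -> lipschitz_at (fun p => - G p).
Proof. by move=> [C C_ge0 G_lip]; exists C => // p /G_lip; rewrite -opprD vnormN. Qed.

Lemma lipschitz_atM G H : lipschitz_at G -> lipschitz_at H -> lipschitz_at (fun p => G p * H p).
Proof.
move=> [C C_ge0 G_lip] [D D_ge0 H_lip].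
exists (C * (D + vnorm (H p0)) + vnorm (G p0) * D) => [|p pr].
  by rewrite addr_ge0 ?mulr_ge0 ?addr_ge0 ?vnorm_ge0.
have -> : G p * H p - G p0 * H p0 =
  (G p - G p0) * ((H p - H p0) + H p0) + G p0 * (H p - H p0) by ring.
have H_le : vnorm (H p - H p0 + H p0) <= D + vnorm (H p0).
  apply: vnormD_le (lexx _); have := H_lip p pr; have := ler_wpM2l D_ge0 (le_trans pr r_le1).
  by rewrite mulr1; lra.
have := vnormD_le (vnormM_le (G_lip p pr) H_le) (vnormM_le (lexx (vnorm (G p0))) (H_lip p pr)).
by lra.
Qed.

Lemma lipschitz_atX G n : lipschitz_at G -> lipschitz_at (fun p => G p ^+ n).
Proof.
move=> G_lip; elim: n => [|n IH]; first exact: lipschitz_at_cst.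
have [C C_ge0 lip] := lipschitz_atM G_lip IH; exists C => // p pr.
by rewrite !exprS; exact: lip.
Qed.

End LipschitzAt.

Section StrictDiffOfSlopes.
Variables (R : realType) (K : valued_ext R) (b0 : R) (x0 : K * K).

Definition pair_dist (p : R * (K * K) * (K * K)) : R :=
  `|p.1.1 - b0| + maxnorm (p.1.2 - x0) + maxnorm (p.2 - x0).

Lemma pair_dist_ge0 p : 0 <= pair_dist p.
Proof. by rewrite !addr_ge0 ?maxnorm_ge0. Qed.

Lemma pair_dist_param p : `|p.1.1 - b0| <= pair_dist p.
Proof. by rewrite /pair_dist -addrA lerDl addr_ge0 ?maxnorm_ge0. Qed.

Lemma pair_dist_left p : maxnorm (p.1.2 - x0) <= pair_dist p.
Proof. by rewrite /pair_dist addrAC lerDr addr_ge0 ?maxnorm_ge0. Qed.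

Lemma pair_dist_right p : maxnorm (p.2 - x0) <= pair_dist p.
Proof. by rewrite /pair_dist lerDr addr_ge0 ?maxnorm_ge0. Qed.

Variable r : R.
Hypothesis r_gt0 : 0 < r.

Let lip := lipschitz_at (K := K) pair_dist (b0, x0, x0) r.
Let lip2 G := lip (fun p => (G p).1) /\ lip (fun p => (G p).2).

Lemma lipschitz_at_maxnorm G : lip2 G -> exists2 C : R, 0 <= C &
  forall p, pair_dist p <= r -> maxnorm (G p - G (b0, x0, x0)) <= C * pair_dist p.
Proof.
move=> [[C C_ge0 lipC] [D D_ge0 lipD]]; exists (C + D) => [|p pr]; first exact: addr_ge0.
have := lipC p pr; have := lipD p pr.
have := mulr_ge0 C_ge0 (pair_dist_ge0 p); have := mulr_ge0 D_ge0 (pair_dist_ge0 p).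
by rewrite maxnorm_le /= => *; apply/andP; split; lra.
Qed.

(* The slopes between two nearby points are close to the differential at [x0]. *)
Lemma strict_diff_of_slopes (F : R -> K * K -> K * K) (slope1 slope2 : _ -> K * K) :
  (forall b x y, F b x - F b y = matrix2 (slope1 (b, x, y)) (slope2 (b, x, y)) (x - y)) ->
  lip2 (fun p => F p.1.1 p.1.2) -> lip2 slope1 -> lip2 slope2 ->
  strict_diff F b0 x0 (F b0 x0) (matrix2 (slope1 (b0, x0, x0)) (slope2 (b0, x0, x0))).
Proof.
move=> slopes /lipschitz_at_maxnorm[C C_ge0 lipF] /lipschitz_at_maxnorm[C1 C1_ge0 lip_1].
move=> /lipschitz_at_maxnorm[C2 C2_ge0 lip_2] eps eps_gt0; pose B := C + 2 * (C1 + C2) + 1.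
have B_gt0 : 0 < B by rewrite /B; lra.
exists (Num.min r (eps / B) / 3) => [|b x y].
  by rewrite divr_gt0 // lt_min r_gt0 divr_gt0.
set d := _ / 3 => b_near x_near y_near; have p_near : pair_dist (b, x, y) <= Num.min r (eps / B).
  by rewrite /pair_dist /=; move: b_near x_near y_near; rewrite /d; lra.
move: (pair_dist_ge0 (b, x, y)) p_near; rewrite le_min => p_ge0 /andP[p_r].
rewrite ler_pdivlMr // => p_eps.
have small c : 0 <= c -> c <= B -> c * pair_dist (b, x, y) <= eps.
  by move=> c_ge0 cB; apply: le_trans p_eps; rewrite mulrC ler_wpM2l.
split; last by apply: le_trans (lipF _ p_r) _; apply: small => //; rewrite /B; lra.
rewrite slopes matrix2B; apply: le_trans (matrix2_norm _ _ _) _.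
rewrite ler_wpM2r ?maxnorm_ge0 //.
apply: le_trans (small (2 * (C1 + C2)) _ _); [|lra|rewrite /B; lra].
by have := lip_1 _ p_r; have := lip_2 _ p_r; lra.
Qed.

End StrictDiffOfSlopes.

(** * The map of the plane and its differential *)

Section PlaneMap.
Variables (R : realType) (K : valued_ext R) (Lam b e t : K).
Implicit Types x y v : K * K.

Definition plane_map x : K * K := (Lam * zpoly t x.1 + wpoly b e x.2, qpoly e x.1).
Definition plane_slope1 x y : K * K := (Lam * ddzpoly t x.1 y.1, ddwpoly b e x.2 y.2).
Definition plane_slope2 x y : K * K := (ddqpoly e x.1 y.1, 0).
Definition plane_diff x : K * K -> K * K := matrix2 (plane_slope1 x x) (plane_slope2 x x).

Lemma plane_mapB x y :
  plane_map x - plane_map y = matrix2 (plane_slope1 x y) (plane_slope2 x y) (x - y).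
Proof.
rewrite /matrix2; congr (_, _) => /=; last by rewrite qpolyB mul0r addr0.
by rewrite -mulrA -zpolyB -wpolyB; ring.
Qed.

Lemma det2_plane_diff x v v' : det2 (plane_diff x v) (plane_diff x v') =
  - (dwpoly b e x.2 * dqpoly e x.1) * det2 v v'.
Proof. by rewrite det2_matrix2 /det2 /dwpoly /dqpoly /=; ring. Qed.

End PlaneMap.

Section FamilyMap.
Variables (R : realType) (K : valued_ext R).

Definition family_map (b : R) := plane_map (vincl (kappa b)^-1 : K) (vincl b) (vincl (tiny R)) (vincl (tau b)).
Definition family_diff (b : R) := plane_diff (vincl (kappa b)^-1 : K) (vincl b) (vincl (tiny R)) (vincl (tau b)).

Lemma kappa_inv_lipschitz b b' : `|(kappa b)^-1 - (kappa b')^-1| <= `|b - b'| :> R.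
Proof.
have [z_gt0 z_le] := andP (zeta_range R).
have kappaV c : (kappa c)^-1 = (zeta R)^-1 - c * zeta R.
  by rewrite /kappa invf_div mulrBl mul1r expr2 [c * _]mulrA mulfK // lt0r_neq0.
have -> : (kappa b)^-1 - (kappa b')^-1 = - zeta R * (b - b') by rewrite !kappaV; ring.
by rewrite normrM normrN (gtr0_norm z_gt0) ler_piMl //; lra.
Qed.

Section LipschitzSlopes.
Variables (P : Type) (d : P -> R) (p0 : P) (r : R).
Hypothesis r_le1 : r <= 1.
Local Notation lip := (lipschitz_at d p0 r).
Variables (Lam b t : P -> K) (e : K) (x y : P -> K * K).
Hypotheses (Lam_lip : lip Lam) (b_lip : lip b) (t_lip : lip t).
Hypotheses (x1_lip : lip (fun p => (x p).1)) (x2_lip : lip (fun p => (x p).2)).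
Hypotheses (y1_lip : lip (fun p => (y p).1)) (y2_lip : lip (fun p => (y p).2)).

Ltac lip := repeat first [ assumption | exact: lipschitz_at_cst | apply: (lipschitz_atM r_le1) |
  apply: lipschitz_atD | apply: lipschitz_atN | apply: (lipschitz_atX _ r_le1) ].

Lemma lipschitz_ddquartic (u v : P -> K) : lip u -> lip v -> lip (fun p => ddquartic (u p) (v p)).
Proof. by move=> u_lip v_lip; rewrite /ddquartic; lip. Qed.

Lemma lipschitz_plane_slope1 : lip (fun p => (plane_slope1 (Lam p) (b p) e (t p) (x p) (y p)).1) /\
  lip (fun p => (plane_slope1 (Lam p) (b p) e (t p) (x p) (y p)).2).
Proof.
split; first by rewrite /plane_slope1 /ddzpoly /=; lip.
by apply: lipschitz_atD => //; apply: (lipschitz_atM r_le1); [lip | exact: lipschitz_ddquartic].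
Qed.

Lemma lipschitz_plane_slope2 : lip (fun p => (plane_slope2 e (x p) (y p)).1) /\
  lip (fun p => (plane_slope2 e (x p) (y p)).2).
Proof.
split; last exact: lipschitz_at_cst.
apply: lipschitz_atD; first exact: lipschitz_at_cst.
by apply: (lipschitz_atM r_le1); [lip | exact: lipschitz_ddquartic].
Qed.

Lemma lipschitz_plane_map : lip (fun p => (plane_map (Lam p) (b p) e (t p) (x p)).1) /\
  lip (fun p => (plane_map (Lam p) (b p) e (t p) (x p)).2).
Proof. by split; rewrite /plane_map /zpoly /wpoly /qpoly /=; lip. Qed.

End LipschitzSlopes.

Lemma strict_diff_family b0 x0 : 2 < b0 < 3 ->
  strict_diff family_map b0 x0 (family_map b0 x0) (family_diff b0 x0).
Proof.
move=> b0_range; pose r := Num.min 1 (Num.min (b0 - 2) (3 - b0)).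
have r_gt0 : 0 < r by rewrite !lt_min; apply/and3P; split; lra.
have [r_le1 [r_left r_right]] : r <= 1 /\ r <= b0 - 2 /\ r <= 3 - b0.
  by rewrite /r !ge_min !lexx !orbT.
clearbody r; set dist := pair_dist b0 x0; set p0 := (b0, x0, x0).
have param_lip (g : R -> R) : (forall p, dist p <= r -> `|g p.1.1 - g b0| <= `|p.1.1 - b0|) ->
    lipschitz_at (K := K) dist p0 r (fun p => vincl (g p.1.1)).
  move=> g_lip; apply: lipschitz_at1 => p pr; rewrite -rmorphB vnorm_incl.
  by apply: le_trans (g_lip p pr) (pair_dist_param _ _ _).
have Lam_lip := param_lip (fun b => (kappa b)^-1) (fun p _ => kappa_inv_lipschitz p.1.1 b0).
have b_lip := param_lip id (fun p _ => lexx _).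
have tau_lip : lipschitz_at (K := K) dist p0 r (fun p => vincl (tau p.1.1)).
  apply: param_lip => p pr; apply: tau_lipschitz; last by lra.
  by have := le_trans (pair_dist_param b0 x0 p) pr; rewrite ler_norml; lra.
have x1_lip : lipschitz_at dist p0 r (fun p => p.1.2.1).
  by apply: lipschitz_at1 => p _; apply: le_trans (vnorm1_le (p.1.2 - x0)) (pair_dist_left _ _ _).
have x2_lip : lipschitz_at dist p0 r (fun p => p.1.2.2).
  by apply: lipschitz_at1 => p _; apply: le_trans (vnorm2_le (p.1.2 - x0)) (pair_dist_left _ _ _).
have y1_lip : lipschitz_at dist p0 r (fun p => p.2.1).
  by apply: lipschitz_at1 => p _; apply: le_trans (vnorm1_le (p.2 - x0)) (pair_dist_right _ _ _).
have y2_lip : lipschitz_at dist p0 r (fun p => p.2.2).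
  by apply: lipschitz_at1 => p _; apply: le_trans (vnorm2_le (p.2 - x0)) (pair_dist_right _ _ _).
pose slope1 (p : R * (K * K) * (K * K)) := plane_slope1 (vincl (kappa p.1.1)^-1)
  (vincl p.1.1) (vincl (tiny R)) (vincl (tau p.1.1)) p.1.2 p.2.
pose slope2 (p : R * (K * K) * (K * K)) := plane_slope2 (vincl (tiny R)) p.1.2 p.2.
apply: (strict_diff_of_slopes (slope1 := slope1) (slope2 := slope2) r_gt0).
- by move=> b x y; exact: plane_mapB.
- exact: (lipschitz_plane_map r_le1 _ Lam_lip b_lip tau_lip x1_lip x2_lip).
- exact: (lipschitz_plane_slope1 r_le1 _ Lam_lip b_lip tau_lip x1_lip x2_lip y1_lip y2_lip).
- exact: (lipschitz_plane_slope2 r_le1 _ x1_lip y1_lip).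
Qed.

Section Iterates.
Variables (b0 : R) (pts : nat -> K * K).

Fixpoint tangent (k : nat) : K * K -> K * K :=
  if k is k'.+1 then family_diff b0 (pts k') \o tangent k' else id.

Lemma bounded_linear_tangent k : bounded_linear (tangent k).
Proof.
elim: k => [|k IH]; first exact: bounded_linear_id.
exact: (bounded_linear_comp IH (bounded_linear_matrix2 _ _)).
Qed.

Lemma det2_tangent k x y : det2 (tangent k x) (tangent k y) =
  (\prod_(j < k) - (dwpoly (vincl b0) (vincl (tiny R)) (pts j).2
                    * dqpoly (vincl (tiny R)) (pts j).1)) * det2 x y.
Proof.
elim: k => [|k IH]; first by rewrite big_ord0 mul1r.
by rewrite /= det2_plane_diff IH big_ord_recr /= [RHS]mulrAC [RHS]mulrC.
Qed.

Lemma strict_diff_iter k : 2 < b0 < 3 -> (forall j, family_map b0 (pts j) = pts j.+1) ->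
  strict_diff (fun b => iter k (family_map b)) b0 (pts 0%N) (pts k) (tangent k).
Proof.
move=> b0_range pts_orbit; elim: k => [|k IH]; first exact: strict_diff_id.
apply: (strict_diff_comp (bounded_linear_tangent k) (bounded_linear_matrix2 _ _) IH).
by rewrite -pts_orbit; exact: strict_diff_family.
Qed.

End Iterates.

End FamilyMap.
Arguments family_map {R} K b x.
Arguments family_diff {R} K b x.

(** * The closed orbit and its tangent vectors *)

Section CyclePositions.
Variables n m : nat.
Hypothesis m_gt0 : (0 < m)%N.

Definition on_cycle (o : option branch_index) : bool :=
  if o is Some (s, i) then (if s then i <= n else i < m)%N else true.
Definition cycle_pos k := iter k (cyc_fwd n m) None.
Definition cycle_length := (n + m).+2.

Lemma cyc_fwd_on_cycle o : on_cycle o -> on_cycle (cyc_fwd n m o).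
Proof.
case: o => [[[] i]|] //=; rewrite /cyc_fwd; first by case: i => //= i /ltnW.
by case: eqP => [_ _|ne i_lt] //=; rewrite ltn_neqAle i_lt andbT; apply/eqP => iE; apply: ne; rewrite -iE.
Qed.

Lemma cyc_fwdK o : on_cycle o -> cyc_bwd n m (cyc_fwd n m o) = o.
Proof.
case: o => [[[] i]|] //=; rewrite /cyc_fwd /cyc_bwd /=.
  by case: i => [|i] //= i_lt; case: eqP => // -[iE]; rewrite iE ltnn in i_lt.
by case: (altP (Some (false, i) =P Some (false, m.-1))) => [[->]|_] /= _; rewrite ?eqxx.
Qed.

Lemma cycle_pos_on_cycle k : on_cycle (cycle_pos k).
Proof. by elim: k => // k; exact: cyc_fwd_on_cycle. Qed.

Lemma cycle_pos_false k : (k < m)%N -> cycle_pos k.+1 = Some (false, k).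
Proof.
elim: k => [|k IH] k_lt //; rewrite /cycle_pos iterS -/(cycle_pos k.+1) IH ?(ltnW k_lt) //.
by rewrite /cyc_fwd; case: eqP => // -[kE]; move: k_lt; rewrite kE prednK ?ltnn.
Qed.

Lemma cycle_pos_true j : (j <= n)%N -> cycle_pos (m + j).+1 = Some (true, (n - j)%N).
Proof.
elim: j => [|j IH] j_le.
  rewrite addn0 subn0 /cycle_pos iterS -/(cycle_pos m) -{2}(prednK m_gt0).
  by rewrite cycle_pos_false ?prednK // /cyc_fwd eqxx.
by rewrite addnS /cycle_pos iterS -/(cycle_pos (m + j).+1) IH ?(ltnW j_le) // -subSS subSn.
Qed.

Lemma cycle_pos_length : cycle_pos cycle_length = None.
Proof.
by rewrite /cycle_length addnC /cycle_pos iterS -/(cycle_pos (m + n).+1) cycle_pos_true // subnn.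
Qed.

Lemma cycle_pos_eq_None k : (k < cycle_length)%N -> (cycle_pos k == None) = (k == 0%N).
Proof.
case: k => // k; rewrite /cycle_length !ltnS => k_le.
have [k_lt|k_ge] := ltnP k m; first by rewrite cycle_pos_false.
by rewrite -(subnKC k_ge) cycle_pos_true // leq_subLR addnC.
Qed.

End CyclePositions.

Section CycleOrbit.
Variables (R : realType) (n m : nat) (b : R).
Hypotheses (n_gt0 : (0 < n)%N) (m_gt0 : (0 < m)%N).
Hypothesis b_range : 2 <= b <= 3.
Hypothesis closed : defect n m b = 0.
Local Notation tiny := (tiny R).
Local Notation u := (cyc_orbit n m b).
Local Notation fwd := (cyc_fwd n m).
Local Notation bwd := (cyc_bwd n m).

Definition pointz o : R := zval u o.
Definition pointw o : R := qpoly tiny (pointz (bwd o)).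

(* The tangent vector is doubled in one turn around the cycle. The solution of the orbit equations
   is rescaled by [wfwd] and [wbwd] halfway, and the vectors below by [turn] at the fold. *)
Definition tangent_scale (o : option branch_index) : R := if o is Some (true, _) then 2 else 1.
Definition turn (o : option branch_index) : R := if fwd o is None then 2 else 1.
Definition vecz o : R := tangent_scale o * ztan u o.
Definition vecw o : R :=
  tangent_scale o * (dqpoly tiny (pointz (bwd o)) * (wbwd (cyclic R n m) o * ztan u (bwd o))).

Lemma tangent_scale_fwd o :
  tangent_scale o * wfwd (cyclic R n m) o = turn o * tangent_scale (fwd o).
Proof.
rewrite /turn /tangent_scale /= /cyc_fwd; case: eqP => [->|_]; first by rewrite mulrC.
by case: o => [[[] [|i]]|] /=; ring.
Qed.

Lemma tangent_scale_bwd o : on_cycle n m o ->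
  tangent_scale o = turn o * (tangent_scale (fwd o) * wbwd (cyclic R n m) (fwd o)).
Proof.
rewrite /turn /tangent_scale /= /cyc_fwd; case: eqP => [-> _|_] /=; first by rewrite eqxx; field.
case: o => [[[] [|i]]|] /= i_le; rewrite ?mulr1 ?mul1r //.
by case: eqP => [[iE]|]; rewrite ?mulr1 //; rewrite iE ltnn in i_le.
Qed.

Lemma cyc_orbit_equations : u Utune = tau b /\
  forall o, zres (cyclic R n m) (kappa b) b tiny u o = 0 /\ tres (cyclic R n m) (kappa b) b tiny u o = 0.
Proof.
have [z0 t0 fold0 tuneE] := newton_fixed (cyc_orbitP n_gt0 m_gt0 b_range).2.
by split=> // -[i|].
Qed.

Let kappa_neq0 : kappa b != 0.
Proof. by have [k_gt0 _] := andP (kappa_range b_range); exact: lt0r_neq0. Qed.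

Lemma pointz_fwd o : (kappa b)^-1 * zpoly (tau b) (pointz o) + wpoly b tiny (pointw o) = pointz (fwd o).
Proof.
have [tuneE eqs] := cyc_orbit_equations; have [zres0 _] := eqs o.
move: zres0; rewrite /zres tuneE /zforce => /eqP; rewrite subr_eq0 => /eqP zE.
by rewrite [zpoly _ _]zE mulKf // subrK.
Qed.

Lemma pointw_fwd o : on_cycle n m o -> qpoly tiny (pointz o) = pointw (fwd o).
Proof. by move=> o_on; rewrite /pointw cyc_fwdK. Qed.

Lemma vecz_fwd o :
  (kappa b)^-1 * dzpoly (tau b) (pointz o) * vecz o + dwpoly b tiny (pointw o) * vecw o =
  turn o * vecz (fwd o).
Proof.
have [tuneE eqs] := cyc_orbit_equations; have [_ tres0] := eqs o.
move: tres0; rewrite /tres tuneE => /eqP; rewrite subr_eq0 => /eqP tE.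
have -> : (kappa b)^-1 * dzpoly (tau b) (pointz o) * vecz o =
    tangent_scale o * ((kappa b)^-1 * (dzpoly (tau b) (pointz o) * ztan u o)) by rewrite /vecz; ring.
rewrite [_ * ztan u o]tE mulKf // /tforce /vecz [RHS]mulrA -tangent_scale_fwd /vecw /=.
by rewrite /dpsi /ddpsi -/(pointz (bwd o)) -/(pointw o) /dwpoly /dqpoly /=; ring.
Qed.

Lemma vecw_fwd o : on_cycle n m o -> dqpoly tiny (pointz o) * vecz o = turn o * vecw (fwd o).
Proof. by move=> o_on; rewrite /vecw cyc_fwdK // /vecz {1}tangent_scale_bwd //; ring. Qed.

Lemma pointz_norm o : `|pointz o| <= 21 / 10.
Proof. exact: (zval_norm (tiny_range R) (cyc_orbit_box n_gt0 m_gt0 b_range)). Qed.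

Lemma pointw_norm o : `|pointw o| <= 24 / 10.
Proof.
have z_le := pointz_norm (bwd o); have z_le4 : `|pointz (bwd o)| <= 4 by lra.
have [/ltW tiny_ge0 tiny_le] := andP (tiny_range R).
have e_range : 0 <= tiny <= 10^-1 ^+ 6 by apply/andP.
by apply: le_trans (qpoly_norm e_range z_le4) _; lra.
Qed.

Lemma pointz_fold : `|pointz None - 2| <= 10^-1.
Proof.
have -> : pointz None - 2 = u Ufold by rewrite /pointz /=; ring.
by have := box_fold (tiny_range R) (cyc_orbit_box n_gt0 m_gt0 b_range); lra.
Qed.

Lemma pointz_off_fold i : `|pointz (Some i)| <= 11 / 10.
Proof. exact: (box_pos_norm (tiny_range R) (cyc_orbit_box n_gt0 m_gt0 b_range)). Qed.

Lemma jacobian_bound o : 19 / 10 <= dwpoly b tiny (pointw o) * dqpoly tiny (pointz o).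
Proof.
have [/ltW tiny_ge0 tiny_le] := andP (tiny_range R).
have e_range : 0 <= tiny <= 10^-1 ^+ 6 by apply/andP.
have z_le := pointz_norm o; have z_le4 : `|pointz o| <= 4 by lra.
have w_le := pointw_norm o; have w_le4 : `|pointw o| <= 4 by lra.
have dw_ge : 199 / 100 <= dwpoly b tiny (pointw o).
  have := ddwpoly_near e_range b w_le4 w_le4; rewrite -/(dwpoly b tiny (pointw o)) ler_norml.
  by have := b_range; lra.
have dq_ge : 99 / 100 <= dqpoly tiny (pointz o).
  have := ddquartic_small e_range z_le4 z_le4; rewrite ler_norml /dqpoly /ddqpoly.
  by lra.
by nra.
Qed.

End CycleOrbit.

(** * Eigenframes and continuation of fixed points *)

Section EigenFrame.
Variables (R : realType) (K : valued_ext R).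
Implicit Types (w l c h : K) (k : R) (x y v : K * K).

(* [(1, w0)] is an eigenvector of eigenvalue [l], and [h] is the other eigenvalue. *)
Definition shear w0 v : K := v.2 - w0 * v.1.
Definition eigenframe (M : K * K -> K * K) w0 l c h := forall v,
  (M v).1 = l * v.1 + c * shear w0 v /\ shear w0 (M v) = h * shear w0 v.

Lemma shearD w0 x y : shear w0 (x + y) = shear w0 x + shear w0 y.
Proof. by rewrite /shear /=; ring. Qed.

Lemma shearN w0 x : shear w0 (- x) = - shear w0 x.
Proof. by rewrite /shear /=; ring. Qed.

Lemma shear_scale2 w0 l x : shear w0 (scale2 l x) = l * shear w0 x.
Proof. by rewrite /shear /=; ring. Qed.

Lemma vnorm_shear w0 x : vnorm (shear w0 x) <= (1 + vnorm w0) * maxnorm x.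
Proof.
have := vnormB_le (vnorm2_le x) (vnormM_le (lexx (vnorm w0)) (vnorm1_le x)).
by rewrite -/(shear w0 x); lra.
Qed.

Lemma eigenframe_of_det M w0 l (D : K) : l != 0 -> bounded_linear M ->
  M (1, w0) = scale2 l (1, w0) -> (forall x y, det2 (M x) (M y) = D * det2 x y) ->
  eigenframe M w0 l (M (0, 1)).1 (D / l).
Proof.
move=> l_neq0 [addM scaleM _] eigen detM v.
have vE : v = scale2 v.1 (1, w0) + scale2 (shear w0 v) (0, 1).
  by case: v => p q; rewrite /scale2 /shear /=; congr (_, _) => /=; ring.
split; first by rewrite {1}vE addM !scaleM eigen /scale2 /=; ring.
have := detM (1, w0) v; rewrite eigen /det2 /scale2 /shear /= => detE.
apply: (mulfI l_neq0); rewrite [RHS]mulrA [l * (D / l)]mulrC divfK //.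
have -> : (D : K) * (v.2 - w0 * v.1) = D * (1 * v.2 - w0 * v.1) by rewrite mul1r.
by rewrite -detE; ring.
Qed.

Definition frame_norm w0 k v : R := Num.max (vnorm v.1) (k * vnorm (shear w0 v)).

Lemma frame_norm_le w0 k v (a : R) :
  (frame_norm w0 k v <= a) = (vnorm v.1 <= a) && (k * vnorm (shear w0 v) <= a).
Proof. by rewrite ge_max. Qed.

Lemma frame_norm_ge0 w0 k v : 0 <= frame_norm w0 k v.
Proof. by rewrite le_max vnorm_ge0. Qed.

Lemma frame_norm0 w0 k : frame_norm w0 k 0 = 0.
Proof. by rewrite /frame_norm /shear /= mulr0 subr0 vnorm0 mulr0 maxxx. Qed.

Lemma frame_normN w0 k v : frame_norm w0 k (- v) = frame_norm w0 k v.
Proof. by rewrite /frame_norm shearN !vnormN. Qed.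

Lemma frame_norm_scale2 w0 k l v : frame_norm w0 k (scale2 l v) = vnorm l * frame_norm w0 k v.
Proof. by rewrite /frame_norm shear_scale2 !vnormM mulrCA maxr_pMr // vnorm_ge0. Qed.

Lemma frame_normD w0 k x y : 0 <= k ->
  frame_norm w0 k (x + y) <= frame_norm w0 k x + frame_norm w0 k y.
Proof.
move=> k_ge0; rewrite frame_norm_le shearD.
have := lexx (frame_norm w0 k x); rewrite {1}frame_norm_le => /andP[x1 xs].
have := lexx (frame_norm w0 k y); rewrite {1}frame_norm_le => /andP[y1 ys].
rewrite vnormD_le //=; have := ler_wpM2l k_ge0 (vnormD (shear w0 x) (shear w0 y)).
by lra.
Qed.

Lemma frame_norm_le_maxnorm w0 k x : 0 <= k ->
  frame_norm w0 k x <= (1 + k * (1 + vnorm w0)) * maxnorm x.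
Proof.
move=> k_ge0; have shear_le := ler_wpM2l k_ge0 (vnorm_shear w0 x).
have := vnorm1_le x; have := maxnorm_ge0 x.
have : 0 <= k * (1 + vnorm w0) * maxnorm x by rewrite !mulr_ge0 ?addr_ge0 ?vnorm_ge0 ?maxnorm_ge0.
by rewrite frame_norm_le; move=> *; apply/andP; split; lra.
Qed.

Lemma maxnorm_le_frame_norm w0 k x : 1 <= k -> maxnorm x <= (1 + vnorm w0) * frame_norm w0 k x.
Proof.
move=> k_ge1; have := lexx (frame_norm w0 k x); rewrite {1}frame_norm_le => /andP[x1 xs].
have {}xs : vnorm (shear w0 x) <= frame_norm w0 k x.
  by apply: le_trans xs; rewrite ler_peMl ?vnorm_ge0.
have w0x1 := vnormM_le (lexx (vnorm w0)) x1.
have x2 : vnorm x.2 <= frame_norm w0 k x + vnorm w0 * frame_norm w0 k x.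
  by rewrite -[x.2](subrK (w0 * x.1)); exact: vnormD_le.
have := mulr_ge0 (vnorm_ge0 w0) (frame_norm_ge0 w0 k x).
by rewrite maxnorm_le => *; apply/andP; split; lra.
Qed.

Lemma frame_norm_eq0 w0 k x : 1 <= k -> frame_norm w0 k x <= 0 -> x = 0.
Proof.
move=> k_ge1 x_le0; have := maxnorm_le_frame_norm w0 x k_ge1.
have -> : frame_norm w0 k x = 0 by apply/eqP; rewrite eq_le x_le0 frame_norm_ge0.
rewrite mulr0 maxnorm_le !le_eqVlt !ltNge !vnorm_ge0 !orbF !vnorm_eq0 => /andP[/eqP x1 /eqP x2].
by case: x x1 x2 {x_le0} => /= ? ? -> ->.
Qed.

Lemma eigenframe_expands M w0 l c h k v : eigenframe M w0 l c h -> 2 <= vnorm l -> 2 <= vnorm h ->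
  4 * vnorm c + 1 <= k -> 7 / 4 * frame_norm w0 k v <= frame_norm w0 k (M v).
Proof.
move=> frameM l_ge h_ge k_ge; have [M1 Ms] := frameM v; have c_ge0 := vnorm_ge0 c.
have [shear_small|shear_large] := leP (k * vnorm (shear w0 v)) (vnorm v.1).
  rewrite {1}/frame_norm max_l // le_max; apply/orP; left; rewrite M1.
  apply: le_trans (vnormD_ge _ _); rewrite !vnormM.
  have : 4 * (vnorm c * vnorm (shear w0 v)) <= vnorm v.1.
    by apply: le_trans shear_small; rewrite mulrA ler_wpM2r ?vnorm_ge0 //; lra.
  by have := ler_wpM2r (vnorm_ge0 v.1) l_ge; lra.
rewrite {1}/frame_norm (max_r (ltW shear_large)) le_max; apply/orP; right; rewrite Ms vnormM.
have ks_ge0 : 0 <= k * vnorm (shear w0 v) by rewrite mulr_ge0 ?vnorm_ge0 //; lra.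
by have := ler_wpM2r ks_ge0 h_ge; lra.
Qed.

(* Strict differentiability makes the expansion uniform in the parameter. *)
Lemma strict_diff_expands g b0 x0 M w0 l c h : strict_diff g b0 x0 x0 M ->
  eigenframe M w0 l c h -> 2 <= vnorm l -> 2 <= vnorm h -> exists k r : R, [/\ 1 <= k, 0 < r &
    forall b x y, `|b - b0| <= r -> maxnorm (x - x0) <= r -> maxnorm (y - x0) <= r ->
    3 / 2 * frame_norm w0 k (x - y) <= frame_norm w0 k (g b x - g b y)].
Proof.
move=> g_diff frameM l_ge h_ge; pose k : R := 4 * vnorm c + 1.
have k_ge1 : 1 <= k by have := vnorm_ge0 c; rewrite /k; lra.
have k_ge0 : 0 <= k by lra.
pose A := (1 + k * (1 + vnorm w0)) * (1 + vnorm w0); have w0_ge0 := vnorm_ge0 w0.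
have kw0_ge0 : 0 <= k * (1 + vnorm w0) by apply: mulr_ge0; lra.
have A_gt0 : 0 < A by apply: mulr_gt0; lra.
have eps_gt0 : 0 < 4^-1 / A by rewrite divr_gt0.
have [r r_gt0 g_near] := g_diff _ eps_gt0; exists k, r; split=> // b x y b_near x_near y_near.
have [err _] := g_near b x y b_near x_near y_near; set E := _ - M (x - y) in err.
have expM := eigenframe_expands (x - y) frameM l_ge h_ge (lexx k).
have E_small : frame_norm w0 k E <= 4^-1 * frame_norm w0 k (x - y).
  apply: le_trans (frame_norm_le_maxnorm _ _ k_ge0) _.
  have coef_ge0 : 0 <= 1 + k * (1 + vnorm w0) by lra.
  apply: le_trans (ler_wpM2l coef_ge0 err) _.
  have := ler_wpM2l (ltW eps_gt0) (maxnorm_le_frame_norm w0 (x - y) k_ge1).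
  move=> /(ler_wpM2l coef_ge0) /le_trans; apply.
  rewrite le_eqVlt; apply/orP; left; apply/eqP.
  have -> : 4^-1 / A = 4^-1 / (1 + k * (1 + vnorm w0)) / (1 + vnorm w0) by rewrite /A invfM mulrA.
  by field; apply/andP; split; apply: lt0r_neq0; lra.
have : frame_norm w0 k (M (x - y)) <= frame_norm w0 k (g b x - g b y) + frame_norm w0 k E.
  have -> : M (x - y) = (g b x - g b y) + - E by rewrite /E opprB [RHS]addrC subrK.
  by rewrite -(frame_normN _ _ E) frame_normD.
by lra.
Qed.

Definition frame_inverse w0 l c h v : K * K :=
  ((v.1 - c * (shear w0 v / (h - 1))) / (l - 1),
   w0 * ((v.1 - c * (shear w0 v / (h - 1))) / (l - 1)) + shear w0 v / (h - 1)).

Lemma bounded_linear_frame_inverse w0 l c h : bounded_linear (frame_inverse w0 l c h).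
Proof.
pose s := (h - 1)^-1; pose a := (l - 1)^-1.
have -> : frame_inverse w0 l c h = matrix2 (a * (1 + c * s * w0), - (a * c * s))
    (w0 * (a * (1 + c * s * w0)) - w0 * s, s - w0 * (a * c * s)).
  by apply/funext => v; rewrite /frame_inverse /matrix2 /shear -/s -/a; congr (_, _) => /=; ring.
exact: bounded_linear_matrix2.
Qed.

Lemma frame_inverseK M w0 l c h v : eigenframe M w0 l c h -> l != 1 -> h != 1 ->
  frame_inverse w0 l c h (M v - v) = v.
Proof.
move=> frameM; rewrite -subr_eq0 -[h == 1]subr_eq0 => l_neq1 h_neq1; have [M1 Ms] := frameM v.
have sE : shear w0 (M v - v) / (h - 1) = shear w0 v.
  by rewrite shearD shearN Ms -{2}[shear w0 v]mul1r -mulrBl mulrAC mulfV // mul1r.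
have v1E : ((M v - v).1 - c * shear w0 v) / (l - 1) = v.1.
  by rewrite /= -[(M v).1]/((M v).1) M1; field.
rewrite /frame_inverse sE v1E; case: (v) => p q; congr (_, _).
by rewrite /shear /=; ring.
Qed.

Lemma frame_inverse_eq0 w0 l c h v : l != 1 -> h != 1 -> frame_inverse w0 l c h v = 0 -> v = 0.
Proof.
rewrite -subr_eq0 -[h == 1]subr_eq0 => l_neq1 h_neq1 [a0]; rewrite a0 mulr0 add0r => /eqP.
rewrite mulf_eq0 invr_eq0 (negbTE h_neq1) orbF => /eqP s0; move: a0; rewrite s0 mul0r mulr0 subr0.
move/eqP; rewrite mulf_eq0 invr_eq0 (negbTE l_neq1) orbF => /eqP v1; move: s0.
by rewrite /shear v1 mulr0 subr0; case: v v1 => /= ? ? -> ->.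
Qed.

End EigenFrame.

Section FixedPoints.
Variable R : realType.

Definition real_ext : valued_ext R :=
  @ValuedExt R R (fun x => `|x|) idfun (@ler_normD R R) (@normrM R) (fun=> erefl).

Implicit Types (x y : real_ext * real_ext) (T : real_ext * real_ext -> real_ext * real_ext).

Lemma maxnorm_fixed_point T x0 (rho : R) : 0 <= rho -> maxnorm (T x0 - x0) <= rho / 2 ->
  (forall x y, maxnorm (x - x0) <= rho -> maxnorm (y - x0) <= rho ->
     maxnorm (T x - T y) <= maxnorm (x - y) / 2) ->
  exists2 x, maxnorm (x - x0) <= rho & T x = x.
Proof.
move=> rho_ge0 T_x0 T_half; pose coords x (j : bool) : R := if j then x.1 else x.2.
pose pt (u : bool -> R) : real_ext * real_ext := (u true, u false).
pose Tb u := coords (T (pt u)); pose rb (_ : bool) := rho.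
have coordsK x : pt (coords x) = x by case: x.
have coords_le x y a : (forall j, `|coords x j - coords y j| <= a) <-> maxnorm (x - y) <= a.
  by rewrite maxnorm_le; split=> [xy|/andP[xy1 xy2] []//]; rewrite (xy true) (xy false).
have box_ball u : box (coords x0) rb u -> maxnorm (pt u - x0) <= rho.
  by move=> bu; apply/(coords_le (pt u) x0 rho) => -[]; [exact: (bu true) | exact: (bu false)].
have Tb_half : halves (coords x0) rb Tb rb.
  move=> D u u' D_ge0 bu bu' uu' j; move: j; apply/(coords_le _ _ (D / 2 * rho)).
  apply: le_trans (T_half _ _ (box_ball _ bu) (box_ball _ bu')) _; rewrite mulrAC ler_pM2r //.
  by apply/(coords_le (pt u) (pt u') (D * rho)) => -[]; [exact: (uu' true) | exact: (uu' false)].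
have [u bu fixed_u] : exists2 u, box (coords x0) rb u & forall j, Tb u j = u j.
  apply: box_fixed_point Tb_half => // u bu j; move: j; apply/(coords_le _ _ rho).
  have x0_near : maxnorm (x0 - x0) <= rho by rewrite subrr maxnorm0.
  have := maxnormD (T (pt u) - T x0) (T x0 - x0); rewrite subrKA.
  by have := T_half _ _ (box_ball _ bu) x0_near; have := box_ball _ bu; lra.
exists (pt u); first exact: box_ball.
by rewrite -[LHS]coordsK /pt -/(Tb u true) -/(Tb u false) !fixed_u.
Qed.

(* Newton's method with the derivative frozen at [b0]: [N] is a left inverse of [M - 1]. *)
Lemma strict_diff_fixed_point g b0 x0 M N : strict_diff g b0 x0 x0 M ->
  bounded_linear N -> (forall v, N (M v - v) = v) -> (forall v, N v = 0 -> v = 0) ->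
  forall rho : R, 0 < rho -> exists2 r : R, 0 < r &
    forall b, `|b - b0| <= r -> exists2 x, maxnorm (x - x0) <= rho & g b x = x.
Proof.
move=> g_diff linN N_inv N_inj rho rho_gt0; have [addN _ [C C_ge0 boundN]] := linN.
have epsT_gt0 : 0 < 2^-1 / (C + 1) by rewrite divr_gt0 //; lra.
have epsT_C : C * (2^-1 / (C + 1)) <= 2^-1 by rewrite mulrCA ger_pMr // ler_pdivrMr; lra.
have [r1 r1_gt0 g_lin] := g_diff _ epsT_gt0; pose s := Num.min r1 rho.
have s_gt0 : 0 < s by rewrite lt_min r1_gt0.
have [s_r1 s_rho] : s <= r1 /\ s <= rho by rewrite /s !ge_min !lexx orbT.
have eps0_gt0 : 0 < s / 2 / (C + 1) by rewrite !divr_gt0 //; lra.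
have eps0_C : C * (s / 2 / (C + 1)) <= s / 2.
  by rewrite mulrCA ger_pMr ?divr_gt0 // ler_pdivrMr; lra.
clearbody s; have [r2 r2_gt0 g_cont] := g_diff _ eps0_gt0; exists (Num.min r1 r2) => [|b].
  by rewrite lt_min r1_gt0.
rewrite le_min => /andP[b_r1 b_r2].
have x0_near (a : R) : 0 < a -> maxnorm (x0 - x0) <= a by rewrite subrr maxnorm0 => /ltW.
pose T x := x - N (g b x - x).
have [||x x_near Tx] := @maxnorm_fixed_point T x0 s (ltW s_gt0).
- have -> : T x0 - x0 = - N (g b x0 - x0) by rewrite /T addrAC subrr sub0r.
  rewrite maxnormN; apply: le_trans (boundN _) (le_trans (ler_wpM2l C_ge0 _) eps0_C).
  by have [_] := g_cont b x0 x0 b_r2 (x0_near _ r2_gt0) (x0_near _ r2_gt0).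
- move=> x y x_near y_near.
  have [err _] := g_lin b x y b_r1 (le_trans x_near s_r1) (le_trans y_near s_r1).
  have -> : T x - T y = - N (g b x - g b y - M (x - y)).
    have -> : g b x - g b y - M (x - y) = ((g b x - x) - (g b y - y)) - (M (x - y) - (x - y)).
      move: (g b x) (g b y) (M (x - y)) => [? ?] [? ?] [? ?].
      by case: (x) (y) => [? ?] [? ?]; congr (_, _) => /=; ring.
    rewrite (bounded_linearB _ _ linN) N_inv (bounded_linearB (g b x - x) _ linN) [RHS]opprB /T.
    by rewrite opprD addrACA -opprD.
  rewrite maxnormN; apply: le_trans (boundN _) _.
  apply: le_trans (ler_wpM2l C_ge0 err) _.
  by rewrite mulrA [leRHS]mulrC ler_wpM2r ?maxnorm_ge0.
exists x; first exact: le_trans s_rho.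
apply/eqP; rewrite -subr_eq0; apply/eqP/N_inj; apply: oppr_inj; rewrite oppr0.
by apply: (addrI x); rewrite addr0.
Qed.

End FixedPoints.

(** * Sources along the tangency curve *)

Section CycleFrame.
Variables (R : realType) (K : valued_ext R) (n m : nat) (b : R).
Hypotheses (n_gt0 : (0 < n)%N) (m_gt0 : (0 < m)%N).
Hypothesis b_range : 2 < b < 3.
Hypothesis closed : defect n m b = 0.
Local Notation tiny := (tiny R).
Local Notation pos := (cycle_pos n m).
Local Notation L := (cycle_length n m).

Let b_range_le : 2 <= b <= 3. Proof. by have := b_range; lra. Qed.

Definition lift2 (x : R * R) : K * K := (vincl x.1, vincl x.2).

Lemma lift2B x y : lift2 (x - y) = lift2 x - lift2 y.
Proof. by rewrite /lift2; congr (_, _); rewrite rmorphB. Qed.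

Lemma lift2_scale2 (c : R) x : lift2 (c * x.1, c * x.2) = scale2 (vincl c) (lift2 x).
Proof. by rewrite /lift2 /scale2 /= !rmorphM. Qed.

Lemma maxnorm_lift2 x : maxnorm (lift2 x) = maxnorm (x : real_ext R * real_ext R).
Proof. by rewrite /maxnorm /= !vnorm_incl. Qed.

Lemma family_map_lift c x : family_map K c (lift2 x) = lift2 (family_map (real_ext R) c x).
Proof.
rewrite /family_map /plane_map /lift2 /= rmorphD (rmorphM vincl (kappa c)^-1).
by rewrite rmorph_zpoly rmorph_wpoly rmorph_qpoly.
Qed.

Lemma iter_family_map_lift c k x :
  iter k (family_map K c) (lift2 x) = lift2 (iter k (family_map (real_ext R) c) x).
Proof. by elim: k => //= k ->; rewrite family_map_lift. Qed.

Definition cycle_pt k : K * K := lift2 (pointz n m b (pos k), pointw n m b (pos k)).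
Definition cycle_vec k : K * K := lift2 (vecz n m b (pos k), vecw n m b (pos k)).

Lemma cycle_pt_fwd k : family_map K b (cycle_pt k) = cycle_pt k.+1.
Proof.
rewrite family_map_lift; congr lift2; congr (_, _) => /=; first exact: pointz_fwd.
by apply: pointw_fwd; exact: cycle_pos_on_cycle.
Qed.

Lemma cycle_vec_fwd k :
  family_diff K b (cycle_pt k) (cycle_vec k) = scale2 (vincl (turn R n m (pos k))) (cycle_vec k.+1).
Proof.
have k_on := cycle_pos_on_cycle n m_gt0 k; rewrite -lift2_scale2 /family_diff /plane_diff /matrix2.
rewrite /= mul0r addr0 -/(dzpoly _ _) -/(dwpoly _ _ _) -/(dqpoly _ _).
rewrite -rmorph_dzpoly -rmorph_dwpoly -rmorph_dqpoly -!rmorphM -rmorphD.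
by congr (vincl _, vincl _); [exact: vecz_fwd | exact: vecw_fwd].
Qed.

Lemma cycle_pt_length : cycle_pt L = cycle_pt 0.
Proof. by rewrite /cycle_pt cycle_pos_length. Qed.

Lemma tangent_cycle_vec k : (k < L)%N -> tangent b cycle_pt k (cycle_vec 0) = cycle_vec k.
Proof.
elim: k => [|k IH] k_lt //=; rewrite IH ?(ltnW k_lt) // cycle_vec_fwd /turn -/(pos k.+1).
have := cycle_pos_eq_None m_gt0 k_lt; rewrite /=; case: (cyc_fwd n m (pos k)) => // i _.
by rewrite rmorph1 /scale2 !mul1r; case: (cycle_vec _).
Qed.

Lemma tangent_cycle_vec_length : tangent b cycle_pt L (cycle_vec 0) = scale2 2 (cycle_vec 0).
Proof.
rewrite /cycle_length -[LHS]/(family_diff K b _ (tangent b cycle_pt (n + m).+1 _)).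
have end_fold : cyc_fwd n m (pos (n + m).+1) = None := cycle_pos_length n m_gt0.
by rewrite tangent_cycle_vec // cycle_vec_fwd /turn end_fold rmorph_nat /cycle_vec /= end_fold.
Qed.

Definition cycle_det : R :=
  \prod_(j < L) - (dwpoly b tiny (pointw n m b (pos j)) * dqpoly tiny (pointz n m b (pos j))).

Lemma cycle_det_ge8 : ~~ odd n -> ~~ odd m -> 8 <= cycle_det.
Proof.
move=> n_even m_even; rewrite /cycle_det prodrN card_ord /cycle_length -signr_odd /=.
rewrite negbK oddD (negbTE n_even) (negbTE m_even) expr0 mul1r.
apply: (@le_trans _ _ ((19 / 10) ^+ (n + m).+2)).
  have : 4%N = (1 + 1).+2 by [].
  have : (4 <= (n + m).+2)%N by rewrite !ltnS; lia.
  by move/(ler_weXn2l (_ : 1 <= 19 / 10 :> R)) => /(_ ltac:(lra)); lra.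
rewrite -[X in _ ^+ X]card_ord -prodr_const ler_prod // => j _.
by rewrite jacobian_bound // divr_ge0.
Qed.

Lemma cycle_frame : exists c : K,
  eigenframe (tangent b cycle_pt L) (vincl (vecw n m b None)) 2 c (vincl (cycle_det / 2)).
Proof.
have two_neq0 : (2 : K) != 0 by exact: natf_neq0_valued.
have vec0E : cycle_vec 0 = (1, vincl (vecw n m b None)).
  by rewrite /cycle_vec /lift2 /= /vecz /= mulr1 rmorph1.
exists (tangent b cycle_pt L (0, 1)).1; rewrite fmorph_div rmorph_nat.
apply: (eigenframe_of_det two_neq0 (bounded_linear_tangent _ _ _)).
  by rewrite -vec0E tangent_cycle_vec_length.
move=> x y; rewrite det2_tangent; congr (_ * _); rewrite /cycle_det rmorph_prod; apply: eq_bigr => j _.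
by rewrite rmorphN (rmorphM vincl (dwpoly _ _ _)) rmorph_dwpoly rmorph_dqpoly.
Qed.

Lemma strict_diff_cycle : strict_diff (fun c => iter L (family_map K c)) b
  (cycle_pt 0) (cycle_pt 0) (tangent b cycle_pt L).
Proof.
rewrite -{2}cycle_pt_length.
by apply: strict_diff_iter => // j; exact: cycle_pt_fwd.
Qed.

Lemma iter_near_cycle (eps : R) k : 0 < eps -> exists2 r : R, 0 < r & forall j c x, (j < k)%N ->
  `|c - b| <= r -> maxnorm (x - cycle_pt 0) <= r ->
  maxnorm (iter j (family_map K c) x - cycle_pt j) <= eps.
Proof.
move=> eps_gt0; elim: k => [|k [r r_gt0 IH]]; first by exists 1.
have [s s_gt0 near] := strict_diff_iter k b_range cycle_pt_fwd eps_gt0.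
exists (Num.min r s) => [|j c x]; first by rewrite lt_min r_gt0.
rewrite !le_min ltnS leq_eqVlt => /predU1P[->|j_lt] /andP[c_r c_s] /andP[x_r x_s].
  by have [] := near c x x c_s x_s x_s.
exact: IH.
Qed.

End CycleFrame.

Section Sources.
Variable R : realType.

Lemma normc_real (r : R) : Normc.normc (real_complex R r) = `|r|.
Proof. by rewrite /Normc.normc /= expr0n /= addr0 sqrtr_sqr. Qed.

Definition complex_ext : valued_ext R :=
  @ValuedExt R (Cx R) (@Normc.normc R) (real_complex R)
    (@le_normcD R) (@Normc.normcM R) normc_real.

Definition expanding (K : valued_ext R) (g : K * K -> K * K) (x : K * K) : Prop :=
  exists (w0 : K) (k rho : R), [/\ 1 <= k, 0 < rho & forall y, maxnorm (y - x) <= rho ->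
    3 / 2 * frame_norm w0 k (y - x) <= frame_norm w0 k (g y - g x)].

Local Notation C := complex_ext.

(* The orbit visits the fold once per period: this is how the sources are told apart. *)
Record source (b : R) (L : nat) (x : C * C) : Prop := Source {
  source_fixed : iter L (family_map C b) x = x;
  source_bounded : forall j, (j < L)%N -> maxnorm (iter j (family_map C b) x) <= 5 / 2;
  source_fold : forall j, (j < L)%N ->
    (vnorm ((iter j (family_map C b) x).1 - 2) < 1 / 2) = (j == 0%N);
  source_expands : expanding (iter L (family_map C b)) x
}.

End Sources.

Section SourceContinuation.
Variables (R : realType) (n m : nat) (b0 : R).
Hypotheses (n_gt0 : (0 < n)%N) (m_gt0 : (0 < m)%N).
Hypotheses (n_even : ~~ odd n) (m_even : ~~ odd m).
Hypothesis b0_range : 2 < b0 < 3.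
Hypothesis closed : defect n m b0 = 0.
Local Notation C := (complex_ext R).
Local Notation L := (cycle_length n m).
Local Notation real_map := (family_map (real_ext R)).
Local Notation real_pt := (cycle_pt (real_ext R) n m b0).
Local Notation complex_pt := (cycle_pt C n m b0).

Let b0_range_le : 2 <= b0 <= 3. Proof. by have := b0_range; lra. Qed.

Lemma cycle_det_half_norm : 4 <= `|cycle_det n m b0 / 2|.
Proof.
have det_ge8 := cycle_det_ge8 n_gt0 m_gt0 b0_range n_even m_even.
by rewrite ger0_norm; lra.
Qed.

Lemma cycle_continuation rho : 0 < rho -> exists2 r : R, 0 < r &
  forall b, `|b - b0| <= r -> exists2 x, maxnorm (x - real_pt 0) <= rho & iter L (real_map b) x = x.
Proof.
have [c frame] := cycle_frame (real_ext R) n_gt0 m_gt0 b0_range closed.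
have h_neq1 : (vincl (cycle_det n m b0 / 2) : real_ext R) != 1.
  by apply/eqP => /= h1; have := cycle_det_half_norm; rewrite h1 normr1; lra.
have two_neq1 : (2 : R) != 1 by rewrite -[1](mulr1n 1) eqr_nat.
apply: (strict_diff_fixed_point (strict_diff_cycle _ n_gt0 m_gt0 b0_range closed)
  (bounded_linear_frame_inverse _ _ _ _)).
- by move=> v; exact: (frame_inverseK v frame two_neq1 h_neq1).
- by move=> v; exact: frame_inverse_eq0.
Qed.

Lemma cycle_expands : exists (w0 : C) (k r : R), [/\ 1 <= k, 0 < r &
  forall b x y, `|b - b0| <= r -> maxnorm (x - complex_pt 0) <= r -> maxnorm (y - complex_pt 0) <= r ->
  3 / 2 * frame_norm w0 k (x - y) <=
  frame_norm w0 k (iter L (family_map C b) x - iter L (family_map C b) y)].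
Proof.
have [c frame] := cycle_frame C n_gt0 m_gt0 b0_range closed.
have two_ge2 : 2 <= vnorm (2 : C) by rewrite vnorm_nat.
have h_ge2 : 2 <= vnorm (vincl (cycle_det n m b0 / 2) : C).
  by rewrite vnorm_incl; have := cycle_det_half_norm; lra.
have [k [r expands]] := strict_diff_expands (strict_diff_cycle C n_gt0 m_gt0 b0_range closed)
  frame two_ge2 h_ge2.
by exists (vincl (vecw n m b0 None)), k, r.
Qed.

Section NearCycle.
Variables (x : R * R) (b : R).
Hypothesis near : forall j, (j < L)%N -> maxnorm (iter j (real_map b) x - real_pt j) <= 10^-1.

Let near1 j : (j < L)%N ->
  `|(iter j (real_map b) x).1 - pointz n m b0 (cycle_pos n m j)| <= 10^-1.
Proof. by move=> j_lt; exact: le_trans (vnorm1_le _) (near j_lt). Qed.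

Let near2 j : (j < L)%N ->
  `|(iter j (real_map b) x).2 - pointw n m b0 (cycle_pos n m j)| <= 10^-1.
Proof. by move=> j_lt; exact: le_trans (vnorm2_le _) (near j_lt). Qed.

Lemma near_cycle_bounded j : (j < L)%N -> maxnorm (iter j (real_map b) x) <= 5 / 2.
Proof.
move=> j_lt; rewrite maxnorm_le; apply/andP; split.
- have := normr_le_near (near1 j_lt) (pointz_norm n_gt0 m_gt0 b0_range_le _).
  by move=> /le_trans; apply; lra.
- have := normr_le_near (near2 j_lt) (pointw_norm n_gt0 m_gt0 b0_range_le _).
  by move=> /le_trans; apply; lra.
Qed.

Lemma near_cycle_fold j : (j < L)%N -> (`|(iter j (real_map b) x).1 - 2| < 1 / 2) = (j == 0%N).
Proof.
move=> j_lt; have := near1 j_lt; rewrite -(cycle_pos_eq_None m_gt0 j_lt).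
case: (cycle_pos n m j) => [i|]; rewrite ?eqxx; move: (iter j _ x).1 => z; rewrite !ler_norml.
  have := pointz_off_fold n_gt0 m_gt0 b0_range_le i; rewrite ler_norml => z0_le z_near.
  by apply/negbTE; rewrite -leNgt ler_normr; apply/orP; right; lra.
have := pointz_fold n_gt0 m_gt0 b0_range_le; rewrite ler_norml => z0_near z_near.
by rewrite ltr_norml; apply/andP; split; lra.
Qed.

End NearCycle.

Lemma source_continuation : exists2 r : R, 0 < r &
  forall b, `|b - b0| <= r -> exists x, source b L x.
Proof.
have [w0 [k [r1 [k_ge1 r1_gt0 expands]]]] := cycle_expands.
have [r2 r2_gt0 near] := iter_near_cycle (real_ext R) n_gt0 m_gt0 b0_range closed L
  (ltac:(lra) : 0 < 10^-1 :> R).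
have rho_gt0 : 0 < Num.min (r1 / 2) r2 by rewrite lt_min r2_gt0 divr_gt0.
have [r3 r3_gt0 continue] := cycle_continuation rho_gt0.
exists (Num.min r1 (Num.min r2 r3)) => [|b]; first by rewrite !lt_min r1_gt0 r2_gt0.
rewrite !le_min => /and3P[b_r1 b_r2 /continue[x]]; rewrite le_min => /andP[x_r1 x_r2] fixed_x.
have near_x j j_lt := near j b x j_lt b_r2 x_r2.
have fixed_lift : iter L (family_map C b) (lift2 C x) = lift2 C x.
  by rewrite iter_family_map_lift fixed_x.
exists (lift2 C x); split=> // [j j_lt|j j_lt|].
- by rewrite iter_family_map_lift maxnorm_lift2; exact: near_cycle_bounded.
- rewrite iter_family_map_lift -(near_cycle_fold near_x j_lt); set y := iter j _ x.
  have -> : (lift2 C y).1 - 2 = vincl (y.1 - 2) by rewrite rmorphB rmorph_nat.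
  by rewrite vnorm_incl.
- have x_near : maxnorm (lift2 C x - complex_pt 0) <= r1 / 2 by rewrite -lift2B maxnorm_lift2.
  exists w0, k, (r1 / 2); split=> // [|y y_near]; first by rewrite divr_gt0.
  apply: expands => //; last by apply: le_trans x_near _; lra.
  by rewrite -(subrKA (lift2 C x)); apply: le_trans (maxnormD _ _) _; lra.
Qed.

End SourceContinuation.

Section PersistentSources.
Variable R : realType.

Lemma source_dense (b1 b2 : R) N : (5 <= N)%N -> 2 <= b1 < b2 -> b2 <= 3 ->
  exists L c d, [/\ (N <= L)%N, b1 <= c, c < d & d <= b2] /\
    forall b, c <= b <= d -> exists x, source b L x.
Proof.
move=> N_ge5 b1_range b2_le3.
have [n [m [b0 [[Nn Nm n_even m_even] [b0_range closed]]]]] := closing_parameters N_ge5 b1_range b2_le3.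
have n_gt0 : (0 < n)%N by lia.
have m_gt0 : (0 < m)%N by lia.
have b0_range3 : 2 < b0 < 3 by lra.
have [r r_gt0 sources] := source_continuation n_gt0 m_gt0 n_even m_even b0_range3 closed.
exists (cycle_length n m), (Num.max b1 (b0 - r)), (Num.min b2 (b0 + r)); split; first split.
- by rewrite /cycle_length; lia.
- by rewrite le_max lexx.
- by rewrite lt_min !gt_max; apply/andP; split; apply/andP; split; lra.
- by rewrite ge_min lexx.
- move=> b; rewrite ge_max le_min => /andP[/andP[_ b_ge] /andP[_ b_le]].
  by apply: sources; rewrite ler_norml; lra.
Qed.

Lemma infinitely_many_sources : exists2 b : R, 2 <= b <= 3 &
  forall N, exists2 L, (N < L)%N & exists x, source b L x.
Proof.
pose good (p : R * R) := 2 <= p.1 < p.2 /\ p.2 <= 3.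
have refine_interval (Np : nat * (R * R)) : exists q, good Np.2 ->
    [/\ good q, Np.2.1 <= q.1, q.2 <= Np.2.2 & exists2 L, (Np.1 < L)%N &
     forall b, q.1 <= b <= q.2 -> exists x, source b L x].
  case: Np => N p; have [[p1 p2]|not_good] := pselect (good p); last by exists p => /not_good.
  have [L [c [d [[NL c_ge cd d_le] sources]]]] := source_dense (leq_addl N 5) p1 p2.
  exists (c, d) => _; split=> //=; first by split=> /=; lra.
  by exists L => //; lia.
have [next nextP] := choice refine_interval.
pose s := fix s k : R * R := if k is k'.+1 then next (k', s k') else (2, 3).
have good_s k : good (s k).
  by elim: k => [|k IH]; [split=> /=; lra | have [] := nextP (k, s k) IH].
have s_step k := nextP (k, s k) (good_s k).
have left_mono : nondecreasing_seq (fst \o s) by apply/nondecreasing_seqP => k; have [] := s_step k.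
have right_mono : nonincreasing_seq (snd \o s) by apply/nonincreasing_seqP => k; have [] := s_step k.
have [k|b b_in] := nested_intervals left_mono right_mono.
  by have [/andP[_ /ltW]] := good_s k.
exists b => [|N]; first exact: (b_in 0%N).
by have [_ _ _ [L NL sources]] := s_step N; exists L => //; apply: sources; exact: (b_in N.+1).
Qed.

End PersistentSources.

(** * The topology of the projective plane *)

Section ComplexContinuity.
Variable R : realType.
Local Notation C := (Cx R).
Local Notation nc := (@vnorm R (complex_ext R)).

Lemma gt0_complex (e : C) : 0 < e -> exists2 r : R, 0 < r & e = real_complex R r.
Proof. by case: e => a b; rewrite ltcE /= => /andP[/eqP b0 a0]; exists a; rewrite //= b0. Qed.

Lemma complex_near (z : C) (r : R) : 0 < r -> \forall y \near z, nc (z - y) < r.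
Proof.
move=> r_gt0; have [/(_ (@cvg_id _ _)) /(_ (real_complex R r)) near _] :=
  @cvgrPdist_lt _ _ _ (nbhs z) _ (@id C) z.
have /near : 0 < real_complex R r by rewrite (ltcR 0).
by apply: filterS => y; rewrite (ltcR (nc (z - y))).
Qed.

Lemma vnorm_continuous : continuous (nc : C -> R).
Proof.
move=> z; apply/(@cvgrPdist_lt _ _ _ (nbhs z) _) => e e_gt0.
apply: filterS (complex_near z e_gt0) => y; apply: le_lt_trans.
by rewrite ler_norml lerBrDr vnormB_ge andbT; have := @vnormB_ge R (complex_ext R) y z; rewrite vdistC; lra.
Qed.

Lemma open_ltr (T : topologicalType) (f g : T -> R) : continuous f -> continuous g ->
  open [set x | f x < g x].
Proof.
move=> cf cg; have -> : [set x | f x < g x] = (fun x => g x - f x) @^-1` [set r | 0 < r].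
  by apply/seteqP; split => x /=; rewrite subr_gt0.
by apply: open_comp => [x _|]; [apply: cvgB; [exact: cg | exact: cf] | exact: open_gt].
Qed.

Variable T : topologicalType.
Implicit Types f g : T -> C.

Lemma complex_cst_continuous (a : C) : continuous (fun _ : T => a).
Proof. by move=> x; exact: (@cvg_cst C a T (nbhs x) _). Qed.

Lemma complex_continuousD f g : continuous f -> continuous g -> continuous (fun x => f x + g x).
Proof. by move=> cf cg x; exact: (@cvgD C C T (nbhs x) _ f g _ _ (cf x) (cg x)). Qed.

Lemma complex_continuousM f g : continuous f -> continuous g -> continuous (fun x => f x * g x).
Proof. by move=> cf cg x; exact: (@cvgM C T (nbhs x) _ f g _ _ (cf x) (cg x)). Qed.

Lemma complex_continuousX f n : continuous f -> continuous (fun x => f x ^+ n).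
Proof.
move=> cf; elim: n => [|n IH]; first exact: complex_cst_continuous.
under eq_fun do rewrite exprS; exact: complex_continuousM.
Qed.

Lemma complex_continuous_sum (I : Type) (r : seq I) (P : pred I) (F : I -> T -> C) :
  (forall i, P i -> continuous (F i)) -> continuous (fun x => \sum_(i <- r | P i) F i x).
Proof.
move=> F_cont; elim: r => [|i r IH].
  have -> : (fun x => \sum_(i <- [::] | P i) F i x) = fun=> 0 by apply/funext => x; rewrite big_nil.
  exact: complex_cst_continuous.
have -> : (fun x => \sum_(j <- i :: r | P j) F j x) =
    fun x => if P i then F i x + \sum_(j <- r | P j) F j x else \sum_(j <- r | P j) F j x.
  by apply/funext => x; rewrite big_cons.
by case Pi: (P i); [exact: (complex_continuousD (F_cont i Pi) IH) | exact: IH].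
Qed.

Lemma vnorm_comp_continuous f : continuous f -> continuous (fun x => nc (f x)).
Proof. by move=> cf x; apply: continuous_comp; [exact: cf | exact: vnorm_continuous]. Qed.

Lemma scaled_vnorm_continuous (a : R) f : continuous f -> continuous (fun x => a * nc (f x)).
Proof.
move=> cf x; apply: (@cvgM R T (nbhs x) _ (fun=> a) (fun y => nc (f y))).
  exact: (@cvg_cst R a T (nbhs x) _).
exact: vnorm_comp_continuous.
Qed.

End ComplexContinuity.

Section ProjectivePlane.
Variable R : realType.
Local Notation C := (Cx R).
Local Notation V := ('rV[C]_3).
Local Notation P2 := (P2 R).
Implicit Types (z : V) (p : P2).

Lemma val_P2_neq0 p : val p != 0.
Proof.
have /existsP[k /andP[/eqP pk _]] := valP p; apply/eqP => p0; move: pk; rewrite p0 mxE => /eqP.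
by rewrite eq_sym oner_eq0.
Qed.

Definition leading_coord z (k : 'I_3) := z 0 k != 0 /\ forall j : 'I_3, (j < k)%N -> z 0 j = 0.

Lemma leading_coord_inj z k k' : leading_coord z k -> leading_coord z k' -> k = k'.
Proof.
move=> [zk z_lt] [zk' z_lt']; apply/val_inj; case: (ltngtP k k') => // [/z_lt'|/z_lt] zE.
  by rewrite zE eqxx in zk.
by rewrite zE eqxx in zk'.
Qed.

Lemma firstnzP z : z != 0 -> exists2 k, firstnz z = Some k & leading_coord z k.
Proof.
move=> z_neq0; rewrite /firstnz; case: pickP => [k /andP[zk /forallP z_lt]|none].
  by exists k => //; split=> // j jk; apply/eqP; have := z_lt j; rewrite jk.
have [k zk] : exists k, z 0 k != 0 by have /rV0Pn := z_neq0.
case: (@arg_minnP _ k (fun k => z 0 k != 0) (fun k : 'I_3 => k : nat) zk) => i zi i_min.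
have := none i; rewrite zi /= => /negbT /forallPn [j]; rewrite negb_imply => /andP[ji zj].
by have := i_min j zj; rewrite leqNgt ji.
Qed.

Lemma P2ofE z k : leading_coord z k -> P2of z = insubd (P2e0 R) ((z 0 k)^-1 *: z).
Proof.
move=> zk; have z_neq0 : z != 0 by apply/rV0Pn; exists k; case: zk.
by rewrite /P2of; have [k' -> /leading_coord_inj/(_ zk) ->] := firstnzP z_neq0.
Qed.

Lemma P2of_val z : z != 0 -> exists2 l, l != 0 & val (P2of z) = l *: z.
Proof.
move=> /firstnzP[k _ [zk z_lt]]; exists (z 0 k)^-1; first by rewrite invr_eq0.
rewrite (@P2ofE z k) // insubdK //; apply/existsP; exists k; rewrite mxE mulVf // eqxx /=.
by apply/forallP => j; apply/implyP => /z_lt zj; rewrite mxE zj mulr0.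
Qed.

Lemma P2of_scale l z : l != 0 -> z != 0 -> P2of (l *: z) = P2of z.
Proof.
move=> l_neq0 /firstnzP[k _ [zk z_lt]].
have lead : leading_coord (l *: z) k.
  by split=> [|j /z_lt zj]; rewrite mxE ?mulf_neq0 // zj mulr0.
rewrite (P2ofE lead) (P2ofE (conj zk z_lt)); congr (insubd _ _).
by rewrite mxE scalerA invfM mulrAC mulVf // mul1r.
Qed.

Lemma P2of_valK p : P2of (val p) = p.
Proof.
have [k /andP[/eqP pk /forallP p_lt]] := existsP (valP p).
have lead : leading_coord (val p) k.
  by split=> [|j jk]; [rewrite pk oner_eq0 | apply/eqP; have := p_lt j; rewrite jk].
by rewrite (P2ofE lead) pk invr1 scale1r valKd.
Qed.

Definition scale_invariant (S : set V) := forall l z, l != 0 -> S z -> S (l *: z).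

Lemma scale_invariantE S l z : scale_invariant S -> l != 0 -> S (l *: z) = S z.
Proof.
move=> S_inv l_neq0; apply/propext; split=> [Slz|]; last exact: S_inv.
by have := S_inv l^-1 _ _ Slz; rewrite invr_eq0 scalerA mulVf // scale1r; apply.
Qed.

Lemma scale_invariantC S : scale_invariant S -> scale_invariant (~` S).
Proof. by move=> S_inv l z l_neq0; rewrite /setC /= (scale_invariantE _ S_inv l_neq0). Qed.

Definition cone_set (S : set V) : set P2 := [set p | S (val p)].

Lemma cone_set_P2of S z : scale_invariant S -> z != 0 -> cone_set S (P2of z) = S z.
Proof. by move=> S_inv /P2of_val[l l_neq0 lE]; rewrite /cone_set /= lE scale_invariantE. Qed.

Lemma open_neq0 : open (~` [set 0 : V]).
Proof.
rewrite openC; apply: accessible_closed_set1.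
exact/hausdorff_accessible/norm_hausdorff.
Qed.

Lemma P2open_cone_set S : scale_invariant S -> open S -> P2open (cone_set S).
Proof.
move=> S_inv S_open; rewrite /P2open.
have -> : [set z : V | z != 0 /\ cone_set S (P2of z)] = ~` [set 0] `&` S.
  apply/seteqP; split=> z /= [].
    by move=> z_neq0; rewrite cone_set_P2of //; split=> //; exact/eqP.
  by move=> /eqP z_neq0 Sz; split=> //; rewrite cone_set_P2of.
exact: openI open_neq0 S_open.
Qed.

(* The type of points, carrying the topology given by [P2open]. *)
Definition P2space := P2.
HB.instance Definition _ := Choice.copy P2space P2.
HB.instance Definition _ := isPointed.Build P2space (P2e0 R).

Lemma P2openT : P2open [set: P2space].
Proof.
have -> : [set: P2space] = cone_set setT by [].
by apply: P2open_cone_set; [|exact: openT].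
Qed.

Lemma P2openI (A B : set P2space) : P2open A -> P2open B -> P2open (A `&` B).
Proof.
move=> oA oB; have := openI oA oB; rewrite /P2open; congr open; apply/seteqP.
by split => z /= => [[[? ?] []]|[? []]].
Qed.

Lemma P2open_bigU (I : Type) (f : I -> set P2space) : (forall i, P2open (f i)) ->
  P2open (\bigcup_i f i).
Proof.
move=> f_open; have := bigcup_open (fun i (_ : setT i) => f_open i); rewrite /P2open; congr open.
apply/seteqP; split=> z /= => [[i _ [z_neq0 fz]]|[z_neq0 [i _ fz]]]; first by split=> //; exists i.
by exists i.
Qed.

HB.instance Definition _ := isOpenTopological.Build P2space P2openT P2openI P2open_bigU.

Lemma open_P2open (U : set P2space) : open U = P2open U.
Proof.
apply/propext; split=> [|oU]; last by rewrite openE => p Up; exists U; split.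
rewrite openE => U_nbhs.
have -> : U = \bigcup_(B : {B : set P2space | P2open B /\ B `<=` U}) projT1 B.
  apply/seteqP; split=> [p Up|p [[B [oB BU]] _ /= Bp]]; last exact: BU.
  by have [B [oB Bp BU]] := U_nbhs p Up; exists (exist _ B (conj oB BU)).
by apply: P2open_bigU => -[B []].
Qed.

Lemma P2closure_closure (S : set P2space) : P2closure S = closure S.
Proof.
apply/seteqP; split=> p /= Sp.
  by move=> B [U [oU Up UB]]; have [q [Uq Sq]] := Sp U oU Up; exists q; split=> //; exact: UB.
move=> U oU Up; have [|q [Sq Uq]] := Sp U; last by exists q.
by exists U; split.
Qed.

Lemma compact_P2compact (A : set P2space) : compact A -> P2compact A.
Proof.
rewrite compact_cover => cA I U U_open AU.
have [||D _ AD] := cA {classic I} setT U.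
- by move=> i _; rewrite open_P2open.
- by move=> p /AU [i _ Uip]; exists i.
by exists ([set` D] : set {classic I}); split; [exact: (finite_fset D) | exact: AD].
Qed.

Lemma open_cone_set S : scale_invariant S -> open S -> open (cone_set S : set P2space).
Proof. by rewrite open_P2open; exact: P2open_cone_set. Qed.

Lemma closed_cone_set S : scale_invariant S -> open (~` S) -> closed (cone_set S : set P2space).
Proof. by move=> S_inv S_open; rewrite -openC; exact: open_cone_set (scale_invariantC S_inv) S_open. Qed.

Lemma P2of_continuous z : z != 0 -> {for z, continuous (@P2of R : V -> P2space)}.
Proof.
move=> z_neq0 A [U [oU Uz UA]]; have := open_nbhs_nbhs (conj oU (conj z_neq0 Uz)).
by apply: filterS => y [_ /UA].
Qed.

Lemma ord3P (Q : 'I_3 -> Prop) : Q 0 -> Q 1 -> Q 2%:R -> forall k, Q k.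
Proof.
move=> Q0 Q1 Q2 [[|[|[|//]]] i].
- by rewrite (_ : Ordinal i = 0) //; apply/val_inj.
- by rewrite (_ : Ordinal i = 1) //; apply/val_inj.
- by rewrite (_ : Ordinal i = 2%:R) //; apply/val_inj.
Qed.

Lemma row3_continuous (T : topologicalType) (F : T -> V) :
  (forall k, continuous (fun x => F x 0 k)) -> continuous F.
Proof.
move=> F_cont x A [P nbhsP PA].
have Fk (k : 'I_3) : nbhs x [set y | P 0 k (F y 0 k)] := F_cont k x _ (nbhsP 0 k).
have : nbhs x [set y | forall k : 'I_3, P 0 k (F y 0 k)].
  apply: filterS (filterI (Fk 0) (filterI (Fk 1) (Fk 2%:R))) => y [F0 [F1 F2]].
  exact: (@ord3P (fun k => P 0 k (F y 0 k))).
by apply: filterS => y Fy; apply: PA => i k; rewrite ord1.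
Qed.

Lemma coord3_continuous (j : 'I_3) : continuous (fun z : V => z 0 j).
Proof. exact: coord_continuous. Qed.

Section Endomorphism.
Variables (d : nat) (c : 'I_3 -> 'I_d.+1 -> 'I_d.+1 -> C).

Lemma hlift_scale l z : hlift c (l *: z) = l ^+ d *: hlift c z.
Proof.
apply/rowP => k; rewrite !mxE /hpoly mulr_sumr; apply: eq_bigr => a _.
rewrite mulr_sumr; apply: eq_bigr => b ab; rewrite !mxE !exprMn.
have -> : l ^+ d = l ^+ a * l ^+ b * l ^+ (d - a - b).
  by rewrite -!exprD -subnDA subnKC.
ring.
Qed.

Lemma hlift_continuous : continuous (hlift c).
Proof.
apply: row3_continuous => k; under eq_fun do rewrite mxE.
do 2!apply: complex_continuous_sum => ? _.
by do !apply: complex_continuousM;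
  (apply: complex_continuousX; exact: coord3_continuous) || exact: complex_cst_continuous.
Qed.

Hypothesis nd : P2nondeg c.

Lemma endo_P2of z : z != 0 -> endo c (P2of z) = P2of (hlift c z).
Proof.
move=> z_neq0; rewrite /endo; have [l l_neq0 ->] := P2of_val z_neq0.
by rewrite hlift_scale P2of_scale ?expf_neq0 // nd.
Qed.

Lemma endo_continuous : continuous (endo c : P2space -> P2space).
Proof.
apply/continuousP => U; rewrite !open_P2open => oU; rewrite /P2open.
have -> : [set z : V | z != 0 /\ (endo c @^-1` U) (P2of z)] =
  ~` [set 0] `&` (hlift c @^-1` [set z | z != 0 /\ U (P2of z)]).
  apply/seteqP; split=> z /= [].
    by move=> z_neq0; rewrite endo_P2of // => Ucz; split; [exact/eqP | split=> //; exact: nd].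
  move=> /eqP z_neq0 [_ Ucz]; split; first exact: z_neq0.
  by rewrite endo_P2of; [exact: Ucz | exact: z_neq0].
apply: openI open_neq0 _; move/continuousP: hlift_continuous; exact.
Qed.

End Endomorphism.

End ProjectivePlane.

Section CompactHausdorff.
Variable R : realType.
Local Notation C := (Cx R).
Local Notation V := ('rV[C]_3).
Local Notation P2space := (P2space R).
Local Notation nc := (@vnorm R (complex_ext R)).

Definition unit_square : set C := [set x | `|complex.Re x| <= 1 /\ `|complex.Im x| <= 1].

Lemma vnorm_complex_le (a c : R) : nc (Complex a c) <= `|a| + `|c|.
Proof.
have -> : Complex a c = real_complex R a + Complex 0 1 * real_complex R c.
  by apply/eqP; rewrite eq_complex /= !mul0r !mulr0 !mul1r ?subr0 ?addr0 ?add0r !eqxx.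
rewrite -(mul1r `|c|); apply: vnormD_le; first by rewrite vnorm_incl.
apply: vnormM_le; last by rewrite vnorm_incl.
by rewrite /vnorm /= expr0n expr1n add0r sqrtr1.
Qed.

Lemma unit_square_compact : compact unit_square.
Proof.
pose h (x : R * R) : C := Complex x.1 x.2.
have -> : unit_square = h @` (`[-1, 1] `*` `[-1, 1]).
  apply/seteqP; split => [[a c] /= [a_le c_le]|_ [[a c] /= [a_le c_le] <-]].
    by exists (a, c) => //=; rewrite !in_itv /= -!ler_norml.
  by move: a_le c_le; rewrite !in_itv /= -!ler_norml.
apply: continuous_compact; last by apply: compact_setX; exact: segment_compact.
apply: continuous_subspaceT => -[x1 x2]; apply/cvgrPdist_lt => e /gt0_complex[r r_gt0 ->].
have r2_gt0 : 0 < r / 2 by lra.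
have near1 : \forall y \near (x1, x2), `|x1 - y.1| < r / 2.
  exact: (@cvgr_dist_lt _ _ _ _ _ _ _ (@cvg_fst _ _ (nbhs x1) (nbhs x2) _)).
have near2 : \forall y \near (x1, x2), `|x2 - y.2| < r / 2.
  exact: (@cvgr_dist_lt _ _ _ _ _ _ _ (@cvg_snd _ _ (nbhs x1) (nbhs x2) _)).
apply: filterS2 near1 near2 => -[y1 y2] /= y1_near y2_near.
have : nc (h (x1, x2) - h (y1, y2)) < r by apply: le_lt_trans (vnorm_complex_le _ _) _; lra.
by rewrite -ltcR.
Qed.

Lemma vnorm_unit_square (x : C) : nc x <= 1 -> unit_square x.
Proof.
case: x => a c; rewrite /vnorm /= => le1; have ac_ge0 : 0 <= a ^+ 2 + c ^+ 2.
  by rewrite addr_ge0 ?sqr_ge0.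
have ac_le1 : a ^+ 2 + c ^+ 2 <= 1.
  by rewrite -(sqr_sqrtr ac_ge0) -(expr1n R 2) ler_sqr ?nnegrE ?sqrtr_ge0.
by split; rewrite -ler_sqr ?nnegrE // expr1n real_normK ?num_real //=;
  have := sqr_ge0 a; have := sqr_ge0 c; lra.
Qed.

Lemma P2_max_coord (p : P2 R) : exists2 k : 'I_3,
  val p 0 k != 0 & forall i, nc (val p 0 i) <= nc (val p 0 k).
Proof.
have [k _ k_max] := @Order.TotalTheory.arg_maxP _ R 'I_3 0 predT (fun k => nc (val p 0 k)) isT.
exists k => [|i]; last exact: k_max.
have [i pi] : exists i, val p 0 i != 0 by apply/rV0Pn; exact: val_P2_neq0.
have : 0 < nc (val p 0 k) by apply: lt_le_trans (k_max i isT); rewrite vnorm_gt0.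
by rewrite vnorm_gt0.
Qed.

Lemma P2space_compact : compact [set: P2space].
Proof.
pose A (k i : 'I_3) : set C := if i == k then [set 1] else unit_square.
pose B (k : 'I_3) : set V := [set v | forall i, A k i (v ord0 i)].
have compactB k : compact ((@P2of R : V -> P2space) @` B k).
  apply: continuous_compact; last first.
    by apply: rV_compact => i; rewrite /A; case: ifP => _; [exact: compact_set1|exact: unit_square_compact].
  apply: continuous_in_subspaceT => v; rewrite inE => Bv; apply: P2of_continuous.
  apply/eqP => v0; have := Bv k; rewrite /A eqxx v0 mxE => /eqP.
  by rewrite eq_sym oner_eq0.
have -> : [set: P2space] = (@P2of R : V -> P2space) @` B 0 `|`
    ((@P2of R : V -> P2space) @` B 1 `|` (@P2of R : V -> P2space) @` B 2%:R).
  apply/seteqP; split=> // p _; have [k pk_neq0 pk_max] := P2_max_coord p.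
  have : ((@P2of R : V -> P2space) @` B k) p.
    exists ((val p 0 k)^-1 *: val p); last first.
      by rewrite P2of_scale ?P2of_valK ?invr_eq0 // val_P2_neq0.
    move=> i; rewrite /A; case: eqP => [->|_]; first by rewrite /= mxE mulVf.
    apply: vnorm_unit_square; rewrite mxE vnormM vnormV.
    by rewrite mulrC ler_pdivrMr ?mul1r ?vnorm_gt0.
  by move: k {pk_neq0 pk_max}; apply: ord3P => Bp; [left | right; left | right; right].
by apply: compactU; [|apply: compactU].
Qed.

Definition minor (p : V) (i j : 'I_3) (z : V) : C := z 0 i * p 0 j - z 0 j * p 0 i.

Lemma minor_scale p i j l z : minor p i j (l *: z) = l * minor p i j z.
Proof. by rewrite /minor !mxE; ring. Qed.

Lemma minorC p q i j : minor q i j p = - minor p i j q.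
Proof. by rewrite /minor; ring. Qed.

Lemma minor_id p i j : minor p i j p = 0.
Proof. by rewrite /minor mulrC subrr. Qed.

Lemma vnorm_minor_continuous p i j : continuous (fun z : V => nc (minor p i j z)).
Proof.
apply: vnorm_comp_continuous; rewrite /minor; under eq_fun do rewrite -mulrN.
by apply: complex_continuousD; apply: complex_continuousM;
  (exact: coord3_continuous || exact: complex_cst_continuous).
Qed.

Lemma minors_eq0 (p q : P2 R) : (forall i j, minor (val p) i j (val q) = 0) -> p = q.
Proof.
move=> minor0; have [k pk] : exists k, val p 0 k != 0 by apply/rV0Pn; exact: val_P2_neq0.
have qE : val q = (val q 0 k / val p 0 k) *: val p.
  apply/rowP => i; rewrite mxE mulrAC; apply: (mulIf pk); rewrite mulfVK //.
  by apply/eqP; rewrite -subr_eq0; apply/eqP; exact: minor0.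
have l_neq0 : val q 0 k / val p 0 k != 0.
  by apply: contra_neq (val_P2_neq0 q) => l0; rewrite qE l0 scale0r.
by rewrite -(P2of_valK q) qE P2of_scale ?val_P2_neq0 // P2of_valK.
Qed.

Lemma P2space_hausdorff : hausdorff_space P2space.
Proof.
rewrite open_hausdorff => p q pq.
have [i [j ij]] : exists i j, minor (val p) i j (val q) != 0.
  apply: contra_neqP pq => /forallNP minor0; apply: minors_eq0 => i j.
  by have /forallNP /(_ j) /negP /negPn /eqP := minor0 i.
pose S p q : set V := [set z | nc (minor p i j z) < nc (minor q i j z)].
have S_open p' q' : open (cone_set (S p' q') : set P2space).
  apply: open_cone_set; last by apply: open_ltr; exact: vnorm_minor_continuous.
  move=> l z l_neq0; rewrite /S /= !minor_scale !vnormM ltr_pM2l //.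
  by rewrite vnorm_gt0.
exists (cone_set (S (val p) (val q)), cone_set (S (val q) (val p))) => /=.
  rewrite !inE /cone_set /S /= !minor_id minorC vnormN.
  by rewrite vnorm0 vnorm_gt0.
split=> //; apply/eqP/seteqP; split=> // x [].
by rewrite /cone_set /S /= => /lt_trans lt_pq /lt_pq; rewrite ltxx.
Qed.

End CompactHausdorff.

(** * Trapping regions *)

Section Traps.
Variables (T : ptopologicalType) (f : T -> T).
Hypotheses (T_compact : compact [set: T]) (T_hausdorff : hausdorff_space T).
Hypothesis f_continuous : continuous f.
Implicit Types (U V : set T) (x y : T).

Definition trap U := open U /\ closure (f @` U) `<=` U.
Definition max_invariant U := \bigcap_(n in [set: nat]) (iter n f @` U).

Lemma iter_continuous n : continuous (iter n f).
Proof.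
elim: n => [|n IH] x; first exact: cvg_id.
by apply: continuous_comp; [exact: IH | exact: f_continuous].
Qed.

Lemma trap_iter U n x : trap U -> U x -> U (iter n f x).
Proof.
move=> [_ fU] Ux; elim: n => //= n IH; apply: fU; apply: subset_closure.
by exists (iter n f x).
Qed.

Lemma max_invariant_compact U : trap U -> compact (max_invariant U).
Proof.
move=> [U_open fU].
have -> : max_invariant U = \bigcap_(n in [set: nat]) (iter n f @` closure (f @` U)).
  apply/seteqP; split=> x Ux n _.
    have [y Uy <-] := Ux n.+1 I; exists (f y); last by rewrite -iterSr.
    by apply: subset_closure; exists y.
  by have [y fUy <-] := Ux n I; exists y => //; exact: fU.
apply: subclosed_compact T_compact _ => //; apply: closed_bigI => n _.
apply: compact_closed => //; apply: continuous_compact.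
  exact/continuous_subspaceT/iter_continuous.
by apply: subclosed_compact T_compact _ => //; exact: closed_closure.
Qed.

Lemma max_invariant_sub U : max_invariant U `<=` U.
Proof. by move=> x /(_ 0%N I) [y Uy <-]. Qed.

Lemma max_invariantS U V : U `<=` V -> max_invariant U `<=` max_invariant V.
Proof. by move=> UV x Ux n _; have [y Uy <-] := Ux n I; exists y => //; exact: UV. Qed.

Lemma periodic_max_invariant U L x : trap U -> (0 < L)%N -> iter L f x = x -> U x ->
  max_invariant U x.
Proof.
move=> trapU L_gt0 periodic Ux n _; exists (iter (n * L - n) f x); first exact: trap_iter.
by rewrite -iterD subnKC ?leq_pmulr // iterM iter_fix.
Qed.

(* A point of the closure of the image lying in [C j] is the image of a point of [C j.+1], unless
   [j = N.-1], where the last hypothesis applies. *)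
Lemma trap_remove U (C O : nat -> set T) N : trap U -> (0 < N)%N ->
  (forall j, closed (C j)) -> (forall j, open (O j)) ->
  (forall j, C j `<=` O j) -> (forall j, O j `<=` C j.+1) ->
  (forall x, U x -> O N.-1 (iter N f x) -> C 0 x) ->
  trap (U `\` \bigcup_(j in `I_N) (iter j f @^-1` C j)).
Proof.
move=> [U_open fU] N_gt0 C_closed O_open CO OC last_C; split.
  apply: openI => //; rewrite openC; apply: closed_bigcup; first exact: finite_II.
  by move=> j _; apply: closed_comp => // x _; exact: iter_continuous.
move=> y y_closure; split.
  by apply: fU; apply: closure_subset y_closure => _ [u [Uu _] <-]; exists u.
move=> [j /= jN Cy].
have y_nbhs : nbhs y (iter j f @^-1` O j).
  apply: open_nbhs_nbhs; split; last exact: CO Cy.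
  by apply: open_comp => // x _; exact: iter_continuous.
have [_ [[u [Uu not_removed] <-] Ou]] := y_closure _ y_nbhs.
move: Ou; rewrite /= -iterSr => Ou; apply: not_removed.
have [jN'|Nj] := ltnP j.+1 N; first by exists j.+1 => //=; apply: OC.
by exists 0%N => //=; apply: last_C => //; have -> : N = j.+1 by apply/eqP; rewrite eqn_leq Nj jN.
Qed.

Lemma bigcap_compact_sub (A : nat -> set T) V : (forall n, compact (A n)) ->
  (forall n, A n.+1 `<=` A n) -> open V -> \bigcap_(n in [set: nat]) A n `<=` V ->
  exists n, A n `<=` V.
Proof.
move=> A_compact A_decr V_open AV.
have A_mono m n : (m <= n)%N -> A n `<=` A m.
  by move=> /subnK <-; elim: (n - m)%N => // k IH; exact: subset_trans (A_decr _) IH.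
have := A_compact 0%N; rewrite compact_cover => /(_ nat setT (fun n => V `|` ~` A n)) [||D _ AD].
- by move=> n _; apply: openU => //; rewrite openC; exact: compact_closed.
- move=> x _; have [Vx|not_Vx] := pselect (V x); first by exists 0%N => //; left.
  have [Ax|/existsNP [n not_Ax]] := pselect (forall n, A n x); first by case: not_Vx; apply: AV => n _.
  by exists n => //; right.
exists (\max_(n <- enum_fset D) n)%N => x Ax.
have [n nD [//|[]]] := AD x (A_mono _ _ (leq0n _) _ Ax).
by apply: A_mono Ax; exact: leq_bigmax_seq.
Qed.

(* A trap containing the intersection contains some [max_invariant (U n)], hence the periodic
   point [x n], which [U n.+1] omits. *)
Lemma bigcap_neq_max_invariant (U : nat -> set T) (x : nat -> T) (L : nat -> nat) V :
  (forall n, trap (U n)) -> (forall n, U n.+1 `<=` U n) -> trap V ->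
  (forall n, (0 < L n)%N /\ iter (L n) f (x n) = x n) ->
  (forall n, U n (x n)) -> (forall n, ~ U n.+1 (x n)) ->
  \bigcap_(n in [set: nat]) max_invariant (U n) <> max_invariant V.
Proof.
move=> trapU U_decr trapV periodic Ux not_Ux eqV.
have [n Un_V] : exists n, max_invariant (U n) `<=` V.
  apply: bigcap_compact_sub.
  - by move=> n; exact: max_invariant_compact.
  - by move=> n; exact: max_invariantS.
  - by case: trapV.
  - by rewrite eqV; exact: max_invariant_sub.
have [L_gt0 fx] := periodic n.
have : max_invariant V (x n).
  apply: (periodic_max_invariant trapV L_gt0 fx); apply: Un_V.
  exact: (periodic_max_invariant (trapU n) L_gt0 fx).
by rewrite -eqV => /(_ n.+1 I) /max_invariant_sub; exact: not_Ux.
Qed.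

End Traps.

Lemma trap_attracting (R : realType) (f : P2space R -> P2space R) U : continuous f -> trap f U ->
  attracting_set f (max_invariant f U).
Proof.
move=> f_continuous trapU; split.
  apply: compact_P2compact; apply: max_invariant_compact => //.
    exact: P2space_compact.
  exact: P2space_hausdorff.
have [U_open fU] := trapU; exists U.
by split; [rewrite -open_P2open | rewrite P2closure_closure].
Qed.

Lemma attracting_trap (R : realType) (f : P2space R -> P2space R) A : attracting_set f A ->
  exists2 U : set (P2space R), trap f U & A = max_invariant f U.
Proof.
move=> [_ [U [U_open [fU ->]]]]; exists U => //.
by split; [rewrite open_P2open | rewrite -P2closure_closure].
Qed.

(** * The endomorphism of the projective plane *)

Section PlaneEndomorphism.
Variables (R : realType) (Lam b e t : Cx R).
Local Notation C := (Cx R).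
Local Notation V := ('rV[C]_3).
Local Notation P2space := (P2space R).
Local Notation plane_map := (@plane_map R (complex_ext R) Lam b e t).

Definition plane_coef (k : 'I_3) (i j : 'I_5) : C :=
  match nat_of_ord k, nat_of_ord i, nat_of_ord j with
  | 0%N, 1%N, 0%N => Lam
  | 0%N, 2%N, 0%N => Lam * (t - 8) / 4
  | 0%N, 3%N, 0%N => Lam * (5 - t) / 4
  | 0%N, 4%N, 0%N => - Lam / 4
  | 0%N, 0%N, 1%N => b
  | 0%N, 0%N, 4%N | 1%N, 4%N, 0%N => e
  | 1%N, 1%N, 0%N | 2%N, 0%N, 0%N => 1
  | _, _, _ => 0
  end.

Definition hom_zpoly (z u : C) : C := z * (u - z) * ((z - 2 * u) ^+ 2 + t * z * u) / 4.

Lemma hlift_plane0 (z : V) : hlift plane_coef z 0 0 =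
  Lam * hom_zpoly (z 0 0) (z 0 2%:R) + b * z 0 1 * z 0 2%:R ^+ 3 + e * z 0 1 ^+ 4.
Proof.
rewrite mxE /hpoly; under eq_bigr do rewrite big_mkcond.
rewrite !(big_ord_recl, big_ord0) /plane_coef /= /bump /= /hom_zpoly.
by move: (z 0 0) (z 0 1) (z 0 2%:R) => z0 z1 z2; field.
Qed.

Lemma hlift_plane1 (z : V) : hlift plane_coef z 0 1 = z 0 0 * z 0 2%:R ^+ 3 + e * z 0 0 ^+ 4.
Proof.
rewrite mxE /hpoly; under eq_bigr do rewrite big_mkcond.
rewrite !(big_ord_recl, big_ord0) /plane_coef /= /bump /=.
by move: (z 0 0) (z 0 1) (z 0 2%:R) => z0 z1 z2; ring.
Qed.

Lemma hlift_plane2 (z : V) : hlift plane_coef z 0 2%:R = z 0 2%:R ^+ 4.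
Proof.
rewrite mxE /hpoly; under eq_bigr do rewrite big_mkcond.
rewrite !(big_ord_recl, big_ord0) /plane_coef /= /bump /=.
by move: (z 0 0) (z 0 1) (z 0 2%:R) => z0 z1 z2; ring.
Qed.

Lemma plane_nondeg : e != 0 -> P2nondeg plane_coef.
Proof.
move=> e_neq0 z; apply: contra_neq => Fz0.
have z2 : z 0 2%:R = 0.
  by have := hlift_plane2 z; rewrite Fz0 mxE => /esym/eqP; rewrite expf_eq0 => /eqP.
have z0 : z 0 0 = 0.
  have := hlift_plane1 z; rewrite Fz0 mxE z2 expr0n mulr0 add0r => /esym/eqP.
  by rewrite mulf_eq0 (negbTE e_neq0) expf_eq0 => /eqP.
have z1 : z 0 1 = 0.
  have := hlift_plane0 z; rewrite Fz0 mxE z2 z0 /hom_zpoly expr0n !mul0r mulr0 mulr0 add0r add0r.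
  by move=> /esym/eqP; rewrite mulf_eq0 (negbTE e_neq0) expf_eq0 => /eqP.
by apply/rowP; apply: ord3P; rewrite mxE.
Qed.

Definition affine_row (x : complex_ext R * complex_ext R) : V :=
  \row_(j < 3) match nat_of_ord j with 0%N => x.1 | 1%N => x.2 | _ => 1 end.
Definition affine_pt x : P2space := P2of (affine_row x).

Lemma affine_rowE x :
  [/\ affine_row x 0 0 = x.1, affine_row x 0 1 = x.2 & affine_row x 0 2%:R = 1].
Proof. by rewrite !mxE. Qed.

Lemma affine_row_neq0 x : affine_row x != 0.
Proof.
by apply/rV0Pn; exists 2%:R; have [_ _ ->] := affine_rowE x; exact: oner_neq0.
Qed.

Lemma affine_pt_inj : injective affine_pt.
Proof.
move=> x y xy; have [l l_neq0 xE] := P2of_val (affine_row_neq0 x).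
have [l' l'_neq0 yE] := P2of_val (affine_row_neq0 y).
have rowE : l *: affine_row x = l' *: affine_row y by rewrite -xE -yE; exact: (congr1 val xy).
have [x0 x1 x2] := affine_rowE x; have [y0 y1 y2] := affine_rowE y.
have ll' : l = l' by have /rowP/(_ 2%:R) := rowE; rewrite !mxE /= !mulr1.
move: rowE; rewrite ll' => /(scalerI l'_neq0) /rowP eq_rows.
have := eq_rows 0; have := eq_rows 1; rewrite x0 x1 y0 y1.
by case: (x) (y) => ? ? [? ?] /= -> ->.
Qed.

Lemma affine_ptK (p : P2space) : val p 0 2%:R != 0 ->
  affine_pt (val p 0 0 / val p 0 2%:R, val p 0 1 / val p 0 2%:R) = p.
Proof.
move=> p2; set x := (_, _); have rowE : affine_row x = (val p 0 2%:R)^-1 *: val p.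
  by apply/rowP; apply: ord3P; rewrite !mxE /= ?mulVf // mulrC.
by rewrite /affine_pt rowE P2of_scale ?invr_eq0 ?val_P2_neq0 // P2of_valK.
Qed.

Lemma plane_endo_pt x : e != 0 -> endo plane_coef (affine_pt x) = affine_pt (plane_map x).
Proof.
move=> e_neq0; rewrite /affine_pt (endo_P2of (plane_nondeg e_neq0) (affine_row_neq0 x)).
congr (@P2of R _); have [x0 x1 x2] := affine_rowE x.
have [y0 y1 y2] := affine_rowE (plane_map x).
apply/rowP; apply: ord3P.
- rewrite hlift_plane0 x0 x1 x2 y0 /hom_zpoly /plane_map /zpoly /wpoly /=.
  by move: x.1 x.2 {x0 x1 x2 y0 y1 y2} => z w; field.
- by rewrite hlift_plane1 x0 x2 y1 expr1n mulr1.
- by rewrite hlift_plane2 x2 y2 expr1n.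
Qed.

Lemma iter_plane_endo_pt n x : e != 0 ->
  iter n (endo plane_coef) (affine_pt x) = affine_pt (iter n plane_map x).
Proof.
move=> e_neq0; elim: n => [|n IH]; first reflexivity.
rewrite !iterS IH; exact: plane_endo_pt.
Qed.

End PlaneEndomorphism.

Section InverseLipschitz.
Variables (R : realType) (K : valued_ext R) (Lam b e t : K).
Hypothesis b_ge : 2 <= vnorm b.
Hypothesis e_le : vnorm e <= 10^-1 ^+ 6.
Hypothesis t_le : vnorm t <= 10^-1 ^+ 3.
Implicit Types x y : K.

Lemma vnorm_nat_le n : vnorm (n%:R : K) <= n%:R.
Proof. by rewrite vnorm_nat. Qed.

Lemma vnorm_ddquartic x y : vnorm x <= 4 -> vnorm y <= 4 -> vnorm (e * ddquartic x y) <= 1 / 2.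
Proof.
move=> x_le y_le; have M := @vnormM_le R K; have D := @vnormD_le R K.
have := M _ _ _ _ e_le (D _ _ _ _ (D _ _ _ _ (D _ _ _ _ (M _ _ _ _ (M _ _ _ _ x_le x_le) x_le)
  (M _ _ _ _ (M _ _ _ _ x_le x_le) y_le)) (M _ _ _ _ (M _ _ _ _ x_le y_le) y_le))
  (M _ _ _ _ (M _ _ _ _ y_le y_le) y_le)).
by rewrite -/(ddquartic x y); lra.
Qed.

Lemma vnorm_ddzpoly x y : vnorm x <= 4 -> vnorm y <= 4 -> vnorm (ddzpoly t x y) <= 200.
Proof.
move=> x_le y_le; have M := @vnormM_le R K; have D := @vnormD_le R K; have B := @vnormB_le R K.
have linear := D _ _ _ _ x_le y_le.
have quadratic := D _ _ _ _ (D _ _ _ _ (M _ _ _ _ x_le x_le) (M _ _ _ _ x_le y_le))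
  (M _ _ _ _ y_le y_le).
have cubic : vnorm (ddquartic x y) <= 256.
  have := D _ _ _ _ (D _ _ _ _ (D _ _ _ _ (M _ _ _ _ (M _ _ _ _ x_le x_le) x_le)
    (M _ _ _ _ (M _ _ _ _ x_le x_le) y_le)) (M _ _ _ _ (M _ _ _ _ x_le y_le) y_le))
    (M _ _ _ _ (M _ _ _ _ y_le y_le) y_le).
  by rewrite -/(ddquartic x y); lra.
have inv4 : vnorm (4^-1 : K) <= 4^-1 by rewrite vnormV vnorm_nat.
have := M _ _ _ _ (B _ _ _ _ (D _ _ _ _ (B _ _ _ _ (D _ _ _ _ (B _ _ _ _ (vnorm_nat_le 4)
  (M _ _ _ _ (vnorm_nat_le 8) linear)) (M _ _ _ _ (vnorm_nat_le 5) quadratic)) cubic)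
  (M _ _ _ _ t_le linear)) (M _ _ _ _ t_le quadratic)) inv4.
by rewrite -/(ddzpoly t x y); lra.
Qed.

Lemma plane_map_inverse_lipschitz : exists2 M : R, 1 <= M & forall u v : K * K,
  maxnorm u <= 4 -> maxnorm v <= 4 ->
  maxnorm (u - v) <= M * maxnorm (plane_map Lam b e t u - plane_map Lam b e t v).
Proof.
exists (2 + 400 * vnorm Lam) => [|u v]; first by have := vnorm_ge0 Lam; lra.
rewrite !maxnorm_le => /andP[u1 u2] /andP[v1 v2].
set D := plane_map _ _ _ _ u - _; have [D1 D2] := (vnorm1_le D, vnorm2_le D).
have D_eq : D = matrix2 (plane_slope1 Lam b e t u v) (plane_slope2 e u v) (u - v).
  exact: plane_mapB.
have D1_eq : b * (u - v).2 = D.1 - Lam * (ddzpoly t u.1 v.1 * (u - v).1)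
    - e * ddquartic u.2 v.2 * (u - v).2.
  by rewrite D_eq /matrix2 /plane_slope1 /ddwpoly /=; ring.
have D2_eq : (u - v).1 = D.2 - e * ddquartic u.1 v.1 * (u - v).1.
  by rewrite D_eq /matrix2 /plane_slope2 /ddqpoly /=; ring.
have D_ge0 := maxnorm_ge0 D; have LamD_ge0 := mulr_ge0 (vnorm_ge0 Lam) D_ge0.
have uv1 : vnorm (u - v).1 <= 2 * maxnorm D.
  have := vnormB_le D2 (vnormM_le (vnorm_ddquartic u1 v1) (lexx (vnorm (u - v).1))).
  by rewrite -D2_eq; lra.
have uv2 : vnorm (u - v).2 <= maxnorm D + vnorm Lam * (200 * (2 * maxnorm D)).
  have := vnormB_le (vnormB_le D1 (vnormM_le (lexx (vnorm Lam)) (vnormM_le (vnorm_ddzpoly u1 v1) uv1)))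
    (vnormM_le (vnorm_ddquartic u2 v2) (lexx (vnorm (u - v).2))).
  by rewrite -D1_eq vnormM; have := ler_wpM2r (vnorm_ge0 (u - v).2) b_ge; lra.
by apply/andP; split; lra.
Qed.

End InverseLipschitz.

Section PlaneTrap.
Variables (R : realType) (Lam b e t : Cx R).
Local Notation C := (Cx R).
Local Notation V := ('rV[C]_3).
Local Notation P2space := (P2space R).
Local Notation nc := (@vnorm R (complex_ext R)).
Local Notation plane_map := (@plane_map R (complex_ext R) Lam b e t).
Local Notation F := (endo (plane_coef Lam b e t) : P2space -> P2space).
Hypothesis Lam_ge : 10 ^+ 5 <= nc Lam.
Hypothesis b_le : nc b <= 3.
Hypothesis e_neq0 : e != 0.
Hypothesis e_le : nc e <= 10^-1 ^+ 6.
Hypothesis t_le : nc t <= 10^-1 ^+ 3.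

Lemma hom_zpoly_growth (z u : C) : 38 / 10 * nc u <= nc z -> 35 / 10 ^+ 3 * nc z ^+ 4 <= nc (hom_zpoly t z u).
Proof.
move=> zu; have u_ge0 := @vnorm_ge0 R (complex_ext R) u; have z_ge0 := @vnorm_ge0 R (complex_ext R) z.
have uz : 7 / 10 * nc z <= nc (u - z).
  by rewrite vdistC; apply: le_trans (vnormB_ge _ _); lra.
have z2u : 47 / 100 * nc z <= nc (z - 2 * u).
  by apply: le_trans (vnormB_ge _ _); rewrite vnormM vnorm_nat; lra.
have square : 2 / 10 * nc z ^+ 2 <= nc ((z - 2 * u) ^+ 2 + t * z * u).
  apply: le_trans (vnormD_ge _ _); rewrite vnormX.
  have : (47 / 100 * nc z) ^+ 2 <= nc (z - 2 * u) ^+ 2 by rewrite ler_sqr // nnegrE ?vnorm_ge0 //; lra.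
  have u_le : nc u <= nc z by lra.
  have := vnormM_le (vnormM_le t_le (lexx (nc z))) u_le.
  by have := sqr_ge0 (nc z); rewrite !expr2; lra.
rewrite /hom_zpoly !vnormM vnormV vnorm_nat.
have zuz : nc z * (7 / 10 * nc z) <= nc z * nc (u - z) by apply: ler_wpM2l.
have zuz_ge0 : 0 <= nc z * (7 / 10 * nc z) by rewrite !mulr_ge0.
have square_ge0 : 0 <= 2 / 10 * nc z ^+ 2 by rewrite mulr_ge0 // sqr_ge0.
have := ler_pM zuz_ge0 square_ge0 zuz square.
have -> : nc z * (7 / 10 * nc z) * (2 / 10 * nc z ^+ 2) = 14 / 100 * nc z ^+ 4 by field.
by lra.
Qed.

(* The leading term dominates because [Lam] is large. *)
Lemma far_growth (z w u : C) : 38 / 10 * nc u <= nc z -> nc w <= 106 / 100 * nc z ->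
  10 ^+ 3 * nc z ^+ 4 <= nc (Lam * hom_zpoly t z u + b * w * u ^+ 3 + e * w ^+ 4).
Proof.
move=> zu wz; have u_ge0 := @vnorm_ge0 R (complex_ext R) u; have z_ge0 := @vnorm_ge0 R (complex_ext R) z.
have w_ge0 := @vnorm_ge0 R (complex_ext R) w; have z4_ge0 : 0 <= nc z ^+ 4 by rewrite exprn_ge0.
have leading : 35 * 10 ^+ 2 * nc z ^+ 4 <= nc (Lam * hom_zpoly t z u).
  rewrite vnormM; have -> : 35 * 10 ^+ 2 * nc z ^+ 4 = 10 ^+ 5 * (35 / 10 ^+ 3 * nc z ^+ 4) by field.
  apply: ler_pM Lam_ge (hom_zpoly_growth zu); first by rewrite exprn_ge0.
  by rewrite mulr_ge0 // divr_ge0 // exprn_ge0.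
have mixed : nc (b * w * u ^+ 3) <= 4 * nc z ^+ 4.
  have u3 : nc (u ^+ 3) <= nc z ^+ 3 by rewrite vnormX lerXn2r ?nnegrE //; lra.
  apply: le_trans (vnormM_le (vnormM_le b_le wz) u3) _.
  have -> : 3 * (106 / 100 * nc z) * nc z ^+ 3 = 318 / 100 * nc z ^+ 4 by field.
  by lra.
have quartic : nc (e * w ^+ 4) <= 4 * nc z ^+ 4.
  have w4 : nc (w ^+ 4) <= (2 * nc z) ^+ 4 by rewrite vnormX lerXn2r ?nnegrE //; lra.
  by apply: le_trans (vnormM_le e_le w4) _; rewrite exprMn; lra.
have := @vnormD_ge R (complex_ext R) (Lam * hom_zpoly t z u + b * w * u ^+ 3) (e * w ^+ 4).
by have := @vnormD_ge R (complex_ext R) (Lam * hom_zpoly t z u) (b * w * u ^+ 3); lra.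
Qed.

Definition plane_cone : set V := [set z | nc (z 0 1) < Num.max (4 * nc (z 0 2%:R)) (nc (z 0 0))].
Definition inner_cone : set V :=
  [set z | nc (z 0 1) <= Num.max (39 / 10 * nc (z 0 2%:R)) (1 / 2 * nc (z 0 0))].

Lemma hlift_plane_cone z : plane_cone z -> inner_cone (hlift (plane_coef Lam b e t) z).
Proof.
rewrite /plane_cone /inner_cone /= hlift_plane0 hlift_plane1 hlift_plane2.
move: (z 0 0) (z 0 1) (z 0 2%:R) => z0 z1 z2 z1_lt.
have z2_ge0 := @vnorm_ge0 R (complex_ext R) z2; have z0_ge0 := @vnorm_ge0 R (complex_ext R) z0.
have coord1 : nc (z0 * z2 ^+ 3 + e * z0 ^+ 4) <= nc z0 * nc z2 ^+ 3 + 10^-1 ^+ 6 * nc z0 ^+ 4.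
  by apply: vnormD_le; [rewrite vnormM vnormX | apply: vnormM_le => //; rewrite vnormX].
apply: le_trans coord1 _; rewrite le_max; have [far|near] := leP (38 / 10 * nc z2) (nc z0).
  apply/orP; right; have z1_le : nc z1 <= 106 / 100 * nc z0.
    by apply: le_trans (ltW z1_lt) _; rewrite ge_max; apply/andP; split; lra.
  have := far_growth far z1_le; have : nc z0 * nc z2 ^+ 3 <= nc z0 * nc z0 ^+ 3.
    by apply: ler_wpM2l => //; apply: lerXn2r; rewrite ?nnegrE //; lra.
  rewrite -exprS; have : 0 <= nc z0 ^+ 4 by rewrite exprn_ge0.
  by move: (nc (_ + _ + _)) (nc z0 ^+ 4) (nc z0 * nc z2 ^+ 3) => *; lra.
apply/orP; left; rewrite vnormX.
have : nc z0 * nc z2 ^+ 3 <= 38 / 10 * nc z2 * nc z2 ^+ 3.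
  by rewrite ler_wpM2r ?exprn_ge0 // ltW.
have : nc z0 ^+ 4 <= (4 * nc z2) ^+ 4 by apply: lerXn2r; rewrite ?nnegrE; lra.
rewrite exprMn -mulrA -exprS; have : 0 <= nc z2 ^+ 4 by rewrite exprn_ge0.
by move: (nc z0 * nc z2 ^+ 3) (nc z2 ^+ 4) (nc z0 ^+ 4) => *; lra.
Qed.

Lemma plane_cone_scale : scale_invariant plane_cone.
Proof.
move=> l z l_neq0; rewrite /plane_cone /= !mxE !vnormM mulrCA.
by rewrite -maxr_pMr ?vnorm_ge0 // ltr_pM2l // vnorm_gt0.
Qed.

Lemma inner_cone_scale : scale_invariant inner_cone.
Proof.
move=> l z l_neq0; rewrite /inner_cone /= !mxE !vnormM mulrCA [1 / 2 * (_ * _)]mulrCA.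
by rewrite -maxr_pMr ?vnorm_ge0 // ler_pM2l // vnorm_gt0.
Qed.

Lemma inner_cone_sub z : z != 0 -> inner_cone z -> plane_cone z.
Proof.
move=> z_neq0; rewrite /inner_cone /plane_cone /= le_max lt_max.
have [z0_ge0 z2_ge0] := (@vnorm_ge0 R (complex_ext R) (z 0 0), @vnorm_ge0 R (complex_ext R) (z 0 2%:R)).
have [z2_gt0|z2_le0] := ltP 0 (nc (z 0 2%:R)).
  have [z1_lt|z1_ge] := ltP (nc (z 0 1)) (nc (z 0 0)); first by rewrite orbT.
  by move=> /orP[] z1_le; apply/orP; left; lra.
have [z0_gt0|z0_le0] := ltP 0 (nc (z 0 0)); first by move=> /orP[] z1_le; apply/orP; right; lra.
move=> z1_le; case/rV0Pn: z_neq0; apply: ord3P; rewrite -(@vnorm_gt0 R (complex_ext R)) => j_gt0.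
- by lra.
- by case/orP: z1_le => z1_le; lra.
- by lra.
Qed.

Lemma scaled_coord_continuous (a : R) (j : 'I_3) : continuous (fun z : V => a * nc (z 0 j)).
Proof. by apply: scaled_vnorm_continuous; exact: coord3_continuous. Qed.

Lemma coord_continuous_vnorm (j : 'I_3) : continuous (fun z : V => nc (z 0 j)).
Proof. by apply: vnorm_comp_continuous; exact: coord3_continuous. Qed.

Definition plane_region : set P2space := cone_set plane_cone.

Lemma plane_region_trap : trap F plane_region.
Proof.
split.
  apply: (open_cone_set plane_cone_scale); apply: open_ltr; first exact: coord_continuous_vnorm.
  by apply: max_fun_continuous; [exact: scaled_coord_continuous | exact: coord_continuous_vnorm].
have inner_closed : closed (cone_set inner_cone : set P2space).
  apply: (closed_cone_set inner_cone_scale).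
  have -> : ~` inner_cone =
      [set z | Num.max (39 / 10 * nc (z 0 2%:R)) (1 / 2 * nc (z 0 0)) < nc (z 0 1)].
    by apply/seteqP; split=> z; rewrite /setC /inner_cone /= ltNge => /negP.
  apply: open_ltr; last exact: coord_continuous_vnorm.
  by apply: max_fun_continuous; exact: scaled_coord_continuous.
apply: (@subset_trans _ (cone_set inner_cone)); last first.
  by move=> p; apply: inner_cone_sub; exact: val_P2_neq0.
have closedE := (closure_id (cone_set inner_cone : set P2space)).1 inner_closed.
rewrite [X in _ `<=` X]closedE; apply: (@closure_subset P2space) => _ [p p_in <-].
rewrite /endo (cone_set_P2of inner_cone_scale); first exact: hlift_plane_cone.
by apply: plane_nondeg => //; exact: val_P2_neq0.
Qed.

Lemma plane_region_proper : plane_region <> setT.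
Proof.
move=> full; pose z : V := \row_j (j == 1)%:R.
have [z0 z1 z2] : [/\ z 0 0 = 0, z 0 1 = 1 & z 0 2%:R = 0] by rewrite !mxE.
have z_neq0 : z != 0 by apply/rV0Pn; exists 1; rewrite z1 oner_neq0.
have : plane_region (P2of z) by rewrite full.
rewrite /plane_region (cone_set_P2of plane_cone_scale) // /plane_cone /= z0 z1 z2.
by rewrite vnorm0 vnorm1 mulr0 maxxx ltr10.
Qed.

Lemma plane_region_pt x : plane_region (affine_pt x) <-> nc x.2 < Num.max 4 (nc x.1).
Proof.
have [x0 x1 x2] := affine_rowE x.
rewrite /plane_region /affine_pt (cone_set_P2of plane_cone_scale) ?affine_row_neq0 //.
by rewrite /plane_cone /= x0 x1 x2 vnorm1 mulr1.
Qed.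

Lemma plane_map_far (u : complex_ext R * complex_ext R) :
  38 / 10 <= vnorm u.1 -> vnorm u.2 <= 106 / 100 * vnorm u.1 -> 3 < vnorm (plane_map u).1.
Proof.
move=> u1_far u2_le; have := @far_growth u.1 u.2 1; rewrite vnorm1 mulr1 => /(_ u1_far u2_le).
have -> : Lam * hom_zpoly t u.1 1 + b * u.2 * 1 ^+ 3 + e * u.2 ^+ 4 = (plane_map u).1.
  by rewrite /plane_map /= /zpoly /wpoly /hom_zpoly; move: u.1 u.2 => z w; field.
apply: lt_le_trans; have : (38 / 10) ^+ 4 <= vnorm u.1 ^+ 4.
  by apply: lerXn2r; rewrite ?nnegrE ?vnorm_ge0 //; lra.
by lra.
Qed.

Lemma plane_map_bounded_preimage (u : complex_ext R * complex_ext R) :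
  vnorm u.2 < Num.max 4 (vnorm u.1) -> maxnorm (plane_map u) < 3 -> maxnorm u <= 4.
Proof.
rewrite gt_max => u_in /andP[map1 _]; have u1 : vnorm u.1 < 38 / 10.
  rewrite ltNge; apply/negP => far; have : 3 < vnorm (plane_map u).1.
    apply: (plane_map_far far); apply: le_trans (ltW u_in) _.
    by rewrite ge_max; apply/andP; split; lra.
  by move=> /(lt_trans map1); rewrite ltxx.
by rewrite maxnorm_le; move: u_in; rewrite lt_max => /orP[] *; apply/andP; split; lra.
Qed.

Lemma plane_region_preimage (p : P2space) x : plane_region p -> F p = affine_pt x -> maxnorm x < 3 ->
  exists u, [/\ p = affine_pt u, plane_map u = x & maxnorm u <= 4].
Proof.
move=> p_in Fp x_lt; have p2 : val p 0 2%:R != 0.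
  have [l l_neq0 lE] := P2of_val (plane_nondeg Lam b t e_neq0 (val_P2_neq0 p)).
  have [l' l'_neq0 l'E] := P2of_val (affine_row_neq0 x).
  have : l *: hlift (plane_coef Lam b e t) (val p) = l' *: affine_row x.
    by rewrite -lE -l'E; exact: (congr1 val Fp).
  move=> /rowP /(_ 2%:R); rewrite mxE hlift_plane2 !mxE /= mulr1.
  by apply: contra_eq_neq => ->; rewrite expr0n mulr0 eq_sym.
have [u pE] : exists u, p = affine_pt u.
  by exists (val p 0 0 / val p 0 2%:R, val p 0 1 / val p 0 2%:R); rewrite affine_ptK.
have mapE : plane_map u = x.
  by apply: (@affine_pt_inj R); rewrite -Fp pE; apply: esym; exact: plane_endo_pt.
exists u; split; [exact: pE | exact: mapE |].
apply: plane_map_bounded_preimage; last by rewrite mapE.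
by apply/plane_region_pt; rewrite -pE.
Qed.

End PlaneTrap.

(** * Sources in the projective plane *)

Section FamilyEndomorphism.
Variables (R : realType) (b : R).
Hypothesis b_range : 2 <= b <= 3.
Local Notation C := (complex_ext R).
Local Notation P2space := (P2space R).
Local Notation nc := (@vnorm R C).
Local Notation incl := (@vincl R C).
Local Notation map := (family_map C b).
Local Notation region := (@plane_region R).

Definition family_coef := plane_coef (incl (kappa b)^-1) (incl b) (incl (tiny R)) (incl (tau b)).
Local Notation F := (endo family_coef : P2space -> P2space).

Lemma family_e_neq0 : incl (tiny R) != 0.
Proof. by rewrite fmorph_eq0 lt0r_neq0 // tiny_gt0. Qed.

Lemma family_Lam_ge : 10 ^+ 5 <= nc (incl (kappa b)^-1).
Proof.
have [k_gt0 k_le] := andP (kappa_range b_range); have [_ tiny_le] := andP (tiny_range R).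
rewrite vnorm_incl gtr0_norm ?invr_gt0 // -[_ ^+ _]invrK lef_pV2 ?posrE ?invr_gt0 ?exprn_gt0 //.
by rewrite -exprVn; lra.
Qed.

Lemma family_b_range : 2 <= nc (incl b) <= 3.
Proof. by rewrite vnorm_incl ger0_norm; have := b_range; lra. Qed.

Lemma family_e_le : nc (incl (tiny R)) <= 10^-1 ^+ 6.
Proof. by rewrite vnorm_incl gtr0_norm ?tiny_gt0. Qed.

Lemma family_t_le : nc (incl (tau b)) <= 10^-1 ^+ 3.
Proof. by rewrite vnorm_incl; exact: (box_tune (tiny_range R) (hom_orbit_box b_range)). Qed.

Lemma family_nondeg : P2nondeg family_coef.
Proof. exact: plane_nondeg family_e_neq0. Qed.

Lemma family_continuous : continuous F.
Proof. exact: endo_continuous family_nondeg. Qed.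

Lemma family_trap : trap F region.
Proof.
have [_ b_le] := andP family_b_range.
exact: (plane_region_trap family_Lam_ge b_le family_e_neq0 family_e_le family_t_le).
Qed.

Lemma iter_family_pt n x : iter n F (affine_pt x) = affine_pt (iter n map x).
Proof. exact: iter_plane_endo_pt family_e_neq0. Qed.

Lemma family_preimage (p : P2space) x : region p -> F p = affine_pt x -> maxnorm x < 3 ->
  exists u, [/\ p = affine_pt u, map u = x & maxnorm u <= 4].
Proof.
have [_ b_le] := andP family_b_range.
exact: (plane_region_preimage family_Lam_ge b_le family_e_neq0 family_e_le family_t_le).
Qed.

Lemma family_inverse_lipschitz : exists2 M : R, 1 <= M & forall u v : C * C,
  maxnorm u <= 4 -> maxnorm v <= 4 -> maxnorm (u - v) <= M * maxnorm (map u - map v).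
Proof.
have [b_ge _] := andP family_b_range.
exact: (plane_map_inverse_lipschitz _ b_ge family_e_le family_t_le).
Qed.

(* All preimages inside the trap of a point near a bounded orbit stay near that orbit. *)
Lemma orbit_pullback (M : R) (y : C * C) L (p : P2space) v : 1 <= M ->
  (forall u v : C * C, maxnorm u <= 4 -> maxnorm v <= 4 ->
     maxnorm (u - v) <= M * maxnorm (map u - map v)) ->
  (forall j, maxnorm (iter j map y) <= 5 / 2) ->
  region p -> iter L F p = affine_pt v -> M ^+ L * maxnorm (v - iter L map y) <= 1 / 4 ->
  exists u, [/\ p = affine_pt u, iter L map u = v &
    maxnorm (u - y) <= M ^+ L * maxnorm (v - iter L map y)].
Proof.
move=> M_ge1 lip y_bounded p_in; have M_ge0 : 0 <= M by lra.
elim: L v => [|L IH] v pv v_near; first by exists v; rewrite expr0 mul1r.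
have v_lt3 : maxnorm v < 3.
  have v_dist : maxnorm (v - iter L.+1 map y) <= 1 / 4.
    by apply: le_trans v_near; rewrite ler_peMl ?maxnorm_ge0 ?exprn_ege1.
  by have := maxnormD (v - iter L.+1 map y) (iter L.+1 map y); rewrite subrK; have := y_bounded L.+1; lra.
have [w [pw map_w w_le]] := family_preimage (trap_iter L family_trap p_in) pv v_lt3.
have y_le4 : maxnorm (iter L map y) <= 4 by apply: le_trans (y_bounded L) _; lra.
have w_near : M ^+ L * maxnorm (w - iter L map y) <= M ^+ L.+1 * maxnorm (v - iter L.+1 map y).
  rewrite exprSr -[leRHS]mulrA; apply: ler_wpM2l; first exact: exprn_ge0.
  by rewrite -map_w; exact: lip.
have [u [pu iter_u u_near]] := IH w pw (le_trans w_near v_near).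
by exists u; split; [exact: pu | rewrite iterS iter_u | exact: le_trans u_near w_near].
Qed.

Lemma source_iter_mod L x j : source b L x -> iter j map x = iter (j %% L) map x.
Proof. by move=> src; rewrite {1}(divn_eq j L) addnC iterD iterM (iter_fix _ (source_fixed src)). Qed.

Lemma source_orbit_bounded L x j : (0 < L)%N -> source b L x -> maxnorm (iter j map x) <= 5 / 2.
Proof. by move=> L_gt0 src; rewrite (source_iter_mod j src) (source_bounded src) ?ltn_pmod. Qed.

Lemma source_unique_period L x L' x' j : (0 < L < L')%N -> source b L x -> source b L' x' ->
  iter j map x' <> x.
Proof.
move=> /andP[L_gt0 LL'] src src' x'E; have L'_gt0 : (0 < L')%N := ltn_trans L_gt0 LL'.
have := source_fold src L_gt0; rewrite eqxx /= -x'E (source_iter_mod j src').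
rewrite (source_fold src') ?ltn_pmod // => /eqP j0.
have xE : x = x' by rewrite -x'E (source_iter_mod j src') j0.
have := source_fold src' LL'; rewrite -{1}xE (source_fixed src) -[x]/(iter 0 map x).
by rewrite (source_fold src L_gt0) eqxx => /esym/eqP L0; rewrite L0 in L_gt0.
Qed.

Lemma source_pullback L x : (0 < L)%N -> source b L x ->
  exists (w0 : C) (k s : R), [/\ 1 <= k, 0 < s & forall (p : P2space) v, region p ->
    iter L F p = affine_pt v -> frame_norm w0 k (v - x) <= s ->
    exists2 u, p = affine_pt u & 3 / 2 * frame_norm w0 k (u - x) <= frame_norm w0 k (v - x)].
Proof.
move=> L_gt0 src; have [w0 [k [rho [k_ge1 rho_gt0 expands]]]] := source_expands src.
have [M M_ge1 lip] := family_inverse_lipschitz; have fixed_x := source_fixed src.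
have w0_gt0 : 0 < 1 + nc w0 by have := vnorm_ge0 w0; lra.
have ML_gt0 : 0 < M ^+ L by apply: exprn_gt0; lra.
pose r := Num.min (1 / 4) rho; have r_gt0 : 0 < r by rewrite lt_min rho_gt0 andbT; lra.
have [r_le4 r_rho] : r <= 1 / 4 /\ r <= rho by rewrite /r !ge_min !lexx orbT.
exists w0, k, (r / (M ^+ L * (1 + nc w0))).
split=> // [|p v p_in pv v_near]; first by rewrite divr_gt0 // mulr_gt0.
have v_dist : M ^+ L * maxnorm (v - iter L map x) <= r.
  rewrite fixed_x; move: v_near; rewrite ler_pdivlMr ?mulr_gt0 // => v_near.
  have := ler_wpM2l (ltW ML_gt0) (maxnorm_le_frame_norm w0 (v - x) k_ge1).
  by move=> /le_trans; apply; rewrite mulrA mulrC.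
have [u [pu iter_u u_near]] := orbit_pullback M_ge1 lip (fun j => source_orbit_bounded j L_gt0 src)
  p_in pv (le_trans v_dist r_le4).
exists u => //; have := expands u (le_trans u_near (le_trans v_dist r_rho)).
by rewrite iter_u fixed_x.
Qed.

End FamilyEndomorphism.

Section FrameBalls.
Variables (R : realType) (x : complex_ext R * complex_ext R) (w0 : complex_ext R) (k : R).
Hypothesis k_ge1 : 1 <= k.
Local Notation C := (complex_ext R).
Local Notation V := ('rV[Cx R]_3).
Local Notation P2space := (P2space R).
Local Notation nc := (@vnorm R C).

Definition offset (z : V) : C * C := (z 0 0 - x.1 * z 0 2%:R, z 0 1 - x.2 * z 0 2%:R).
Definition frame_ball (s : R) : set P2space :=
  cone_set [set z | frame_norm w0 k (offset z) < s * nc (z 0 2%:R)].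
Definition frame_cball (s : R) : set P2space :=
  cone_set [set z | frame_norm w0 k (offset z) <= s * nc (z 0 2%:R)].

Lemma frame_norm_offset_scale l z : frame_norm w0 k (offset (l *: z)) = nc l * frame_norm w0 k (offset z).
Proof.
by rewrite -frame_norm_scale2; congr frame_norm; rewrite /offset /scale2 !mxE; congr (_, _) => /=; ring.
Qed.

Lemma frame_ball_scale s :
  scale_invariant [set z | frame_norm w0 k (offset z) < s * nc (z 0 2%:R)].
Proof.
move=> l z l_neq0; rewrite /= frame_norm_offset_scale mxE vnormM mulrCA ltr_pM2l //.
by rewrite vnorm_gt0.
Qed.

Lemma frame_cball_scale s :
  scale_invariant [set z | frame_norm w0 k (offset z) <= s * nc (z 0 2%:R)].
Proof.
move=> l z l_neq0; rewrite /= frame_norm_offset_scale mxE vnormM mulrCA ler_pM2l //.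
by rewrite vnorm_gt0.
Qed.

Lemma offset_affine_row u : offset (affine_row u) = u - x.
Proof. by have [u0 u1 u2] := affine_rowE u; rewrite /offset u0 u1 u2 !mulr1. Qed.

Lemma frame_ball_pt u s : frame_ball s (affine_pt u) <-> frame_norm w0 k (u - x) < s.
Proof.
have [_ _ u2] := affine_rowE u.
rewrite /frame_ball /affine_pt (cone_set_P2of (@frame_ball_scale s)) ?affine_row_neq0 //=.
by rewrite offset_affine_row u2 vnorm1 mulr1.
Qed.

Lemma frame_cball_pt u s : frame_cball s (affine_pt u) <-> frame_norm w0 k (u - x) <= s.
Proof.
have [_ _ u2] := affine_rowE u.
rewrite /frame_cball /affine_pt (cone_set_P2of (@frame_cball_scale s)) ?affine_row_neq0 //=.
by rewrite offset_affine_row u2 vnorm1 mulr1.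
Qed.

Lemma frame_ball_sub s s' : s <= s' -> frame_ball s `<=` frame_cball s'.
Proof.
move=> ss' p; rewrite /frame_ball /frame_cball /cone_set /= => /ltW /le_trans; apply.
by rewrite ler_wpM2r ?vnorm_ge0.
Qed.

Lemma frame_cball_affine s p : frame_cball s p -> exists u, p = affine_pt u.
Proof.
rewrite /frame_cball /cone_set /= => p_in.
have p2 : val p 0 2%:R != 0.
  apply/eqP => p2; move: p_in; rewrite /offset p2 !mulr0 !subr0 vnorm0 mulr0.
  move=> /(frame_norm_eq0 k_ge1)[p0 p1]; move: (val_P2_neq0 p) => /eqP; apply.
  by apply/rowP; apply: ord3P; rewrite mxE.
by exists (val p 0 0 / val p 0 2%:R, val p 0 1 / val p 0 2%:R); rewrite affine_ptK.
Qed.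

Lemma frame_norm_offset_continuous : continuous (fun z : V => frame_norm w0 k (offset z)).
Proof.
have coord (j : 'I_3) (a : Cx R) : continuous (fun z : V => z 0 j - a * z 0 2%:R).
  under eq_fun do rewrite -mulNr.
  apply: complex_continuousD; first exact: coord3_continuous.
  by apply: complex_continuousM; [exact: complex_cst_continuous | exact: coord3_continuous].
apply: max_fun_continuous; first exact: vnorm_comp_continuous (coord 0 x.1).
apply: scaled_vnorm_continuous.
have -> : (fun z => shear w0 (offset z)) =
    (fun z : V => z 0 1 - x.2 * z 0 2%:R + - w0 * (z 0 0 - x.1 * z 0 2%:R) : Cx R).
  by apply/funext => z; rewrite mulNr.
apply: (complex_continuousD (coord 1 x.2)).
exact: (complex_continuousM (@complex_cst_continuous R V (- w0)) (coord 0 x.1)).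
Qed.

Lemma frame_ball_open s : open (frame_ball s).
Proof.
apply: (open_cone_set (@frame_ball_scale s)); apply: open_ltr; first exact: frame_norm_offset_continuous.
by apply: scaled_vnorm_continuous; exact: coord3_continuous.
Qed.

Lemma frame_cball_closed s : closed (frame_cball s).
Proof.
apply: (closed_cone_set (@frame_cball_scale s)).
have -> : ~` [set z | frame_norm w0 k (offset z) <= s * nc (z 0 2%:R)] =
    [set z : V | s * nc (z 0 2%:R) < frame_norm w0 k (offset z)].
  by apply/seteqP; split=> z; rewrite /setC /= ltNge => /negP.
apply: open_ltr; last exact: frame_norm_offset_continuous.
by apply: scaled_vnorm_continuous; exact: coord3_continuous.
Qed.

End FrameBalls.

Lemma iter_comm_fix (T : Type) (f : T -> T) m n y : iter n f y = y -> iter n (iter m f) y = y.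
Proof. by move=> fy; rewrite -iterM mulnC iterM iter_fix. Qed.

Section SourceRemoval.
Variables (R : realType) (b : R).
Hypothesis b_range : 2 <= b <= 3.
Local Notation C := (complex_ext R).
Local Notation P2space := (P2space R).
Local Notation F := (endo (family_coef b) : P2space -> P2space).
Local Notation region := (@plane_region R).
Variables (L : nat) (x : C * C) (w0 : C) (k s : R).
Hypotheses (L_gt0 : (0 < L)%N) (k_ge1 : 1 <= k) (s_gt0 : 0 < s).
Hypothesis pullback : forall (p : P2space) v, region p -> iter L F p = affine_pt v ->
  frame_norm w0 k (v - x) <= s ->
  exists2 u, p = affine_pt u & 3 / 2 * frame_norm w0 k (u - x) <= frame_norm w0 k (v - x).

(* The backward orbit of a periodic point converges to [x], and contains the point. *)
Lemma periodic_frame_cball n (p : P2space) : (0 < n)%N -> iter n F p = p -> region p ->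
  frame_cball x w0 k s p -> p = affine_pt x.
Proof.
move=> n_gt0 periodic p_in p_ball; have [u pu] := frame_cball_affine k_ge1 p_ball.
have u_le : frame_norm w0 k (u - x) <= s by apply/frame_cball_pt; rewrite -pu.
pose back i := iter (i * n.-1) (iter L F) p.
have Fback i : iter L F (back i.+1) = back i.
  by rewrite /back -iterS mulSn -addSn prednK // addnC iterD (iter_comm_fix L periodic).
have back_in i : region (back i) by rewrite /back -iterM; exact: trap_iter (family_trap b_range) p_in.
have approach i : exists2 v, back i = affine_pt v &
    (3 / 2) ^+ i * frame_norm w0 k (v - x) <= frame_norm w0 k (u - x).
  elim: i => [|i [v backv v_near]]; first by exists u; rewrite ?expr0 ?mul1r.
  have v_le : frame_norm w0 k (v - x) <= s.
    apply: le_trans u_le; apply: le_trans v_near.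
    by rewrite ler_peMl ?frame_norm_ge0 // exprn_ege1 //; lra.
  have [v' backv' v'_near] := pullback (back_in i.+1) (etrans (Fback i) backv) v_le.
  exists v'; first exact: backv'.
  rewrite exprSr -mulrA; apply: le_trans v_near; apply: ler_wpM2l v'_near.
  by rewrite exprn_ge0 // divr_ge0.
have [v backv v_near] := approach n.
have uv : u = v.
  apply: (@affine_pt_inj R); rewrite -pu -backv /back.
  by rewrite mulnC iterM iter_fix // (iter_comm_fix L periodic).
rewrite pu; congr affine_pt; apply/eqP; rewrite -subr_eq0; apply/eqP/(@frame_norm_eq0 _ C w0 k) => //.
have expand : 3 / 2 * frame_norm w0 k (u - x) <= frame_norm w0 k (u - x).
  rewrite -uv in v_near; apply: le_trans v_near; apply: ler_wpM2r; first exact: frame_norm_ge0.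
  by rewrite -[leLHS]expr1; apply: ler_weXn2l => //; lra.
by lra.
Qed.

Let radius j : R := s / 2 * (1 + j / (2 * L%:R)).

Let slope_gt0 : 0 < (2 * L%:R : R)^-1.
Proof. by rewrite invr_gt0 mulr_gt0 // ltr0n. Qed.

Let radius_le i j : i <= j -> radius i <= radius j.
Proof. by move=> ij; rewrite ler_pM2l ?divr_gt0 // lerD2l ler_pM2r. Qed.

Let radius_lt i j : i < j -> radius i < radius j.
Proof. by move=> ij; rewrite ltr_pM2l ?divr_gt0 // ltrD2l ltr_pM2r. Qed.

Let radius0 : radius 0 = s / 2.
Proof. by rewrite /radius mul0r addr0 mulr1. Qed.

Let radiusL : radius L%:R = s * (3 / 4).
Proof. by rewrite /radius; field; rewrite pnatr_eq0 -lt0n. Qed.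

Definition source_cycle_nbhd : set P2space :=
  \bigcup_(j in `I_L) (iter j F @^-1` frame_cball x w0 k (radius j%:R)).

Lemma source_cycle_nbhd_pt : source_cycle_nbhd (affine_pt x).
Proof.
by exists 0%N => //; apply/frame_cball_pt; rewrite subrr frame_norm0 radius0 ltW ?divr_gt0.
Qed.

Lemma trap_remove_source U : trap F U -> U `<=` region -> trap F (U `\` source_cycle_nbhd).
Proof.
move=> trapU U_region; pose O j := frame_ball x w0 k (radius (j%:R + 1 / 2)).
apply: (@trap_remove _ _ (@family_continuous R b) U
  (fun j => frame_cball x w0 k (radius j%:R)) O L trapU L_gt0) => [j|j|j p|j|p Up Op].
- exact: frame_cball_closed.
- exact: frame_ball_open.
- move=> p_in; have [u pu] := frame_cball_affine k_ge1 p_in; move: p_in; rewrite pu.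
  by move=> /frame_cball_pt u_le; apply/frame_ball_pt; apply: le_lt_trans u_le (radius_lt _); lra.
- by apply: frame_ball_sub; apply: radius_le; rewrite -(natr1 j); lra.
- have Cp := frame_ball_sub (lexx _) Op; have [v pv] := frame_cball_affine k_ge1 Cp.
  have v_le : frame_norm w0 k (v - x) <= s * (3 / 4).
    rewrite pv in Cp; move/frame_cball_pt: Cp => v_le; apply: le_trans v_le _; rewrite -radiusL.
    by apply: radius_le; rewrite -[X in _ <= X%:R](prednK L_gt0) -(natr1 L.-1); lra.
  have v_le_s : frame_norm w0 k (v - x) <= s by have := s_gt0; lra.
  have [u pu u_le] := pullback (U_region _ Up) pv v_le_s.
  by rewrite pu; apply/frame_cball_pt; rewrite radius0; have := s_gt0; lra.
Qed.

Lemma periodic_source_cycle_nbhd n (p : P2space) : (0 < n)%N -> iter n F p = p -> region p ->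
  source_cycle_nbhd p -> exists j, iter j F p = affine_pt x.
Proof.
move=> n_gt0 periodic p_in [j /= jL p_ball]; exists j.
apply: (periodic_frame_cball n_gt0).
- by rewrite -iterD addnC iterD periodic.
- exact: trap_iter (family_trap b_range) p_in.
- have [u pu] := frame_cball_affine k_ge1 p_ball; move: p_ball; rewrite pu => /frame_cball_pt u_le.
  apply/frame_cball_pt; apply: le_trans u_le _; apply: (@le_trans _ _ (radius L%:R)).
    by apply: radius_le; rewrite ler_nat ltnW.
  by rewrite radiusL; have := s_gt0; lra.
Qed.

End SourceRemoval.

Lemma ltn_neq_injective (T : Type) (g : nat -> T) : (forall m n, (m < n)%N -> g m <> g n) ->
  injective g.
Proof.
move=> g_neq m n gE; have [mn|nm|//] := ltngtP m n; first by have := g_neq _ _ mn gE.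
by have := g_neq _ _ nm (esym gE).
Qed.

Section SourceSequence.
Variables (R : realType) (b : R).
Hypothesis b_range : 2 <= b <= 3.
Local Notation C := (complex_ext R).
Local Notation P2space := (P2space R).
Local Notation F := (endo (family_coef b) : P2space -> P2space).
Local Notation region := (@plane_region R).

Lemma source_region L x : (0 < L)%N -> source b L x -> region (affine_pt x).
Proof.
move=> L_gt0 src; have := source_bounded src L_gt0; rewrite /= maxnorm_le => /andP[_ x2_le].
by apply/plane_region_pt; rewrite lt_max; apply/orP; left; apply: le_lt_trans x2_le _; lra.
Qed.

Lemma source_periodic L x : source b L x -> iter L F (affine_pt x) = affine_pt x.
Proof. by move=> src; rewrite iter_family_pt (source_fixed src). Qed.

Lemma source_distinct L x L' x' j : (0 < L < L')%N -> source b L x -> source b L' x' ->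
  iter j F (affine_pt x') <> affine_pt x.
Proof.
move=> LL' src src'; rewrite iter_family_pt => /(@affine_pt_inj R).
exact: source_unique_period LL' src src'.
Qed.

Lemma source_removal L x : (0 < L)%N -> source b L x -> exists N : set P2space,
  [/\ N (affine_pt x), forall U, trap F U -> U `<=` region -> trap F (U `\` N) &
      forall n (p : P2space), (0 < n)%N -> iter n F p = p -> region p -> N p ->
        exists j, iter j F p = affine_pt x].
Proof.
move=> L_gt0 /(source_pullback b_range L_gt0)[w0 [k [s [k_ge1 s_gt0 pullback]]]].
exists (source_cycle_nbhd b L x w0 k s); split.
- exact: source_cycle_nbhd_pt.
- by move=> U; exact: trap_remove_source.
- by move=> n p; exact: periodic_source_cycle_nbhd.
Qed.

Hypothesis sources : forall N, exists2 L, (N < L)%N & exists x, source b L x.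

Lemma source_sequence : exists (L : nat -> nat) (x : nat -> C * C),
  [/\ forall n, (0 < L n)%N, {homo L : m n / (m < n)%N} & forall n, source b (L n) (x n)].
Proof.
have next_source N : exists Lx : nat * (C * C), (N < Lx.1)%N /\ source b Lx.1 Lx.2.
  by have [L NL [x src]] := sources N; exists (L, x).
have [next nextP] := choice next_source.
pose s := fix s n := next (if n is n'.+1 then (s n').1 else 0%N).
exists (fun n => (s n).1), (fun n => (s n).2); split.
- by case=> [|n] /=; apply: leq_ltn_trans (nextP _).1.
- by apply: homo_ltn => [|n]; [exact: ltn_trans | exact: (nextP _).1].
- by case=> [|n]; exact: (nextP _).2.
Qed.

(* Removing the sources one after the other from the trap gives a decreasing sequence of traps, to
   which [bigcap_neq_max_invariant] applies. *)
Lemma quasi_attractor_not_attracting : exists Q : set (P2 R),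
  quasi_attractor (endo (family_coef b)) Q /\ ~ attracting_set (endo (family_coef b)) Q.
Proof.
have [L [x [L_gt0 L_incr src]]] := source_sequence.
have [N NP] := choice (fun n => source_removal (L_gt0 n) (src n)).
pose U := fix U n : set P2space := if n is n'.+1 then U n' `\` N n' else region.
have U_region n : U n `<=` region by elim: n => [|n IH] p //= [Up _]; exact: IH.
have trapU n : trap F (U n).
  by elim: n => [|n IH]; [exact: family_trap | have [_ removal _] := NP n; exact: removal].
have Ux m n : (m <= n)%N -> U m (affine_pt (x n)).
  elim: m => [|m IH] mn; first exact: source_region (L_gt0 n) (src n).
  split; first exact: IH (ltnW mn).
  move=> Nx; have [_ _ capture] := NP m.
  have [j] := capture (L n) _ (L_gt0 n) (source_periodic (src n)) (source_region (L_gt0 n) (src n)) Nx.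
  by apply: source_distinct (src m) (src n); rewrite L_gt0 L_incr.
exists (\bigcap_(n in [set: nat]) max_invariant F (U n)); split.
  exists (fun n => max_invariant F (U n)); split; last split=> //.
    by move=> n; apply: trap_attracting => //; exact: family_continuous.
  by move=> n; apply: (@max_invariantS _ F (U n.+1) (U n)) => p [].
move=> /(@attracting_trap R F)[W trapW].
apply: (@bigcap_neq_max_invariant _ F (@P2space_compact R) (@P2space_hausdorff R)
  (@family_continuous R b) U (fun n => affine_pt (x n)) L W trapU) => // [n p []|n|n|n [_]] //.
- by split; [exact: L_gt0 | exact: source_periodic].
- exact: Ux.
- by apply; have [] := NP n.
Qed.

Lemma infinitely_many_cycles :
  (forall L x, (0 < L)%N -> source b L x -> repelling_periodic (endo (family_coef b)) (affine_pt x)) ->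
  ~ finite_set (repelling_cycles_in (endo (family_coef b)) (max_invariant F region)).
Proof.
move=> repelling; have [L [x [L_gt0 L_incr src]]] := source_sequence.
pose cycle n : set (P2 R) := cycle_of (endo (family_coef b)) (affine_pt (x n)).
have cycle_lt m n : (m < n)%N -> cycle m <> cycle n.
  move=> mn cycleE; have : cycle n (affine_pt (x m)) by rewrite -cycleE; exists 0%N.
  by move=> [j _]; apply: source_distinct (src m) (src n); rewrite L_gt0 L_incr.
have cycle_inj := ltn_neq_injective cycle_lt.
have cycles_in : range cycle `<=` repelling_cycles_in (endo (family_coef b)) (max_invariant F region).
  move=> _ [n _ <-]; exists (affine_pt (x n)); split; first exact: repelling (L_gt0 n) (src n).
  split=> // _ [j _ <-]; have trapF := family_trap b_range.
  apply: (periodic_max_invariant trapF (L_gt0 n)).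
    by rewrite -iterD addnC iterD; congr iter; exact: source_periodic.
  exact: trap_iter trapF (source_region (L_gt0 n) (src n)).
move=> /(sub_finite_set cycles_in); rewrite (eq_finite_set (inj_card_eq (in2W cycle_inj))).
exact: infinite_nat.
Qed.

End SourceSequence.

(** * Sources are repelling *)

Section RowPairs.
Variable R : realType.
Local Notation C := (complex_ext R).
Local Notation V2 := ('rV[Cx R]_2).
Local Notation nc := (@vnorm R C).

Definition row_of_pair (x : C * C) : V2 := \row_(j < 2) (if j == 0 then x.1 else x.2).
Definition pair_of_row (u : V2) : C * C := (u 0 0, u 0 1).

Lemma row_of_pairK : cancel row_of_pair pair_of_row.
Proof. by move=> [x1 x2]; rewrite /pair_of_row !mxE. Qed.

Lemma ord2P (Q : 'I_2 -> Prop) : Q 0 -> Q 1 -> forall k, Q k.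
Proof.
move=> Q0 Q1 [[|[|//]] i].
- by rewrite (_ : Ordinal i = 0) //; apply/val_inj.
- by rewrite (_ : Ordinal i = 1) //; apply/val_inj.
Qed.

Lemma pair_of_rowK : cancel pair_of_row row_of_pair.
Proof. by move=> u; apply/rowP; apply: ord2P; rewrite !mxE. Qed.

Lemma pair_of_rowB u v : pair_of_row (u - v) = pair_of_row u - pair_of_row v.
Proof. by rewrite /pair_of_row !mxE. Qed.

Lemma pair_of_rowZ (l : Cx R) u : pair_of_row (l *: u) = scale2 (l : C) (pair_of_row u).
Proof. by rewrite /pair_of_row !mxE. Qed.

Lemma unchart_affine_row u : unchart 2%:R u = affine_row (pair_of_row u).
Proof.
apply/rowP; apply: ord3P; rewrite !mxE.
- have -> : (0 : 'I_3) = lift 2%:R (0 : 'I_2) by apply/val_inj.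
  by rewrite liftK.
- have -> : (1 : 'I_3) = lift 2%:R (1 : 'I_2) by apply/val_inj.
  by rewrite liftK.
- by rewrite unlift_none.
Qed.

Lemma val_affine_pt (x : C * C) : exists2 l : Cx R, l != 0 & val (affine_pt x) = l *: affine_row x.
Proof. exact: P2of_val (affine_row_neq0 x). Qed.

Lemma chart_affine_pt x : chart 2%:R (val (affine_pt x)) = row_of_pair x.
Proof.
have [l l_neq0 xE] := val_affine_pt x; have [x0 x1 x2] := affine_rowE x.
apply/rowP => j; rewrite [LHS]mxE xE !mxE /= mulr1 mulrAC mulfV // mul1r.
by move: j; apply: ord2P.
Qed.

Lemma row_near (u : V2) (eps : R) : 0 < eps ->
  \forall y \near u, maxnorm (pair_of_row y - pair_of_row u) <= eps.
Proof.
move=> eps_gt0; have coord (j : 'I_2) : nbhs u [set y : V2 | nc (u 0 j - y 0 j) < eps].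
  exact: (@coord_continuous (Cx R) 1 2 0 j u _ (complex_near (u 0 j) eps_gt0)).
apply: filterS (filterI (coord 0) (coord 1)) => y [y0 y1].
rewrite maxnorm_le; apply/andP; split; rewrite vdistC; apply: ltW; [exact: y0 | exact: y1].
Qed.

Lemma difference_quotient_near (G : V2 -> V2) (p v : V2) (a : Cx R) (eps delta : R) :
  differentiable G p -> v *m 'J G p = a *: v -> 0 < eps -> 0 < delta ->
  exists h : Cx R, [/\ h != 0, nc h <= delta &
    maxnorm (pair_of_row (h^-1 *: (G (h *: v + p) - G p)) - scale2 (a : C) (pair_of_row v)) <= eps].
Proof.
move=> dG eigen eps_gt0 delta_gt0; pose q (h : Cx R) : V2 := h^-1 *: (G (h *: v + p) - G p).
have q_cvg : q h @[h --> 0^'] --> a *: v.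
  rewrite -eigen -(deriveEjacobian v dG); exact: (@diff_derivable _ _ _ G p v dG).
have q_near : \forall h \near 0^', maxnorm (pair_of_row (q h) - pair_of_row (a *: v)) <= eps.
  exact: q_cvg _ (row_near _ eps_gt0).
have h_small : \forall h \near (0 : Cx R)^', nc (0 - h) < delta.
  by apply: (@cvg_within _ (nbhs (0 : Cx R))); exact: complex_near.
have h_neq0 : \forall h \near (0 : Cx R)^', h != 0 by exact: nbhs_dnbhs_neq.
have [h [[qh h_lt] h0]] := filter_ex (filterI (filterI q_near h_small) h_neq0).
exists h; split=> //; first by move: h_lt; rewrite sub0r vnormN => /ltW.
by rewrite -pair_of_rowZ.
Qed.

(* Expansion of the frame norm passes to the derivative along an eigenvector. *)
Lemma expanding_eigenvalue (g : C * C -> C * C) (x : C * C) (a : Cx R) :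
  g x = x -> expanding g x -> differentiable (row_of_pair \o g \o pair_of_row) (row_of_pair x) ->
  eigenvalue ('J (row_of_pair \o g \o pair_of_row) (row_of_pair x)) a -> 3 / 2 <= nc a.
Proof.
set G := _ \o pair_of_row; move=> gx [w0 [k [rho [k_ge1 rho_gt0 expands]]]] dG /eigenvalueP[v eigen v_neq0].
pose y := pair_of_row v; pose A := 1 + k * (1 + vnorm w0); have k_ge0 : 0 <= k by lra.
have A_gt0 : 0 < A by have := mulr_ge0 k_ge0 (addr_ge0 ler01 (vnorm_ge0 w0)); rewrite /A; lra.
have y_gt0 : 0 < frame_norm w0 k y.
  rewrite ltNge; apply/negP => /(frame_norm_eq0 k_ge1) y0; move/eqP: v_neq0; apply.
  by rewrite -(pair_of_rowK v) -/y y0; apply/rowP; apply: ord2P; rewrite !mxE.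
rewrite leNgt; apply/negP => a_lt; pose eps := (3 / 2 - nc a) * frame_norm w0 k y / 2 / A.
have gap_gt0 : 0 < (3 / 2 - nc a) * frame_norm w0 k y by rewrite mulr_gt0 // subr_gt0.
have eps_gt0 : 0 < eps by rewrite /eps !divr_gt0.
have y1_gt0 : 0 < maxnorm y + 1 by have := maxnorm_ge0 y; lra.
have [h [h_neq0 h_le]] := difference_quotient_near dG eigen eps_gt0 (divr_gt0 rho_gt0 y1_gt0).
set q := _ *: _; have hq : pair_of_row (G (h *: v + row_of_pair x)) - x = scale2 (h : C) (pair_of_row q).
  rewrite -pair_of_rowZ /q scalerA mulfV // scale1r pair_of_rowB; congr (_ - _).
  by rewrite /G /= !row_of_pairK gx.
rewrite -/y => q_near; have h_gt0 : 0 < nc h by rewrite vnorm_gt0.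
have hy : pair_of_row (h *: v + row_of_pair x) - x = scale2 (h : C) y.
  by rewrite -[x in _ - x]row_of_pairK -pair_of_rowB addrK pair_of_rowZ.
have hy_small : maxnorm (scale2 (h : C) y) <= rho.
  move: h_le; rewrite ler_pdivlMr // => h_le; apply: le_trans h_le; rewrite maxnorm_le /= !vnormM.
  have y_le : maxnorm y <= maxnorm y + 1 by rewrite lerDl ler01.
  by apply/andP; split; apply: ler_wpM2l (ltW h_gt0) _ _ (le_trans _ y_le);
    [exact: (vnorm1_le y) | exact: (vnorm2_le y)].
have := expands (pair_of_row (h *: v + row_of_pair x)); rewrite hy gx => /(_ hy_small).
have -> : g (pair_of_row (h *: v + row_of_pair x)) - x = scale2 (h : C) (pair_of_row q).
  by rewrite -hq /G /= row_of_pairK.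
rewrite !frame_norm_scale2 mulrCA ler_pM2l // => q_ge.
have : frame_norm w0 k (pair_of_row q) <= nc a * frame_norm w0 k y + A * eps.
  rewrite -[pair_of_row q](subrK (scale2 (a : C) y)) addrC.
  apply: le_trans (frame_normD _ _ _ k_ge0) _; rewrite frame_norm_scale2 lerD2l.
  by apply: le_trans (frame_norm_le_maxnorm _ _ k_ge0) _; rewrite ler_wpM2l // ltW.
have -> : A * eps = (3 / 2 - nc a) * frame_norm w0 k y / 2 by rewrite /eps mulrC divfK // lt0r_neq0.
by lra.
Qed.

End RowPairs.

Section SourceRepelling.
Variables (R : realType) (b : R).
Local Notation C := (complex_ext R).
Local Notation V2 := ('rV[Cx R]_2).
Local Notation incl := (@vincl R C).
Local Notation map := (family_map C b).

Definition chart_map (u : V2) : V2 := row_of_pair (map (pair_of_row u)).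

Lemma iter_chart_map n u : iter n chart_map u = row_of_pair (iter n map (pair_of_row u)).
Proof.
by elim: n => [|n IH]; rewrite ?pair_of_rowK // !iterS IH /chart_map row_of_pairK.
Qed.

Lemma in_chart_iter n : in_chart 2%:R (iter n (endo (family_coef b))) = iter n chart_map.
Proof.
apply/funext => u; rewrite /in_chart unchart_affine_row iter_chart_map -chart_affine_pt.
exact (congr1 (fun p : P2space R => chart 2%:R (val p)) (iter_family_pt b n (pair_of_row u))).
Qed.

Lemma chart_map_differentiable u : differentiable chart_map u.
Proof.
have dM (f g : V2 -> Cx R) : differentiable f u -> differentiable g u ->
  differentiable (fun u => f u * g u) u by exact: differentiableM.
have dD (f g : V2 -> Cx R) : differentiable f u -> differentiable g u ->
  differentiable (fun u => f u + g u) u by exact: differentiableD.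
have dN (f : V2 -> Cx R) : differentiable f u -> differentiable (fun u => - f u) u.
  exact: differentiableN.
have dc (c : Cx R) : differentiable (fun _ : V2 => c) u by exact: differentiable_cst.
have dX (f : V2 -> Cx R) n : differentiable f u -> differentiable (fun u => f u ^+ n) u.
  move=> df; elim: n => [|n IH]; first exact: dc.
  by have -> : (fun u => f u ^+ n.+1) = (fun u => f u * f u ^+ n); [apply/funext => v; rewrite exprS | exact: dM].
have d0 : differentiable (fun u : V2 => u 0 0) u by exact: differentiable_coord.
have d1 : differentiable (fun u : V2 => u 0 1) u by exact: differentiable_coord.
pose P : V2 -> Cx R := fun u =>
  incl (kappa b)^-1 * (u 0 0 * (1 + - u 0 0) * ((u 0 0 + - 2) ^+ 2 + incl (tau b) * u 0 0) * 4^-1)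
  + (incl b * u 0 1 + incl (tiny R) * u 0 1 ^+ 4).
pose Q : V2 -> Cx R := fun u => u 0 0 + incl (tiny R) * u 0 0 ^+ 4.
have -> : chart_map = (fun u : V2 => P u *: delta_mx 0 0 + Q u *: delta_mx 0 1).
  apply/funext => v; apply/rowP; apply: ord2P; rewrite !mxE /=.
    by rewrite mulr1 mulr0 addr0.
  by rewrite mulr0 mulr1 add0r.
have dP : differentiable P u.
  by repeat first [exact: dc | exact: d0 | exact: d1 | apply: (dD) | apply: (dM) | apply: (dN) | apply: (dX)].
have dQ : differentiable Q u.
  by repeat first [exact: dc | exact: d0 | apply: (dD) | apply: (dM) | apply: (dX)].
by apply: differentiableD; exact: differentiableZl.
Qed.

Lemma iter_chart_map_differentiable n u : differentiable (iter n chart_map) u.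
Proof.
elim: n => [|n IH]; first exact: ex_diff.
exact: (differentiable_comp IH (chart_map_differentiable _)).
Qed.

Lemma source_repelling L x : (0 < L)%N -> source b L x ->
  repelling_periodic (endo (family_coef b)) (affine_pt x).
Proof.
move=> L_gt0 src; exists L; split=> //; split; first exact: source_periodic src.
exists 2%:R; split.
  have [l l_neq0 ->] := val_affine_pt x; have [_ _ x2] := affine_rowE x.
  by rewrite mxE x2 mulr1.
rewrite in_chart_iter chart_affine_pt; split; first exact: iter_chart_map_differentiable.
have chartE : iter L chart_map = row_of_pair (R := R) \o iter L map \o @pair_of_row R.
  by apply/funext => u; exact: iter_chart_map.
have := iter_chart_map_differentiable L (row_of_pair x); rewrite chartE => diff_chart a eigen_a.
have := expanding_eigenvalue (source_fixed src) (source_expands src) diff_chart eigen_a.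
move=> a_ge; have : (1 : R) < Normc.normc a by apply: lt_le_trans a_ge; lra.
by rewrite -ltcR.
Qed.

End SourceRepelling.

Theorem theorem1p5 (R : realType) :
  (exists (d : nat) (c : 'I_3 -> 'I_d.+1 -> 'I_d.+1 -> Cx R),
     (2 <= d)%N /\ P2nondeg c /\
     exists A : set (P2 R),
       proper_attracting_set (endo c) A /\
       ~ finite_set (repelling_cycles_in (endo c) A)) /\
  (exists (d : nat) (c : 'I_3 -> 'I_d.+1 -> 'I_d.+1 -> Cx R),
     (2 <= d)%N /\ P2nondeg c /\
     exists Q : set (P2 R),
       quasi_attractor (endo c) Q /\ ~ attracting_set (endo c) Q).
Proof.
have [b b_range sources] := infinitely_many_sources R.
split; exists 4%N, (family_coef b); split=> //; split; try exact: family_nondeg.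
- exists (max_invariant (endo (family_coef b) : P2space R -> P2space R) (@plane_region R)); split.
    split; first by apply: trap_attracting; [exact: family_continuous | exact: family_trap].
    move=> whole; apply: (@plane_region_proper R); apply/seteqP; split=> // p _.
    by apply: (@max_invariant_sub (P2space R) (endo (family_coef b)) _ p); rewrite whole.
  by apply: infinitely_many_cycles => // L x; exact: source_repelling.
- exact: quasi_attractor_not_attracting.
Qed.
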